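(* Let $d\in\mathbb{N}$, $2<p<\infty$ and $\frac1p<r<\frac12$. Let $\operatorname{I}:\mathbf{W}^r_p(\mathbb{T}^d)\to L_\infty(\mathbb{T}^d)$, $\operatorname{I}f=f$, be the embedding operator. Then for each of the three choices $s_m\in\{d_m,e_m,\sigma_m\}$ (Kolmogorov numbers, dyadic entropy numbers, best $m$-term trigonometric approximation) there is a constant $c>0$, independent of $m$, such that for all integers $m\ge 2$ $$ s_m\big(\operatorname{I}:\mathbf{W}^r_p(\mathbb{T}^d)\to L_\infty(\mathbb{T}^d)\big)\le c\, m^{-r}(\log m)^{(d-1)(1-r)+r}. $$
   Context: $\mathbb{T}^d$ is the $d$-dimensional torus represented by $[0,2\pi]^d$; functions are complex-valued and $2\pi$-periodic in each variable; $\log$ is the natural logarithm. Sobolev space of mixed smoothness: for $r>0$ let $F_r(x):=1+2\sum_{k=1}^\infty k^{-r}\cos(kx)$, $x\in\mathbb{T}$, and $F_r(\mathbf{x}):=\prod_{j=1}^d F_r(x_j)$. For $1<p<\infty$, $\mathbf{W}^r_p(\mathbb{T}^d)$ is the space of all $f\in L_p(\mathbb{T}^d)$ of the form $f(\mathbf{x})=(2\pi)^{-d}\int_{\mathbb{T}^d}F_r(\mathbf{x}-\mathbf{y})\varphi(\mathbf{y})\,d\mathbf{y}$ for some $\varphi\in L_p(\mathbb{T}^d)$, with norm $\|f\|_{\mathbf{W}^r_p}:=\|\varphi\|_p$. (Equivalently, $\hat f(\mathbf{k})=\prod_{j=1}^d\max(1,|k_j|)^{-r}\,\hat\varphi(\mathbf{k})$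 for all $\mathbf{k}\in\mathbb{Z}^d$.) Asymptotic quantities for a bounded linear operator $T:A\to B$ between Banach spaces with unit balls $U_A,U_B$, and $m\in\mathbb{N}=\{1,2,\dots\}$: Kolmogorov numbers: $d_m(T):=\inf_{L\subset B,\ \dim L<m}\ \sup_{\|a\|_A\le1}\ \inf_{b\in L}\|Ta-b\|_B$ (infimum over linear subspaces $L$ of $B$). Entropy numbers: $e_m(T):=\inf\{\varepsilon>0:\exists\, b_1,\dots,b_{2^{m-1}}\in B \text{ with } T(U_A)\subset\bigcup_{k=1}^{2^{m-1}}(b_k+\varepsilon U_B)\}$. Best $m$-term trigonometric approximation (for $B=L_\infty(\mathbb{T}^d)$): $\sigma_m(T):=\sup_{\|a\|_A\le1}\inf_{y\in Y_{m-1}}\|Ta-y\|_\infty$, where $Y_n:=\{\sum_{\mathbf{k}\in\Lambda}c_{\mathbf{k}}e^{i\mathbf{k}\cdot\mathbf{x}}:\Lambda\subset\mathbb{Z}^d,\ |\Lambda|\le n,\ c_{\mathbf{k}}\in\mathbb{C}\}$. *)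

(* Defs.v *)
From HB Require Import structures.
From mathcomp Require Import all_boot all_order all_algebra.
From mathcomp Require Import finmap.
From mathcomp Require Import complex.
From mathcomp Require Import all_classical all_reals all_analysis.

Set Implicit Arguments.
Unset Strict Implicit.
Unset Printing Implicit Defensive.

Import Order.TTheory GRing.Theory Num.Theory.
Import numFieldNormedType.Exports.

Local Open Scope classical_set_scope.
Local Open Scope ring_scope.

(* Spaces are given by an extended seminorm on a complex vector space: the    *)
(* space proper is {x | N x < +oo}, and elements at distance 0 are identified.*)
(* For function spaces this amounts to identifying functions that agree a.e.  *)
Section snumbers.
Variables (R : realType) (A B : lmodType R[i]).
Variables (NA : A -> \bar R) (NB : B -> \bar R) (T : {linear A -> B}).

Definition unit_ball (V : lmodType R[i]) (N : V -> \bar R) : set V :=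
  [set x | (N x <= 1)%E].

(* L is a linear subspace of the space B with dim L <= n. *)
Definition subspace_dim_le (n : nat) (L : set B) : Prop :=
  exists2 g : 'I_n -> B, (forall i, (NB (g i) < +oo)%E) &
    L = [set y | exists c : 'I_n -> R[i], y = \sum_(i < n) c i *: g i].

Definition kolmogorov_number (m : nat) : \bar R :=
  ereal_inf [set ereal_sup [set ereal_inf [set NB (T a - b) | b in L]
                            | a in unit_ball NA]
             | L in [set L | exists2 n, (n < m)%N & subspace_dim_le n L]].

Definition entropy_number (m : nat) : \bar R :=
  ereal_inf [set eps%:E | eps in [set eps : R | 0 < eps /\
    exists2 b : 'I_(2 ^ (m - 1)) -> B, (forall k, (NB (b k) < +oo)%E) &
      T @` unit_ball NA `<=`
        \bigcup_k [set b k + (eps%:C)%C *: u | u in unit_ball NB]]].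

End snumbers.

Section torus.
Variable R : realType.

(* A function on T^d is a function on R^d considered up to a.e. equality on   *)
(* [0, 2pi]^d, the class of its restriction to that cube; its values outside  *)
(* the cube play no role, so that periodicity need not be recorded.           *)
Definition rpoint (d : nat) := d.-tuple (measurableTypeR R).
Definition cfun (d : nat) := rpoint d -> R[i]^o.

Definition circle : set (measurableTypeR R) := `[0, 2 * pi]%classic.

Fact measurable_circle : measurable circle. Proof. exact: measurable_itv. Qed.

Fact lebesgue_circle_fin : (lebesgue_measure circle < +oo)%E.
Proof.
by rewrite lebesgue_measure_itv/=; case: ifP => _; rewrite -?EFinB ltry.
Qed.

Definition circle_measure :
  {finite_measure set (measurableTypeR R) -> \bar R} :=
  mfrestr measurable_circle lebesgue_circle_fin.

Section cons_measure.
Variables (d : nat) (mu : {finite_measure set (rpoint d) -> \bar R}).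

Definition tcons (z : measurableTypeR R * rpoint d) : rpoint d.+1 :=
  [the (d.+1).-tuple _ of z.1 :: z.2].

Fact measurable_tcons :
  measurable_fun [set: measurableTypeR R * rpoint d] tcons.
Proof. exact: measurable_cons. Qed.

Definition cons_measure : set (rpoint d.+1) -> \bar R :=
  pushforward (circle_measure \x mu)%E tcons.

Fact cons_measure0 : cons_measure set0 = 0%E.
Proof. by have mt := measurable_tcons; exact: measure0. Qed.

Fact cons_measure_ge0 A : (0 <= cons_measure A)%E.
Proof. by have mt := measurable_tcons; exact: measure_ge0. Qed.

Fact cons_measure_sigma_additive : semi_sigma_additive cons_measure.
Proof. by have mt := measurable_tcons; exact: measure_semi_sigma_additive. Qed.

HB.instance Definition _ := isMeasure.Build _ _ _ cons_measure
  cons_measure0 cons_measure_ge0 cons_measure_sigma_additive.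

Fact cons_measure_fin : fin_num_fun cons_measure.
Proof.
move=> A mA; rewrite ge0_fin_numE ?measure_ge0//.
apply: (@le_lt_trans _ _ (cons_measure [set: rpoint d.+1])).
  by apply: le_measure; rewrite ?inE.
rewrite /cons_measure /pushforward preimage_setT -setXTT product_measure1E//.
by rewrite lte_mul_pinfty// ?ge0_fin_numE// ltey_eq fin_num_measure.
Qed.

HB.instance Definition _ :=
  Measure_isFinite.Build _ _ _ cons_measure cons_measure_fin.

End cons_measure.

(* Lebesgue measure on [0, 2pi]^d. *)
Fixpoint torus_measure (d : nat) : {finite_measure set (rpoint d) -> \bar R} :=
  match d with
  | 0 => dirac (nil_tuple _ : rpoint 0)
  | d'.+1 => cons_measure (torus_measure d')
  end.

Definition cmeasurable (d : nat) (f : cfun d) : Prop :=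
  measurable_fun [set: rpoint d] (fun x => complex.Re (f x)) /\
  measurable_fun [set: rpoint d] (fun x => complex.Im (f x)).

(* ||f||_p for 1 <= p <= +oo, with value +oo when f is not measurable. *)
Definition Lp_norm (d : nat) (p : \bar R) (f : cfun d) : \bar R :=
  if `[< cmeasurable f >] then
    Lnorm (torus_measure d) p (fun x => (Normc.normc (f x))%:E)
  else +oo%E.

Definition cintegral (d : nat) (f : cfun d) : R[i] :=
  ((\int[torus_measure d]_x complex.Re (f x)) +i*
   (\int[torus_measure d]_x complex.Im (f x)))%C.

(* The series converges for t \notin 2 pi Z; elsewhere lim is unspecified, on *)
(* a null set when used below.                                                *)
Definition Fr1 (r t : R) : R :=
  1 + 2 * limn (fun n => \sum_(1 <= k < n.+1) k%:R `^ (- r) * cos (k%:R * t)).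

Definition Fr (d : nat) (r : R) (x : rpoint d) : R :=
  \prod_(j < d) Fr1 r (tnth x j).

Definition Fr_conv (d : nat) (r : R) (phi : cfun d) : cfun d := fun x =>
  (((2 * pi) ^- d)%:C)%C *
  cintegral (fun y =>
    ((Fr r [tuple tnth x j - tnth y j | j < d])%:C)%C * phi y).

(* ||f||_{W^r_p} = ||phi||_p for the phi in L_p, unique up to a null set,     *)
(* such that f = Fr_conv r phi; it is +oo (infimum of the empty set) when     *)
(* there is no such phi, i.e. when f is not in W^r_p.                         *)
Definition sobolev_norm (d : nat) (r p : R) (f : cfun d) : \bar R :=
  ereal_inf [set Lp_norm p%:E phi | phi in [set phi : cfun d |
    [/\ (Lp_norm p%:E f < +oo)%E, (Lp_norm p%:E phi < +oo)%E &
        \forall x \ae torus_measure d, f x = Fr_conv r phi x]]].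

(* e^{i k.x} *)
Definition trig_monomial (d : nat) (k : d.-tuple int) : cfun d := fun x =>
  let t := \sum_(j < d) (tnth k j)%:~R * tnth x j in (cos t +i* sin t)%C.

Definition trig_polys (d n : nat) : set (cfun d) :=
  [set y | exists (L : {fset d.-tuple int}) (c : d.-tuple int -> R[i]),
    (#|` L| <= n)%N /\ y = \sum_(k <- L) c k *: trig_monomial k].

Definition best_mterm (A : lmodType R[i]) (NA : A -> \bar R) (d : nat)
    (T : {linear A -> cfun d}) (m : nat) : \bar R :=
  ereal_sup [set ereal_inf [set Lp_norm +oo%E (T a - y : cfun d)
                            | y in @trig_polys d (m - 1)]
            | a in unit_ball NA].

End torus.

(* Main.v *)
Require Import Defs.
From HB Require Import structures.
From mathcomp Require Import all_boot all_order all_algebra.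
From mathcomp Require Import finmap.
From mathcomp Require Import complex.
From mathcomp Require Import all_classical all_reals all_analysis.
From mathcomp Require Import measurable_realfun.
From mathcomp Require Import zify ring lra.

Set Implicit Arguments.
Unset Strict Implicit.
Unset Printing Implicit Defensive.

Import Order.TTheory GRing.Theory Num.Theory.
Import numFieldNormedType.Exports.

Local Open Scope classical_set_scope.
Local Open Scope ring_scope.

(* Write f = F_r * phi and treat the real and imaginary parts u of phi one at
   a time. Two summations by parts turn F_r into dyadic blocks of Fejer
   kernels; with a = 2^-r, the tensor block K_s of level |s| = s_1 + ... + s_d
   has L_1 norm O(a^|s|) and sup norm O((2 a)^|s|). Cut u at the heights l^i:
   the layer u_i is bounded by l^i and, since p > 2, its L_2 norm decays in i.
   On u_i the blocks of level > n := n0 + i are small by the L_1 bound. The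
   blocks of level <= n map u_i to a trigonometric polynomial through its
   Fourier coefficients, with weights of square sum O((2 a^2)^n n^(d - 1)), as
   r < 1/2; this finite-dimensional operator is approximated with a budget
   m e^i, e < 1, by a random subspace, a random net or a random sparse
   polynomial, up to sqrt (n / (m e^i)) times its norm. For a suitable l,
   which exists because 1/p < r, all errors decay geometrically in i, and
   2^n0 ~ m (ln m)^(d - 2) balances the two main terms. *)

(** * Random signs in finite dimension *)

(** The obstacle: for r < 1/2 the blocks of high level cannot be summed from an [L_2] bound on phi,
    only from a sup bound, whereas the random methods for low levels feed on an [L_2] bound. A
    function in [L_p] lies in between, and each layer supplies both bounds, at a price l^i for the
    first and with a decay l^(i (2 - p) / 2) in the second. With l = 2^eta the decay conditions read
    eta < r and (1 - 2 r) / (p - 2) < eta; they are compatible exactly when r p > 1. Only about ln m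
    layers are approximated. The rest of u is small in [L_q] for some q between 1/r and p, and
    convolution with F_r still maps [L_q] to bounded functions. The sup norm of a polynomial of
    degree 2^n is read off a grid of 2^O(n) points, whose logarithm is the factor n under the root.
    High blocks err by a^n n^(d - 1), low ones by sqrt (n / m) sqrt ((2 a^2)^n n^(d - 1)); equating
    the two gives n0 and the exponent d - 1 - r (d - 2) of ln m. Fejer kernels serve because, being
    nonnegative, they have [L_1] norms free of logarithms. *)

Section averaging.
Variable R : realType.
Implicit Types (x y s : R).

(** Under a centred law the linear term averages to zero, which leaves the sub-Gaussian bound on
    exponential moments used by the sampling arguments. *)
Lemma expR_le_addr_sqr x : expR x <= x + expR (2 * x ^+ 2).
Proof.
have [x_big|x_small] := lerP 2^-1 x.
  have : expR x <= expR (2 * x ^+ 2) by rewrite ler_expR; nra.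
  lra.
have e1 := expR_ge1Dx (2 * x ^+ 2).
have [x_neg|x_neg] := lerP x (- 2^-1).
  have : expR x <= 1 by rewrite -[leRHS]expR0 ler_expR; lra.
  nra.
(* For [|x| < 1/2] the upper bound comes from squaring and inverting the lower bound 1 - x / 2 of
   exp (- x / 2). *)
have h1 := expR_ge1Dx (- (x / 2)).
suff : expR x <= 1 + x + 2 * x ^+ 2 by lra.
have -> : expR x = (expR (- (x / 2)) ^+ 2)^-1.
  by rewrite -expRM_natl -expRN; congr expR; rewrite mulrN opprK; field.
have h2 : 0 < (1 + - (x / 2)) ^+ 2 by rewrite exprn_gt0//; lra.
have h3 : (1 + - (x / 2)) ^+ 2 <= expR (- (x / 2)) ^+ 2.
  by rewrite lerXn2r// ?nnegrE ?expR_ge0//; lra.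
apply: (@le_trans _ _ ((1 + - (x / 2)) ^+ 2)^-1).
  by rewrite lef_pV2// posrE; exact: lt_le_trans h3.
rewrite -[leLHS]mul1r ler_pdivrMr//.
have -> : (1 + x + 2 * x ^+ 2) * (1 + - (x / 2)) ^+ 2 =
  1 + x ^+ 2 * (5 / 4 - 7 / 4 * x + x ^+ 2 / 2) by field.
rewrite lerDl mulr_ge0 ?sqr_ge0//; nra.
Qed.

Lemma expR_addN_le x : expR x + expR (- x) <= 2 * expR (2 * x ^+ 2).
Proof.
have := expR_le_addr_sqr x; have := expR_le_addr_sqr (- x).
rewrite sqrrN; lra.
Qed.

Lemma sumr_sqr_CauchySchwarz (I : finType) (P : pred I) (f g : I -> R) :
  (\sum_(i | P i) f i * g i) ^+ 2 <=
  (\sum_(i | P i) f i ^+ 2) * (\sum_(i | P i) g i ^+ 2).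
Proof.
set A := \sum_(i | P i) f i ^+ 2; set B := \sum_(i | P i) g i ^+ 2.
set C := \sum_(i | P i) f i * g i.
have B0 : 0 <= B by apply: sumr_ge0 => i _; exact: sqr_ge0.
have H s t : 0 <= s ^+ 2 * A - 2 * s * t * C + t ^+ 2 * B.
  have -> : s ^+ 2 * A - 2 * s * t * C + t ^+ 2 * B =
      \sum_(i | P i) (s * f i - t * g i) ^+ 2.
    rewrite /A /B /C !mulr_sumr -sumrN -!big_split/=.
    by apply: eq_bigr => i _; ring.
  by apply: sumr_ge0 => i _; exact: sqr_ge0.
(* When [B = 0] the quadratic form [H] at [(C, A + 1)] equals - C^2 (A + 2), which forces
   [C = 0]. *)
have [B_eq0|B_neq0] := eqVneq B 0.
  have := H C (A + 1); have : 0 <= A by apply: sumr_ge0 => i _; exact: sqr_ge0.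
  rewrite B_eq0 => A0.
  have -> : C ^+ 2 * A - 2 * C * (A + 1) * C + (A + 1) ^+ 2 * 0 =
    - (C ^+ 2 * (A + 2)) by ring.
  rewrite oppr_ge0 mulr0 pmulr_lle0//; lra.
have B_gt0 : 0 < B by rewrite lt_neqAle eq_sym B_neq0.
have := H B C.
have -> : B ^+ 2 * A - 2 * B * C * C + C ^+ 2 * B = B * (A * B - C ^+ 2) by ring.
by rewrite pmulr_rge0// subr_ge0.
Qed.

Lemma exists_le_average (T : finType) (w F : T -> R) (M : R) :
  (forall t, 0 <= w t) -> \sum_t w t = 1 -> \sum_t w t * F t <= M ->
  exists t, F t <= M.
Proof.
move=> w0 w1 wF; apply: contrapT => /forallNP H.
have [t wt] : exists t, 0 < w t.
  apply: contrapT => /forallNP Hw.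
  have : \sum_t w t = 0.
    apply: big1 => t _; apply/eqP; rewrite eq_le w0 andbT leNgt.
    exact/negP/Hw.
  by rewrite w1 => /eqP; rewrite oner_eq0.
have H' u : 0 <= w u * (F u - M).
  by rewrite mulr_ge0// subr_ge0 ltW// ltNge; exact/negP/H.
have : \sum_u w u * (F u - M) = 0.
  apply/eqP; rewrite eq_le sumr_ge0 ?andbT//.
  under eq_bigr do rewrite mulrBr.
  by rewrite sumrB -mulr_suml w1 mul1r subr_le0.
move=> /psumr_eq0P => /(_ (fun u _ => H' u) t isT) /eqP.
by rewrite mulf_eq0 gt_eqF//= subr_eq0 => /eqP FM; apply: (H t); rewrite FM.
Qed.

(* Maurey's argument: sample independently, one term at a time. *)
Lemma exists_sample_sqr (T U : finType) (w : T -> R) (h : T -> U -> R) (B : R) :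
  (forall t, 0 <= w t) -> \sum_t w t = 1 ->
  (forall u, \sum_t w t * h t u = 0) ->
  \sum_t w t * (\sum_u h t u ^+ 2) <= B ->
  forall k : nat, exists2 l : seq T, size l = k &
    \sum_u (\sum_(t <- l) h t u) ^+ 2 <= k%:R * B.
Proof.
move=> w0 w1 hw hB; elim=> [|k [l lk IH]].
  exists [::] => //; rewrite mul0r big1// => u _.
  by rewrite big_nil expr0n.
pose S u := \sum_(t <- l) h t u.
have [t tP] : exists t, \sum_u (h t u + S u) ^+ 2 <= k.+1%:R * B.
  apply: (@exists_le_average _ w) => //.
  rewrite [leLHS](_ : _ = \sum_t w t * (\sum_u h t u ^+ 2) +
     2 * (\sum_u S u * \sum_t w t * h t u) + (\sum_u S u ^+ 2)).
    rewrite [X in 2 * X]big1 ?mulr0 ?addr0; last by move=> u _; rewrite hw mulr0.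
    by rewrite -natr1 mulrDl mul1r addrC lerD.
  under [X in 2 * X]eq_bigr do rewrite mulr_sumr.
  rewrite exchange_big/= mulr_sumr.
  have -> : \sum_u S u ^+ 2 = \sum_t w t * \sum_u S u ^+ 2.
    by rewrite -mulr_suml w1 mul1r.
  rewrite -!big_split/=; apply: eq_bigr => t _.
  rewrite !mulr_sumr -!big_split/=; apply: eq_bigr => u _; ring.
exists (t :: l); first by rewrite /= lk.
by under eq_bigr do rewrite big_cons.
Qed.

(** Exponential counterpart of the previous sampling: each well-chosen draw multiplies the sum over
    [u] by at most exp (2 c^2). One sum of exponentials controls all [u] at once, at a cost
    logarithmic in [#|U|]. *)
Lemma exists_sample_exp (T U : finType) (w : T -> R) (h : T -> U -> R) (c : R) :
  (forall t, 0 <= w t) -> \sum_t w t = 1 ->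
  (forall u, \sum_t w t * h t u = 0) ->
  (forall t u, `|h t u| <= c) ->
  forall k : nat, exists2 l : seq T, size l = k &
    \sum_u expR (\sum_(t <- l) h t u) <= #|U|%:R * expR (2 * c ^+ 2 * k%:R).
Proof.
move=> w0 w1 hw hc; elim=> [|k [l lk IH]].
  exists [::] => //; rewrite mulr0 expR0 mulr1 (eq_bigr (fun=> 1)).
    by rewrite sumr_const.
  by move=> u _; rewrite big_nil expR0.
pose S u := \sum_(t <- l) h t u.
have [t tP] : exists t, \sum_u expR (h t u + S u) <=
    #|U|%:R * expR (2 * c ^+ 2 * k.+1%:R).
  apply: (@exists_le_average _ w) => //.
  apply: (@le_trans _ _ (expR (2 * c ^+ 2) * \sum_u expR (S u))).
    under eq_bigr do rewrite mulr_sumr.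
    rewrite exchange_big/= mulr_sumr; apply: ler_sum => u _.
    under eq_bigr do rewrite expRD mulrA.
    rewrite -mulr_suml ler_wpM2r ?expR_ge0//.
    apply: (@le_trans _ _ (\sum_t w t * (h t u + expR (2 * c ^+ 2)))).
      apply: ler_sum => t _; rewrite ler_wpM2l//.
      apply: le_trans (expR_le_addr_sqr _) _; rewrite lerD2l ler_expR.
      rewrite ler_wpM2l// -[leLHS]real_normK ?num_real//.
      by rewrite lerXn2r// nnegrE// (le_trans _ (hc t u)).
    under eq_bigr do rewrite mulrDr.
    by rewrite big_split/= hw add0r -mulr_suml w1 mul1r.
  have -> : 2 * c ^+ 2 * k.+1%:R = 2 * c ^+ 2 + 2 * c ^+ 2 * k%:R :> R.
    by rewrite -[k.+1]addn1 natrD mulrDr mulr1 addrC.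
  by rewrite expRD [leRHS]mulrCA ler_wpM2l ?expR_ge0.
exists (t :: l); first by rewrite /= lk.
by under eq_bigr do rewrite big_cons.
Qed.

Lemma exists_le_sum (T : finType) (F : T -> R) (M : R) (t0 : T) :
  \sum_t F t <= #|T|%:R * M -> exists t, F t <= M.
Proof.
move=> FM; have T0 : (0 < #|T|%:R :> R) by rewrite ltr0n; apply/card_gt0P; exists t0.
apply: (@exists_le_average _ (fun=> #|T|%:R^-1)) => //.
- by rewrite sumr_const -[LHS]mulr_natr mulVf// gt_eqF.
- by rewrite -mulr_sumr ler_pdivrMl.
Qed.

End averaging.

Section signs.
Variable R : realType.
Implicit Types (J : finType).

Definition bsign (b : bool) : R := (-1) ^+ b.

Lemma bsign_sqr b : bsign b ^+ 2 = 1.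
Proof. by rewrite /bsign -exprM mulnC exprM sqrrN !expr1n. Qed.

Lemma norm_bsign b : `|bsign b| = 1.
Proof. by rewrite /bsign normrX normrN1 expr1n. Qed.

Definition flip J (j : J) (e : {ffun J -> bool}) : {ffun J -> bool} :=
  [ffun i => (i == j) (+) e i].

Lemma flipK J (j : J) : involutive (flip j).
Proof. by move=> e; apply/ffunP => i; rewrite !ffunE addbA addbb addFb. Qed.

(* The second-order chaos is integrated out one sign at a time; the exponent  *)
(* [c + 16 c^2 V] absorbs the error of each step for both signs of [c].       *)
Lemma sum_expR_sqr_signs J (v : J -> R) (c : R) (r : seq J) :
  `|c| <= 40^-1 -> uniq r -> \sum_(j <- r) v j ^+ 2 <= 1 -> forall a : R,
  \sum_(e : {ffun J -> bool})
     expR (c * (a + \sum_(j <- r) bsign (e j) * v j) ^+ 2) <=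
  #|{ffun J -> bool}|%:R * expR ((c + 16 * c ^+ 2 * \sum_(j <- r) v j ^+ 2) *
                     (a ^+ 2 + \sum_(j <- r) v j ^+ 2)).
Proof.
move=> c_small; elim: r => [_ _ a|j r IH /= /andP[jr ur] vr a].
  under eq_bigr do rewrite big_nil addr0.
  by rewrite sumr_const -[leLHS]mulr_natl big_nil mulr0 !addr0.
set N := #|{ffun J -> bool}|%:R.
rewrite big_cons in vr *; set V := \sum_(i <- r) v i ^+ 2 in vr IH *.
set x := v j in vr *.
have V0 : 0 <= V by apply: sumr_ge0 => i _; exact: sqr_ge0.
have x0 : 0 <= x ^+ 2 := sqr_ge0 _.
have {}IH := IH ur (le_trans (ler_wpDl x0 (lexx _)) vr).
set c' := c + 16 * c ^+ 2 * V in IH.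
pose h (e : {ffun J -> bool}) b :=
  expR (c * (b + \sum_(i <- r) bsign (e i) * v i) ^+ 2).
have flipr e b : h (flip j e) b = h e b.
  congr (expR (c * (b + _) ^+ 2)); apply: eq_big_seq => i ir.
  by rewrite ffunE (negbTE (memPn jr _ ir)).
set F := (X in X <= _).
(* Adding to each sign pattern its flip at [j] replaces the random term [x] by the two shifts of
   [a]. *)
have F2 : 2 * F = \sum_e h e (a + x) + \sum_e h e (a - x).
  rewrite mulr_natl mulr2n {2}/F (reindex_inj (inv_inj (flipK j)))/=.
  rewrite -!big_split/=; apply: eq_bigr => e _.
  have HE (e' : {ffun J -> bool}) : expR (c * (a + \sum_(j0 <- j :: r) bsign (e' j0) * v j0) ^+ 2)
     = h e' (a + bsign (e' j) * x) by rewrite /h big_cons addrA.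
  rewrite !HE flipr ffunE eqxx /bsign; case: (e j) => /=.
    by rewrite expr1 expr0 mulN1r mul1r addrC.
  by rewrite expr1 expr0 mulN1r mul1r.
rewrite -(ler_pM2l (_ : 0 < 2 :> R))//; rewrite {}F2.
apply: le_trans (lerD (IH _) (IH _)) _.
rewrite -mulrDr mulrCA ler_wpM2l//.
have -> : c' * ((a + x) ^+ 2 + V) =
  c' * (a ^+ 2 + x ^+ 2 + V) + 2 * c' * a * x by ring.
have -> : c' * ((a - x) ^+ 2 + V) =
  c' * (a ^+ 2 + x ^+ 2 + V) + (- (2 * c' * a * x)) by ring.
rewrite !expRD -mulrDr.
apply: (le_trans (ler_wpM2l (expR_ge0 _) (expR_addN_le _))).
rewrite mulrCA ler_wpM2l// -expRD ler_expR.
have c2 : 16 * c ^+ 2 <= 16 / 40 * `|c|.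
  by rewrite -real_normK ?num_real//; have := normr_ge0 c; nra.
(* Here the bound [40^-1] on [c] serves: it gives |16 c V| <= 2/5, and (7/5)^2 < 2. *)
have hc' : 8 * c' ^+ 2 <= 16 * c ^+ 2.
  have c'E : c' ^+ 2 = c ^+ 2 * (1 + 16 * c * V) ^+ 2 by rewrite /c'; ring.
  rewrite c'E.
  suff : (1 + 16 * c * V) ^+ 2 <= 2 by have := sqr_ge0 c; nra.
  have : `|16 * c * V| <= 16 / 40.
    rewrite !normrM ger0_norm// (ger0_norm V0).
    have := normr_ge0 c; nra.
  by rewrite ler_norml => /andP[]; nra.
have a0 : 0 <= a ^+ 2 := sqr_ge0 _.
have -> : c' * (a ^+ 2 + x ^+ 2 + V) + 2 * (2 * c' * a * x) ^+ 2 =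
  (c' + 8 * c' ^+ 2 * x ^+ 2) * a ^+ 2 + c' * (x ^+ 2 + V) by ring.
have c'le : c' <= c + 16 * c ^+ 2 * (x ^+ 2 + V).
  by rewrite /c'; have := sqr_ge0 c; nra.
have : c' + 8 * c' ^+ 2 * x ^+ 2 <= c + 16 * c ^+ 2 * (x ^+ 2 + V).
  have -> : c + 16 * c ^+ 2 * (x ^+ 2 + V) = c' + 16 * c ^+ 2 * x ^+ 2.
    by rewrite /c'; ring.
  by rewrite lerD2l ler_wpM2r.
nra.
Qed.

Definition sdot J (e : {ffun J -> bool}) (v : J -> R) : R :=
  \sum_j bsign (e j) * v j.

(** The rows of [g] are independent, so the sum over all sign matrices is the [m]-th power of a sum
    over one row. *)
Lemma sum_expR_sdot J (v : J -> R) (c : R) (m : nat) :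
  `|c| <= 40^-1 -> \sum_j v j ^+ 2 <= 1 ->
  \sum_(g : {ffun 'I_m -> {ffun J -> bool}})
    expR (c * \sum_(i < m) sdot (g i) v ^+ 2) <=
  #|{ffun 'I_m -> {ffun J -> bool}}|%:R *
    expR (m%:R * ((c + 16 * c ^+ 2 * \sum_j v j ^+ 2) * \sum_j v j ^+ 2)).
Proof.
move=> c_small v1.
have H := @sum_expR_sqr_signs J v c (index_enum J) c_small (index_enum_uniq _) v1 0.
under eq_bigr do rewrite mulr_sumr expR_sum.
rewrite -(bigA_distr_bigA (fun=> fun e => expR (c * sdot e v ^+ 2))).
rewrite prodr_const !card_ord card_ffun card_ord natrX expRM_natl -exprMn.
have H1 : \sum_e expR (c * sdot e v ^+ 2) <= #|{ffun J -> bool}|%:R *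
    expR ((c + 16 * c ^+ 2 * \sum_j v j ^+ 2) * \sum_j v j ^+ 2).
  by move: H; rewrite expr0n/= add0r; under eq_bigr do rewrite add0r.
have H0 : 0 <= \sum_e expR (c * sdot e v ^+ 2).
  by apply: sumr_ge0 => e _; exact: expR_ge0.
by apply: lerXn2r; rewrite ?nnegrE//; exact: le_trans H1.
Qed.

End signs.

Section random_signs.
Variable R : realType.

Lemma mul_card_sum (X : finType) (a b : R) :
  a * (#|X|%:R * b) = \sum_(x : X) a * b.
Proof. by rewrite sumr_const -[RHS]mulr_natl mulrCA. Qed.

(** Union bound through exponential moments, with parameter [64^-1] for the upper tail at 3 m and
    [- 64^-1] for the lower tail at m / 4. As 5/256 - 12/256 and - 3/256 + 1/256 are both at most -
    1/128, every failure weight averages to at most exp (- m / 128), and their total falls below 1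
    for some [g]. *)
Lemma exists_sign_rows (J T U : finType) (v : T -> J -> R) (y : U -> J -> R)
    (m : nat) :
  (forall t, \sum_j v t j ^+ 2 <= 1) ->
  (#|T| + #|U|)%:R < expR (m%:R / 128 : R) ->
  exists g : 'I_m -> {ffun J -> bool},
    (forall t, \sum_i sdot (g i) (v t) ^+ 2 <= 3 * m%:R) /\
    (forall u, m%:R / 4 * (\sum_j y u j ^+ 2) <= \sum_i sdot (g i) (y u) ^+ 2).
Proof.
move=> v1 TU.
pose z u j := y u j / Num.sqrt (\sum_j y u j ^+ 2).
have zn u : \sum_j y u j ^+ 2 != 0 -> \sum_j z u j ^+ 2 = 1.
  move=> yu; under eq_bigr do rewrite expr_div_n.
  by rewrite -mulr_suml sqr_sqrtr ?sumr_ge0 ?divff// => j _; exact: sqr_ge0.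
have zn1 u : \sum_j z u j ^+ 2 <= 1.
  have [y0|/zn->//] := eqVneq (\sum_j y u j ^+ 2) 0.
  rewrite big1// => j _; rewrite /z y0 sqrtr0 invr0 mulr0 expr0n//.
pose F (g : {ffun 'I_m -> {ffun J -> bool}}) : R :=
  \sum_t expR (64^-1 * \sum_i sdot (g i) (v t) ^+ 2) * expR (- (3 / 64 * m%:R)) +
  \sum_(u | \sum_j y u j ^+ 2 != 0)
     expR (- 64^-1 * \sum_i sdot (g i) (z u) ^+ 2) * expR (m%:R / 256).
have [g gP] : exists g, F g <= (#|T| + #|U|)%:R * expR (- (m%:R / 128)).
  apply: (@exists_le_sum _ _ _ _ [ffun=> [ffun=> true]]).
  rewrite /F big_split/= exchange_big/= [X in _ + X]exchange_big/=.
  rewrite [in leRHS](natrD _ #|T|) [in leRHS]mulrDl [leRHS]mulrDr lerD//.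
    rewrite mul_card_sum; apply: ler_sum => t _.
    rewrite -mulr_suml.
    have h40 : `|64^-1 : R| <= 40^-1 by rewrite ger0_norm//; lra.
    apply: (@le_trans _ _ (_ * _)).
      by apply: ler_wpM2r; [exact: expR_ge0|exact: (sum_expR_sdot m h40 (v1 t))].
    rewrite -[leLHS]mulrA ler_wpM2l// -expRD ler_expR.
    set V := \sum_j _; have V0 : 0 <= V by apply: sumr_ge0 => j _; exact: sqr_ge0.
    have V1 : V <= 1 := v1 t.
    have m0 : 0 <= m%:R :> R by [].
    suff : (64^-1 + 16 * 64^-1 ^+ 2 * V) * V <= 5 / 256 by nra.
    by nra.
  rewrite mul_card_sum.
  rewrite [leRHS](bigID (fun u => \sum_j y u j ^+ 2 != 0))/=.
  rewrite ler_wpDr//; first by apply: sumr_ge0 => u _; rewrite mulr_ge0// expR_ge0.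
  apply: ler_sum => u yu.
  rewrite -mulr_suml.
  have h40 : `|- 64^-1 : R| <= 40^-1 by rewrite normrN ger0_norm//; lra.
  apply: (@le_trans _ _ (_ * _)).
    by apply: ler_wpM2r; [exact: expR_ge0|exact: (sum_expR_sdot m h40 (zn1 u))].
  rewrite -[leLHS]mulrA ler_wpM2l// -expRD ler_expR zn// !mulr1.
  have m0 : 0 <= m%:R :> R by [].
  nra.
have F1 : F g < 1.
  by apply: le_lt_trans gP _; rewrite expRN ltr_pdivrMr ?expR_gt0// mul1r.
have pos1 t : 0 <= expR (64^-1 * \sum_i sdot (g i) (v t) ^+ 2) *
    expR (- (3 / 64 * m%:R)) by rewrite mulr_ge0 ?expR_ge0.
have pos2 u : 0 <= expR (- 64^-1 * \sum_i sdot (g i) (z u) ^+ 2) *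
    expR (m%:R / 256) by rewrite mulr_ge0 ?expR_ge0.
exists g; split=> [t|u].
  have : expR (64^-1 * \sum_i sdot (g i) (v t) ^+ 2) *
     expR (- (3 / 64 * m%:R)) < 1.
    apply: le_lt_trans F1; rewrite /F (bigD1 t)//= -addrA lerDl addr_ge0//;
      by apply: sumr_ge0.
  rewrite -expRD -[ltRHS]expR0 ltr_expR; lra.
have [->|yu] := eqVneq (\sum_j y u j ^+ 2) 0.
  by rewrite mulr0; apply: sumr_ge0 => i _; exact: sqr_ge0.
have : expR (- 64^-1 * \sum_i sdot (g i) (z u) ^+ 2) * expR (m%:R / 256) < 1.
  apply: le_lt_trans F1; rewrite /F [X in _ <= _ + X](bigD1 u)//= addrCA.
  rewrite lerDl addr_ge0//; by apply: sumr_ge0.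
rewrite -expRD -[ltRHS]expR0 ltr_expR => H.
have -> : \sum_i sdot (g i) (y u) ^+ 2 =
    (\sum_j y u j ^+ 2) * \sum_i sdot (g i) (z u) ^+ 2.
  have yu0 : 0 <= \sum_j y u j ^+ 2 by apply: sumr_ge0 => j _; exact: sqr_ge0.
  rewrite -{1}(sqr_sqrtr yu0) mulr_sumr; apply: eq_bigr => i _.
  rewrite -exprMn; congr (_ ^+ 2); rewrite /sdot mulr_sumr.
  apply: eq_bigr => j _; rewrite /z [RHS]mulrCA; congr (_ * _).
  by rewrite [RHS]mulrCA mulfV ?mulr1// gt_eqF// sqrtr_gt0 lt_neqAle eq_sym yu.
rewrite mulrC ler_wpM2l//; last lra.
by apply: sumr_ge0 => j _; exact: sqr_ge0.
Qed.

(* Low-M* estimate for the absolutely convex hull of finitely many vectors:   *)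
(* a point of the hull orthogonal to the random signs is approximated by an   *)
(* average of k vertices, and on such averages the signs act isometrically.   *)
Lemma kernel_width (J T : finType) (v : T -> J -> R) (m k : nat) :
  (forall t, \sum_j v t j ^+ 2 <= 1) -> (0 < k)%N -> (0 < #|T|)%N ->
  k%:R * ln (8 * #|T|%:R) <= m%:R / 128 :> R ->
  exists g : 'I_m -> {ffun J -> bool}, forall lam : T -> R,
    (forall i, sdot (g i) (fun j => \sum_t lam t * v t j) = 0) ->
    \sum_j (\sum_t lam t * v t j) ^+ 2 <= 52 / k%:R * (\sum_t `|lam t|) ^+ 2.
Proof.
move=> v1 k0 T0 km.
pose y (u : {ffun 'I_k -> T * bool}) j := \sum_(i < k) bsign R (u i).2 * v (u i).1 j.
have T0R : 0 < #|T|%:R :> R by rewrite ltr0n.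
have k1 : 1 <= k%:R :> R by rewrite ler1n.
have m_gt0 : (0 < m%:R :> R).
  have : 0 < ln (8 * #|T|%:R : R).
    have T1 : 1 <= #|T|%:R :> R by rewrite ler1n.
    by rewrite ln_gt0//; lra.
  nra.
have [|g [gv gy]] := @exists_sign_rows J T _ v y m v1.
  (* The rows must act well on the [#|T|] vertices and on the (2 [#|T|])^k signed sums of [k]
     vertices; k ln (8 [#|T|]) covers both counts. *)
  apply: (@lt_le_trans _ _ (expR (k%:R * ln (8 * #|T|%:R)))); last by rewrite ler_expR.
  rewrite expRM_natl lnK ?posrE ?mulr_gt0// card_ffun card_ord card_prod card_bool.
  rewrite (natrD _ #|T|) natrX natrM; set t := #|T|%:R in T0R *.
  have t1 : 1 <= t by rewrite /t ler1n.
  apply: (@le_lt_trans _ _ (2 * (2 * t) ^+ k)).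
    have -> : 2 * (2 * t) ^+ k = (2 * t) ^+ k + (2 * t) ^+ k by ring.
    rewrite [t * 2]mulrC lerD2r; apply: (@le_trans _ _ (2 * t)); first lra.
    by rewrite -{1}[2 * t]expr1 ler_weXn2l//; lra.
  have -> : 8 * t = 4 * (2 * t) by ring.
  rewrite [ltRHS]exprMn ltr_pM2r ?exprn_gt0 ?mulr_gt0//.
  apply: (@lt_le_trans _ _ (4 ^+ 1)); first by rewrite expr1; lra.
  by rewrite ler_weXn2l//; lra.
exists g => lam lam0.
set L := \sum_t `|lam t|.
have L0 : 0 <= L by exact: sumr_ge0.
have [L_eq0|L_neq0] := eqVneq L 0.
  rewrite big1 ?L_eq0 ?expr0n ?mulr0// => j _.
  rewrite big1 ?expr0n// => t _.
  have /eqP : `|lam t| = 0 by apply: (psumr_eq0P _ L_eq0).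
  by rewrite normr_eq0 => /eqP ->; rewrite mul0r.
have {L_neq0}L_gt0 : 0 < L by rewrite lt_neqAle eq_sym L_neq0.
pose sg t : bool := lam t < 0.
have sgE t : bsign R (sg t) * `|lam t| = lam t.
  rewrite /bsign /sg; case: ltrP => [lt0|ge0].
    by rewrite ltr0_norm// expr1 mulN1r opprK.
  by rewrite ger0_norm// expr0 mul1r.
pose w j := (\sum_t lam t * v t j) / L.
have wE j : \sum_t `|lam t| / L * (bsign R (sg t) * v t j) = w j.
  rewrite /w mulr_suml; apply: eq_bigr => t _.
  by rewrite -{2}(sgE t); ring.
(* This scaling makes the squared row values of each vertex sum to at most 1, like the squared
   coordinates. *)
pose c : R := (Num.sqrt (3 * m%:R))^-1.
have c2 : c ^+ 2 = (3 * m%:R)^-1.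
  by rewrite exprVn sqr_sqrtr// mulr_ge0.
(* Sampling is run on the coordinates and on the rows together. The row parts are centred precisely
   because the sampled point is orthogonal to all rows. *)
pose h (t : T) (u : J + 'I_m) : R := match u with
  | inl j => bsign R (sg t) * v t j - w j
  | inr i => bsign R (sg t) * sdot (g i) (v t) * c end.
have sumw : \sum_t `|lam t| / L = 1 by rewrite -mulr_suml divff// gt_eqF.
have [|||l lk lP] := @exists_sample_sqr R T _ (fun t => `|lam t| / L) h 2 _ sumw _ _ k.
- by move=> t; rewrite divr_ge0.
- case=> [j|i] /=.
    under eq_bigr do rewrite mulrBr.
    by rewrite sumrB wE -mulr_suml sumw mul1r subrr.
  under eq_bigr do rewrite mulrA.
  rewrite -mulr_suml (_ : \sum_t _ = 0) ?mul0r//.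
  transitivity (sdot (g i) (fun j => \sum_t lam t * v t j) / L).
    rewrite /sdot mulr_suml.
    under [RHS]eq_bigr do rewrite -mulrA -/(w _) -wE mulr_sumr.
    rewrite exchange_big/=; apply: eq_bigr => t _.
    by rewrite !mulr_sumr; apply: eq_bigr => j _; ring.
  by rewrite lam0 mul0r.
- under eq_bigr do rewrite big_sumType/= mulrDr.
  rewrite big_split/= (_ : 2 = 1 + 1)//; apply: lerD.
    apply: (@le_trans _ _ (\sum_t `|lam t| / L * (\sum_j v t j ^+ 2) - \sum_j w j ^+ 2)).
      rewrite [leRHS](_ : _ = \sum_t `|lam t| / L * (\sum_j v t j ^+ 2) +
         \sum_j w j ^+ 2 - 2 * \sum_j w j * w j); last first.
        under [\sum_j w j * w j]eq_bigr do rewrite -expr2.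
        ring.
      under [X in _ <= _ - 2 * X]eq_bigr do rewrite -{2}wE mulr_sumr.
      rewrite exchange_big/= mulr_sumr.
      have -> : \sum_j w j ^+ 2 = \sum_t `|lam t| / L * \sum_j w j ^+ 2.
        by rewrite -mulr_suml sumw mul1r.
      rewrite -big_split -sumrB/=; apply: ler_sum => t _.
      rewrite !mulr_sumr -big_split -sumrB/=; apply: ler_sum => j _.
      rewrite [leRHS](_ : _ = `|lam t| / L *
        (v t j ^+ 2 + w j ^+ 2 - 2 * w j * (bsign R (sg t) * v t j))); last by ring.
      rewrite le_eqVlt; apply/orP; left; apply/eqP.
      by rewrite sqrrB exprMn bsign_sqr mul1r; ring.
    apply: (@le_trans _ _ (\sum_t `|lam t| / L * (\sum_j v t j ^+ 2))).
      by rewrite gerBl; apply: sumr_ge0 => j _; exact: sqr_ge0.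
    rewrite -sumw; apply: ler_sum => t _; rewrite ler_piMr// divr_ge0//.
  rewrite -sumw; apply: ler_sum => t _; rewrite ler_piMr ?divr_ge0//.
  under eq_bigr do rewrite !exprMn bsign_sqr mul1r c2.
  by rewrite -mulr_suml ler_pdivrMr ?mulr_gt0// mul1r.
have {lP} := lP; rewrite big_sumType/= => lP.
have [u uE] : exists u : {ffun 'I_k -> T * bool}, forall j,
    y u j = \sum_(t <- l) bsign R (sg t) * v t j.
  have [t0 _] := card_gt0P T0.
  exists [ffun i : 'I_k => (nth t0 l i, sg (nth t0 l i))] => j.
  rewrite /y (big_nth t0) lk big_mkord; apply: eq_bigr => i _; by rewrite ffunE.
have kR : 0 < k%:R :> R by rewrite ltr0n.
have P1 : \sum_j (y u j - k%:R * w j) ^+ 2 <= 2 * k%:R.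
  rewrite mulrC; apply: le_trans lP; rewrite -[leLHS]addr0 lerD//.
    rewrite le_eqVlt; apply/orP; left; apply/eqP/eq_bigr => j _.
    by rewrite sumrB uE big_const_seq count_predT lk iter_addr_0 mulr_natl.
  by apply: sumr_ge0 => i _; exact: sqr_ge0.
(* The sample has small row values, and the lower estimate m / 4 for the rows turns this into a
   small norm. *)
have P2 : \sum_j y u j ^+ 2 <= 24 * k%:R.
  have : m%:R / 4 * \sum_j y u j ^+ 2 <= 6 * m%:R * k%:R.
    apply: le_trans (gy u) _.
    have : \sum_i (sdot (g i) (y u) * c) ^+ 2 <= k%:R * 2.
      apply: le_trans lP; rewrite -[leLHS]add0r lerD//.
        by apply: sumr_ge0 => i _; exact: sqr_ge0.
      rewrite le_eqVlt; apply/orP; left; apply/eqP/eq_bigr => i _.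
      congr (_ ^+ 2); rewrite -mulr_suml; congr (_ * _); rewrite /sdot.
      under eq_bigr do rewrite uE mulr_sumr.
      rewrite exchange_big/=; apply: eq_bigr => t _; rewrite mulr_sumr.
      by apply: eq_bigr => j _; ring.
    under eq_bigr do rewrite exprMn c2.
    rewrite -mulr_suml ler_pdivrMr ?mulr_gt0// => /le_trans; apply.
    lra.
  have -> : 6 * m%:R * k%:R = m%:R / 4 * (24 * k%:R) :> R by field.
  by rewrite ler_pM2l// divr_gt0.
(* The constant is 52 = 2 * 24 + 2 * 2, from the norm of the sample and its distance to the
   target. *)
have P3 : \sum_j (k%:R * w j) ^+ 2 <= 52 * k%:R.
  apply: (@le_trans _ _ (2 * (\sum_j y u j ^+ 2) + 2 * \sum_j (y u j - k%:R * w j) ^+ 2)).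
    rewrite !mulr_sumr -big_split/=; apply: ler_sum => j _.
    by have := sqr_ge0 (2 * y u j - k%:R * w j); nra.
  lra.
have P4 : \sum_j w j ^+ 2 <= 52 / k%:R.
  rewrite ler_pdivlMr// -(ler_pM2r kR).
  apply: le_trans P3; rewrite mulrAC mulrC mulr_suml mulr_sumr.
  by rewrite le_eqVlt; apply/orP; left; apply/eqP/eq_bigr => j _; ring.
have -> : \sum_j (\sum_t lam t * v t j) ^+ 2 = (\sum_j w j ^+ 2) * L ^+ 2.
  rewrite mulr_suml; apply: eq_bigr => j _.
  by rewrite /w -exprMn divfK// gt_eqF.
by rewrite ler_wpM2r// sqr_ge0.
Qed.

End random_signs.

(** * Kolmogorov widths from sections of the dual body *)

Section width.
Variable R : realType.

Lemma is_derive_affine (a b h : R) :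
  is_derive h (1 : R) (fun x => a + x * b) b.
Proof.
have -> : (fun x => a + x * b) = cst a + (@id R * cst b) by [].
by apply: is_derive_eq; rewrite /= add0r scaler0 add0r [_ *: _]mulr1.
Qed.

Lemma sum_continuous (X : topologicalType) (I : Type) (r : seq I)
    (f : I -> X -> R) :
  (forall i, continuous (f i)) -> continuous (fun x => \sum_(i <- r) f i x).
Proof.
move=> fc; elim: r => [|i r IH] x.
  have -> : (fun x => \sum_(i <- [::]) f i x) = cst 0.
    by apply/funext => z; rewrite big_nil.
  exact: cvg_cst.
have -> : (fun x => \sum_(j <- i :: r) f j x) =
    f i \+ (fun x => \sum_(j <- r) f j x).
  by apply/funext => z; rewrite big_cons.
by apply: cvgD; [exact: fc|exact: IH].
Qed.

(* Minimising the even power sum of order [2 M] of the residuals replaces     *)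
(* the duality between Kolmogorov and Gelfand widths: the vector of           *)
(* [(2 M - 1)]-th powers of the residuals is orthogonal to the subspace.      *)
Lemma exists_power_minimizer (M m : nat) (s0 : 'rV[R]_M.+1) (G : 'M[R]_(m, M.+1)) :
  exists2 c : 'rV[R]_m, True &
    forall i, \sum_t (s0 - c *m G) 0 t ^+ (M.+1.*2.-1) * G i t = 0.
Proof.
pose Phi (s : 'rV[R]_M.+1) := \sum_t s 0 t ^+ M.+1.*2.
have even0 (x : R) : 0 <= x ^+ M.+1.*2.
  by rewrite -mul2n exprM exprn_ge0// sqr_ge0.
(* Membership in the coset of the row space of [G] is written with [cokermx G], as finitely many
   linear equations, so that closedness is immediate; the sublevel condition gives compactness. *)
pose A := [set s : 'rV[R]_M.+1 | (forall j, ((s0 - s) *m cokermx G) 0 j = 0) /\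
   Phi s <= Phi s0].
have Phi_cont : continuous Phi.
  apply: sum_continuous => t s.
  apply: (@continuous_comp _ _ _ (fun z : 'rV[R]_M.+1 => z 0 t) (fun x => x ^+ M.+1.*2)).
    exact: coord_continuous.
  exact: exprn_continuous.
have As0 : A s0 by split=> // j; rewrite subrr mul0mx mxE.
have Acl : closed A.
  have -> : A = (\bigcap_j [set s | ((s0 - s) *m cokermx G) 0 j = 0]) `&`
     [set s | Phi s <= Phi s0].
    apply/seteqP; split => s /=; first by move=> [H1 H2]; split=> // j _.
    by move=> [H1 H2]; split=> // j; exact: H1.
  apply: closedI.
    apply: closed_bigI => j _.
    apply: (@preimage_closed _ _ (fun s : 'rV[R]_M.+1 => ((s0 - s) *m cokermx G) 0 j)
       [set x | x = 0]); last exact: closed_eq.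
    move=> s _.
    have -> : (fun s : 'rV[R]_M.+1 => ((s0 - s) *m cokermx G) 0 j) =
        (fun s => \sum_t (s0 0 t - s 0 t) * cokermx G t j).
      by apply/funext => z; rewrite mxE; apply: eq_bigr => t _; rewrite !mxE.
    apply: sum_continuous => t z.
    apply: (@continuousM R _ (fun x : 'rV[R]_M.+1 => s0 0 t - x 0 t)
      (fun=> cokermx G t j) z); last exact: cst_continuous.
    apply: (@continuousB R _ _ (fun=> s0 0 t) (fun x : 'rV[R]_M.+1 => x 0 t) z).
      exact: cst_continuous.
    exact: coord_continuous.
  apply: (@preimage_closed _ _ Phi [set x | x <= Phi s0]); last exact: closed_le.
  by move=> s _; exact: Phi_cont.
pose K := 1 + Phi s0.
have Acp : compact A.
  apply: (subclosed_compact Acl (@rV_compact _ _ (fun=> `[- K, K]%classic) _)).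
    by move=> i; exact: segment_compact.
  move=> s [_ sPhi] t /=.
  have st : s 0 t ^+ M.+1.*2 <= Phi s0.
    apply: le_trans sPhi; rewrite /Phi (bigD1 t)//= lerDl; exact: sumr_ge0.
  rewrite in_itv/= -ler_norml leNgt; apply/negP => sK.
  have P0 : 0 <= Phi s0 by exact: sumr_ge0.
  have s1 : 1 <= `|s 0 t| by rewrite /K in sK; lra.
  have : `|s 0 t| <= s 0 t ^+ M.+1.*2.
    rewrite -[leRHS]ger0_norm// normrX -{1}(expr1 `|s 0 t|) ler_weXn2l//.
  rewrite /K in sK; lra.
have [s sA smin] := @EVT_min_rV R M.+1 Phi A (ex_intro _ s0 As0) Acp
  (continuous_subspaceT Phi_cont).
move: (set_mem sA) => [s_sub s_le].
have /submxP[c cE] : (s0 - s <= G)%MS.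
  by rewrite submxE; apply/eqP/rowP => j; rewrite s_sub mxE.
have sE : s = s0 - c *m G by rewrite -cE opprB addrC subrK.
exists c => // i; rewrite -sE.
pose b := row i G.
have sb h : Phi s <= Phi (s + h *: b).
  have [le|gt] := leP (Phi (s + h *: b)) (Phi s0); last by rewrite (le_trans s_le)// ltW.
  apply: smin; apply/mem_set; split=> // j.
  have -> : s0 - (s + h *: b) = (s0 - s) - h *: b by rewrite opprD addrA.
  rewrite mulmxBl mxE s_sub add0r mxE -scalemxAl mxE -row_mul mulmx_coker row0.
  by rewrite mxE mulr0 oppr0.
pose f : R -> R := \sum_(t < M.+1) (fun h => s 0 t + h * G i t) ^+ M.+1.*2.
have fE h : f h = Phi (s + h *: b).
  rewrite /f fct_sumE; apply: eq_bigr => t _.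
  by rewrite !mxE exprfctE.
have fd (h : R) : is_derive h (1 : R) f (\sum_(t < M.+1)
    (M.+1.*2%:R * (s 0 t + h * G i t) ^+ M.+1.*2.-1) *: G i t).
  apply: (@is_derive_sum R R R M.+1 (fun t => (fun h => s 0 t + h * G i t) ^+ M.+1.*2)
    h 1 (fun t => (M.+1.*2%:R * (s 0 t + h * G i t) ^+ M.+1.*2.-1) *: G i t)) => t.
  exact: (@is_deriveX R R (fun h => s 0 t + h * G i t) M.+1.*2 h 1 (G i t)
    (is_derive_affine _ _ _)).
have f0 : is_derive (0 : R) (1 : R) f 0.
  apply: (@derive1_at_min R f (-1) 1 0).
  - lra.
  - by move=> h _; exact: ex_derive.
  - by rewrite in_itv/=; lra.
  - by move=> h _; rewrite !fE scale0r addr0; exact: sb.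
have := @derive_val _ _ _ _ _ _ _ (fd 0); rewrite (@derive_val _ _ _ _ _ _ _ f0).
have -> : \sum_(t < M.+1) (M.+1.*2%:R * (s 0 t + 0 * G i t) ^+ M.+1.*2.-1) *: G i t =
    \sum_(t < M.+1) M.+1.*2%:R * (s 0 t ^+ M.+1.*2.-1 * G i t).
  by apply: eq_bigr => t _; rewrite mul0r addr0; exact: esym (mulrA _ _ _).
rewrite -mulr_sumr => /esym/eqP; rewrite mulf_eq0 => /orP[|/eqP//].
by rewrite pnatr_eq0.
Qed.

(** Apply the kernel estimate to the [q]-th powers of the residuals, with q = 2 M + 1: orthogonality
    to the rows removes the approximant and bounds the power sum of order [q.+1] by [tau] times that
    of order [q]. As 4^q exceeds the number of residuals, no single one can exceed [4 * tau]. *)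
Lemma width_of_kernel (J : finType) (M m : nat) (v : 'I_M.+1 -> J -> R)
    (g : 'I_m -> J -> R) (tau : R) :
  0 <= tau ->
  (forall lam : 'I_M.+1 -> R,
    (forall i, \sum_j g i j * \sum_t lam t * v t j = 0) ->
    \sum_j (\sum_t lam t * v t j) ^+ 2 <= tau ^+ 2 * (\sum_t `|lam t|) ^+ 2) ->
  forall x : J -> R, \sum_j x j ^+ 2 <= 1 ->
  exists c : 'I_m -> R, forall t,
    `|\sum_j (x j - \sum_i c i * g i j) * v t j| <= 4 * tau.
Proof.
move=> tau0 ker x x1.
pose s0 : 'rV[R]_M.+1 := \row_t \sum_j x j * v t j.
pose G : 'M[R]_(m, M.+1) := \matrix_(i, t) \sum_j g i j * v t j.
have [c _ cP] := exists_power_minimizer s0 G.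
pose s t := (s0 - c *m G) 0 t.
have sE t : s t = \sum_j (x j - \sum_i c 0 i * g i j) * v t j.
  rewrite /s !mxE.
  under [RHS]eq_bigr do rewrite mulrBl mulr_suml.
  rewrite sumrB exchange_big/=; congr (_ - _); apply: eq_bigr => i _.
  by rewrite mxE mulr_sumr; apply: eq_bigr => j _; rewrite mulrA.
exists (fun i => c 0 i) => t0; rewrite -sE.
have [q qE] : exists q, q.+1 = M.+1.*2 by exists M.+1.*2.-1.
rewrite -qE succnK in cP.
pose lam t := s t ^+ q.
pose w j := \sum_t lam t * v t j.
have wg i : \sum_j g i j * w j = 0.
  rewrite -[RHS](cP i) /w; under eq_bigr do rewrite mulr_sumr.
  rewrite exchange_big/=; apply: eq_bigr => t _.
  by rewrite [X in _ = _ * X]mxE mulr_sumr; apply: eq_bigr => j _; rewrite /lam mulrCA.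
have wle := ker lam wg.
have wx : \sum_j x j * w j = \sum_t s t ^+ q.+1.
  have -> : \sum_j x j * w j = \sum_j (x j - \sum_i c 0 i * g i j) * w j.
    under [RHS]eq_bigr do rewrite mulrBl mulr_suml.
    rewrite sumrB exchange_big/= [X in _ - X]big1 ?subr0// => i _.
    under eq_bigr do rewrite -mulrA.
    by rewrite -mulr_sumr wg mulr0.
  rewrite /w; under eq_bigr do rewrite mulr_sumr.
  rewrite exchange_big/=; apply: eq_bigr => t _.
  rewrite exprSr sE mulr_sumr -sE; apply: eq_bigr => j _; rewrite /lam; ring.
have even0 t : 0 <= s t ^+ q.+1 by rewrite qE -mul2n exprM exprn_ge0// sqr_ge0.
have normE t : s t ^+ q.+1 = `|s t| ^+ q.+1 by rewrite -normrX ger0_norm.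
have main : \sum_t `|s t| ^+ q.+1 <= tau * \sum_t `|s t| ^+ q.
  have -> : \sum_t `|s t| ^+ q.+1 = \sum_j x j * w j.
    by rewrite wx; apply: eq_bigr => t _.
  have -> : \sum_t `|s t| ^+ q = \sum_t `|lam t|.
    by apply: eq_bigr => t _; rewrite normrX.
  apply: (le_trans (ler_norm _)).
  rewrite -(@ler_pXn2r _ 2)// ?nnegrE ?mulr_ge0 ?sumr_ge0//.
  rewrite real_normK ?num_real// exprMn; apply: le_trans wle.
  apply: (le_trans (sumr_sqr_CauchySchwarz _ _ _)).
  by rewrite ler_piMl// sumr_ge0// => j _; exact: sqr_ge0.
rewrite leNgt; apply/negP => big.
have : \sum_t (`|s t| ^+ q.+1 - tau * `|s t| ^+ q + tau ^+ q.+1) <= M.+1%:R * tau ^+ q.+1.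
  rewrite big_split/= sumrB -mulr_sumr sumr_const card_ord -[X in _ + X]mulr_natl.
  by rewrite gerDr subr_le0.
apply/negP; rewrite -ltNge.
have pos t : 0 <= `|s t| ^+ q.+1 - tau * `|s t| ^+ q + tau ^+ q.+1.
  have n0 := normr_ge0 (s t).
  rewrite !exprS -mulrBl; case: (lerP tau `|s t|) => le.
    by rewrite addr_ge0 ?mulr_ge0 ?exprn_ge0// subr_ge0.
  have : `|s t| ^+ q <= tau ^+ q by rewrite lerXn2r ?nnegrE// ltW.
  have : 0 <= `|s t| ^+ q by exact: exprn_ge0.
  nra.
rewrite (bigD1 t0)//= ltr_wpDr ?sumr_ge0//.
have n0 : 0 <= `|s t0| := normr_ge0 _.
rewrite [X in _ < X - _ + _]exprS -mulrBl.
have tq : 0 <= tau ^+ q.+1 by exact: exprn_ge0.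
have [tz|tnz] := eqVneq tau 0.
  rewrite tz mulr0 in big; rewrite tz expr0n/= mulr0 addr0 subr0.
  by rewrite mulr_gt0// exprn_gt0.
have {tnz}tpos : 0 < tau by rewrite lt_neqAle eq_sym tnz.
apply: (@lt_le_trans _ _ (3 * tau * (4 * tau) ^+ q)).
  rewrite exprMn mulrACA -exprS ltr_pM2r ?exprn_gt0//.
  apply: (@lt_le_trans _ _ (4 ^+ q)).
    rewrite -natrX ltr_nat; apply: (@leq_ltn_trans q); last exact: ltn_expl.
    by rewrite -ltnS qE -addnn -[X in (X < _)%N]addn0 ltn_add2l.
  by rewrite ler_peMl ?exprn_ge0//; lra.
rewrite -[leLHS]addr0 lerD//; apply: ler_pM.
- lra.
- by rewrite exprn_ge0// mulr_ge0.
- lra.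
- by rewrite lerXn2r ?nnegrE ?mulr_ge0// ltW.
Qed.

(** The span of [m] sign vectors serves for every [b] and [x] simultaneously; [T] is the set of
    functionals in which the error is measured and enters through a logarithm only. *)
Lemma exists_approx_subspace : exists2 C : R, 0 < C &
  forall (J T : finType) (v : T -> J -> R) (A : R) (m : nat),
  0 < A -> (forall t, \sum_j v t j ^+ 2 <= A ^+ 2) -> (0 < m)%N -> (0 < #|T|)%N ->
  exists g : 'I_m -> {ffun J -> bool}, forall (b : R) (x : J -> R),
    0 <= b -> \sum_j x j ^+ 2 <= b ^+ 2 ->
    exists c : 'I_m -> R, forall t,
    `|\sum_j (x j - \sum_i c i * bsign R (g i j)) * v t j| <=
       C * A * b * Num.sqrt (ln (8 * #|T|%:R) / m%:R).
Proof.
(* The 4 is the loss of [width_of_kernel]. The square of [8 * 16] exceeds 52 * 256, which arises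
   from [52 / k] with k at least m / (256 D), where D is the logarithm. *)
exists (4 * (8 * 16)); first by rewrite !mulr_gt0.
set C := 4 * _ => J T v A m A0 vA m0 T0.
have C2 : C ^+ 2 = 4 ^+ 2 * (8 ^+ 2 * 16 ^+ 2) by rewrite !exprMn.
have C0 : 0 <= C by rewrite !mulr_ge0.
clearbody C.
have mR : 0 < m%:R :> R by rewrite ltr0n.
have T1 : 1 <= #|T|%:R :> R by rewrite ler1n.
set D := ln (8 * #|T|%:R).
have D0 : 0 < D by rewrite ln_gt0//; lra.
(* For [m] too small to allow even [k = 1], the zero approximant and the Cauchy-Schwarz inequality
   suffice. *)
have [D_big|D_small] := lerP (m%:R / 128) D.
  exists (fun=> [ffun=> true]) => b x b0 xb; exists (fun=> 0) => t.
  have -> : \sum_j (x j - \sum_(i < m) 0 * bsign R (([ffun=> true] : {ffun J -> bool}) j)) * v t j =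
      \sum_j x j * v t j.
    by apply: eq_bigr => j _; rewrite big1 ?subr0// => i _; rewrite mul0r.
  apply: (@le_trans _ _ (A * b)).
    rewrite -(@ler_pXn2r _ 2)// ?nnegrE ?mulr_ge0 ?(ltW A0)//.
    rewrite real_normK ?num_real//; apply: (le_trans (sumr_sqr_CauchySchwarz _ _ _)).
    rewrite mulrC exprMn ler_pM ?sumr_ge0// => j _; exact: sqr_ge0.
  have -> : C * A * b * Num.sqrt (D / m%:R) =
    A * b * (C * Num.sqrt (D / m%:R)) by ring.
  rewrite -[leLHS]mulr1 ler_wpM2l ?mulr_ge0 ?(ltW A0)//.
  rewrite -[leLHS]ger0_norm// -(@ler_pXn2r _ 2)// ?nnegrE ?mulr_ge0 ?sqrtr_ge0//.
  rewrite normr1 expr1n exprMn C2 sqr_sqrtr ?divr_ge0 ?(ltW D0)//.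
  have : 128^-1 <= D / m%:R by rewrite ler_pdivlMr//; lra.
  by rewrite -mulrA; set z := D / m%:R => hz; lra.
(* The largest [k] that [kernel_width] allows; rounding down loses at most a factor 2. *)
pose k := Num.truncn (m%:R / 128 / D).
have k1 : (1 <= m%:R / 128 / D) by rewrite ler_pdivlMr// mul1r ltW.
have /andP[kle klt] : (k%:R <= m%:R / 128 / D < k.+1%:R).
  by apply: truncn_itv; rewrite (le_trans _ k1).
have k0 : (0 < k)%N by rewrite lt0n; apply/eqP => kz; move: klt; rewrite kz; lra.
have kR : 1 <= k%:R :> R by rewrite ler1n.
have k2 : m%:R / 256 / D <= k%:R.
  have -> : m%:R / 256 / D = m%:R / 128 / D / 2 by field; rewrite gt_eqF.
  by move: klt; rewrite -natr1; lra.
pose vn (t : 'I_#|T|.-1.+1) j := v (enum_val (cast_ord (prednK T0) t)) j / A.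
have vn1 t : \sum_j vn t j ^+ 2 <= 1.
  under eq_bigr do rewrite expr_div_n.
  by rewrite -mulr_suml ler_pdivrMr ?exprn_gt0// mul1r.
have [||g gP] := @kernel_width R J 'I_#|T|.-1.+1 vn m k vn1 k0.
- by rewrite card_ord.
- by rewrite card_ord prednK//; move: kle; rewrite ler_pdivlMr.
exists g => b x b0 xb.
have [bz|bnz] := eqVneq b 0.
  exists (fun=> 0) => t; rewrite bz mulr0 mul0r.
  have x0 j : x j = 0.
    apply/eqP; rewrite -sqrf_eq0; apply/eqP.
    move: xb; rewrite bz expr0n => xb.
    have : \sum_j x j ^+ 2 = 0.
      by apply/eqP; rewrite eq_le xb sumr_ge0// => i _; exact: sqr_ge0.
    move/psumr_eq0P; apply => // i _; exact: sqr_ge0.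
  rewrite big1 ?normr0// => j _; rewrite x0 big1 ?subr0 ?mul0r// => i _.
  by rewrite mul0r.
have {bnz}bpos : 0 < b by rewrite lt_neqAle eq_sym bnz.
pose tau := Num.sqrt (52 / k%:R) : R.
have [|||c cP] := @width_of_kernel J _ m vn (fun i j => bsign R (g i j)) tau _ _ (fun j => x j / b).
- exact: sqrtr_ge0.
- move=> lam H; rewrite sqr_sqrtr; first exact: gP.
  by rewrite divr_ge0.
- under eq_bigr do rewrite expr_div_n.
  by rewrite -mulr_suml ler_pdivrMr ?exprn_gt0// mul1r.
exists (fun i => b * c i) => t.
have [t' t'E] : exists t', enum_val (cast_ord (prednK T0) t') = t.
  by exists (cast_ord (esym (prednK T0)) (enum_rank t)); rewrite cast_ordKV enum_rankK.
have := cP t'.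
have -> : \sum_j (x j / b - \sum_i c i * bsign R (g i j)) * vn t' j =
   (\sum_j (x j - \sum_i b * c i * bsign R (g i j)) * v t j) / (A * b).
  rewrite mulr_suml; apply: eq_bigr => j _; rewrite /vn t'E.
  under [in RHS]eq_bigr do rewrite -mulrA.
  by rewrite -mulr_sumr; field; rewrite !gt_eqF.
rewrite normrM [X in _ * X]ger0_norm; last by rewrite invr_ge0 mulr_ge0// ltW.
rewrite ler_pdivrMr ?mulr_gt0// => /le_trans; apply.
have -> : C * A * b * Num.sqrt (D / m%:R) = A * b * (C * Num.sqrt (D / m%:R)) by ring.
rewrite mulrC ler_wpM2l ?mulr_ge0 ?(ltW A0) ?(ltW bpos)//.
rewrite -(@ler_pXn2r _ 2)// ?nnegrE ?mulr_ge0 ?sqrtr_ge0//.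
have kR0 : 0 < k%:R :> R by rewrite ltr0n.
rewrite !exprMn C2 /tau sqr_sqrtr; last by rewrite divr_ge0// ltW.
rewrite sqr_sqrtr; last by rewrite divr_ge0// ltW.
rewrite -[leRHS]mulrA ler_pM2l//.
rewrite ler_pdivrMr//.
have : m%:R <= 256 * D * k%:R.
  move: k2; rewrite ler_pdivrMr// ler_pdivrMr// => k2.
  by rewrite [256 * _]mulrC -mulrA [256 * _]mulrC mulrA [D * _]mulrC.
rewrite -(ler_pM2l (_ : 0 < m%:R^-1))//; last by rewrite invr_gt0.
rewrite mulVf ?gt_eqF//.
have -> : m%:R^-1 * (256 * D * k%:R) = 256 * (D / m%:R * k%:R) by ring.
rewrite -mulrA; set z := D / m%:R * k%:R => hz; lra.
Qed.

End width.

(** * Entropy nets and sparse approximation in finite dimension *)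

Section nets.
Variable R : realType.

Lemma sum_pair (I J : finType) (F : I * J -> R) :
  \sum_k F k = \sum_i \sum_j F (i, j).
Proof. by rewrite pair_bigA/=; apply: eq_bigr => -[]. Qed.

(* The law of independent signs with means [a k]. *)
Definition tilt (K : finType) (a : K -> R) (e : {ffun K -> bool}) : R :=
  \prod_k ((1 + a k * bsign R (e k)) / 2).

(** By independence it suffices to treat one sign: its deviation from the mean is centred and at
    most 2, whence 8 = 2 * 2^2. *)
Lemma sum_tilt_expR (K : finType) (a c : K -> R) :
  (forall k, `|a k| <= 1) ->
  \sum_e tilt a e * expR (\sum_k c k * (bsign R (e k) - a k)) <=
  expR (8 * \sum_k c k ^+ 2).
Proof.
move=> a1; under eq_bigr do rewrite expR_sum -big_split/=.
rewrite -(bigA_distr_bigA (fun k b => (1 + a k * bsign R b) / 2 *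
  expR (c k * (bsign R b - a k)))).
rewrite mulr_sumr expR_sum; apply: ler_prod => k _; rewrite !big_bool/= /bsign.
rewrite expr1 expr0 mulr1 mulrN1.
move: (a1 k); rewrite ler_norml => /andP[am ap].
set x := a k in am ap *; set y := c k.
have h b : b = 1 \/ b = -1 -> expR (y * (b - x)) <= y * (b - x) + expR (8 * y ^+ 2).
  move=> bE; apply: le_trans (expR_le_addr_sqr _) _; rewrite lerD2l ler_expR.
  have y0 : 0 <= y ^+ 2 := sqr_ge0 y.
  suff : (b - x) ^+ 2 <= 4 by rewrite exprMn; nra.
  by case: bE => ->; nra.
apply/andP; split.
  by rewrite addr_ge0// mulr_ge0 ?expR_ge0//; lra.
apply: (@le_trans _ _ ((1 - x) / 2 * (y * (-1 - x) + expR (8 * y ^+ 2)) +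
  (1 + x) / 2 * (y * (1 - x) + expR (8 * y ^+ 2)))).
  by rewrite lerD// ler_wpM2l ?h//; [lra|right|lra|left].
by rewrite le_eqVlt; apply/orP; left; apply/eqP; field.
Qed.

Lemma sum_tilt (K : finType) (a : K -> R) : \sum_e tilt a e = 1.
Proof.
rewrite -(bigA_distr_bigA (fun k b => (1 + a k * bsign R b) / 2)).
by rewrite big1// => k _; rewrite big_bool/= /bsign; field.
Qed.

Lemma tilt_ge0 (K : finType) (a : K -> R) e :
  (forall k, `|a k| <= 1) -> 0 <= tilt a e.
Proof.
move=> a1; apply: prodr_ge0 => k _.
by move: (a1 k); rewrite ler_norml /bsign; case: (e k) => /andP[? ?];
  rewrite ?expr1 ?expr0; lra.
Qed.

(** The left side is the squared [L_2] norm of the density with respect to the uniform law; each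
    factor is exactly [1 + a k ^+ 2]. *)
Lemma sum_tilt_sqr (K : finType) (a : K -> R) :
  #|{ffun K -> bool}|%:R * \sum_e tilt a e ^+ 2 <= expR (\sum_k a k ^+ 2).
Proof.
under eq_bigr do rewrite -prodrXl.
rewrite -(bigA_distr_bigA (fun k b => ((1 + a k * bsign R b) / 2) ^+ 2)).
rewrite card_ffun card_bool natrX -prodr_const -big_split/= expR_sum.
apply: ler_prod => k _; rewrite big_bool/= /bsign expr1 expr0.
have -> : 2%:R * (((1 + a k * -1) / 2) ^+ 2 + ((1 + a k * 1) / 2) ^+ 2) =
  1 + a k ^+ 2 by field.
by rewrite expR_ge1Dx andbT addr_ge0// sqr_ge0.
Qed.

Definition sign_mean (J : finType) (q : nat) (e : {ffun J * 'I_q -> bool}) (j : J) : R :=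
  q%:R^-1 * \sum_i bsign R (e (j, i)).

(* Dual Sudakov inequality: many sign patterns have means close to [x],       *)
(* since tilting the uniform law to have mean [x] costs little in L2.         *)
Lemma many_good_signs (J T : finType) (v : T -> J -> R) (A u : R) (q : nat)
    (x : J -> R) :
  0 < A -> (forall t, \sum_j v t j ^+ 2 <= A ^+ 2) -> (0 < q)%N -> (0 < #|T|)%N ->
  0 <= u -> u ^+ 2 * q%:R = 32 * A ^+ 2 * ln (4 * #|T|%:R) ->
  \sum_j x j ^+ 2 <= 1 ->
  #|{ffun J * 'I_q -> bool}|%:R * expR (- q%:R) / 4 <=
  (\sum_(e : {ffun J * 'I_q -> bool} |
     [forall t, `|\sum_j (x j - sign_mean e j) * v t j| <= u]) 1 : R).
Proof.
move=> A0 vA q0 T0 u0 uE x1.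
have qR : 0 < q%:R :> R by rewrite ltr0n.
have TR : 0 < #|T|%:R :> R by rewrite ltr0n.
pose a (k : J * 'I_q) := x k.1.
have xj1 j : `|x j| <= 1.
  rewrite -(@ler_pXn2r _ 2)// ?nnegrE// real_normK ?num_real// expr1n.
  apply: le_trans x1; rewrite (bigD1 j)//= lerDl.
  by apply: sumr_ge0 => i _; exact: sqr_ge0.
have a1 k : `|a k| <= 1 := xj1 k.1.
pose good (e : {ffun J * 'I_q -> bool}) :=
  [forall t, `|\sum_j (x j - sign_mean e j) * v t j| <= u].
pose X t (e : {ffun J * 'I_q -> bool}) := \sum_j (sign_mean e j - x j) * v t j.
have XE s t e : s * X t e =
    \sum_k (s * v t k.1 / q%:R) * (bsign R (e k) - a k).
  rewrite sum_pair/=.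
  rewrite mulr_sumr; apply: eq_bigr => j _.
  rewrite -mulr_sumr sumrB /a/= sumr_const card_ord -[x j *+ q]mulr_natl /sign_mean.
  by field; rewrite gt_eqF.
have csum s t : \sum_(k : J * 'I_q) (s * v t k.1 / q%:R) ^+ 2 <= s ^+ 2 * A ^+ 2 / q%:R.
  rewrite sum_pair/=.
  under eq_bigr do rewrite sumr_const card_ord -mulr_natl.
  apply: (@le_trans _ _ (s ^+ 2 / q%:R * \sum_j v t j ^+ 2)).
    rewrite mulr_sumr le_eqVlt; apply/orP; left; apply/eqP/eq_bigr => j _.
    by field; rewrite gt_eqF.
  by rewrite mulrAC ler_wpM2r ?invr_ge0 ?(ltW qR)// ler_wpM2l// sqr_ge0.
(* Minimiser of the Chernoff exponent 8 s^2 A^2 / q - s u. Its value there is - ln (4 [#|T|]), which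
   explains the relation imposed on [u]. *)
pose s := u * q%:R / (16 * A ^+ 2).
have s0 : 0 <= s.
  rewrite /s; apply: divr_ge0; first by rewrite mulr_ge0// ltW.
  by rewrite mulr_ge0// exprn_ge0// ltW.
have bad : \sum_(e | ~~ good e) tilt a e <= 2^-1.
  apply: (@le_trans _ _ (\sum_e \sum_t (tilt a e * expR (s * X t e) +
      tilt a e * expR ((- s) * X t e)) * expR (- (s * u)))).
    rewrite [leRHS](bigID good)/= ler_wpDl//.
      apply: sumr_ge0 => e _; apply: sumr_ge0 => t _.
      by rewrite mulr_ge0 ?expR_ge0// addr_ge0// mulr_ge0 ?expR_ge0 ?tilt_ge0.
    apply: ler_sum => e; rewrite negb_forall => /existsP[t]; rewrite -ltNge => ut.
    rewrite (bigD1 t)//= ler_wpDr//.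
      apply: sumr_ge0 => t' _.
      by rewrite mulr_ge0 ?expR_ge0// addr_ge0// mulr_ge0 ?expR_ge0 ?tilt_ge0.
    rewrite -mulrDr -mulrA ler_peMr ?tilt_ge0//.
    rewrite expRN ler_pdivlMr ?expR_gt0// mul1r.
    have : u < `|X t e|.
      have -> : X t e = - \sum_j (x j - sign_mean e j) * v t j.
        by rewrite -sumrN; apply: eq_bigr => j _; rewrite -mulNr opprB.
      by rewrite normrN.
    have e1 := expR_ge0 (s * X t e); have e2 := expR_ge0 (- s * X t e).
    rewrite lter_normr => /orP[/ltW h|/ltW h].
      by rewrite -[leLHS]addr0 lerD// ler_expR ler_wpM2l.
    by rewrite -[leLHS]add0r lerD// ler_expR mulNr -mulrN ler_wpM2l.
  rewrite exchange_big/=.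
  apply: (@le_trans _ _ (\sum_(t : T) (2 * #|T|%:R)^-1)); last first.
    rewrite sumr_const -[leLHS]mulr_natl invfM mulrCA mulfV ?mulr1//.
    by rewrite gt_eqF.
  apply: ler_sum => t _; rewrite -mulr_suml big_split/=.
  have H s' : s' ^+ 2 = s ^+ 2 -> \sum_e tilt a e * expR (s' * X t e) <=
     expR (8 * (s ^+ 2 * A ^+ 2 / q%:R)).
    move=> s'E; under eq_bigr do rewrite XE.
    apply: (le_trans (sum_tilt_expR _ a1)).
    by rewrite ler_expR ler_wpM2l// (le_trans (csum _ _))// s'E.
  apply: (@le_trans _ _ (2 * expR (8 * (s ^+ 2 * A ^+ 2 / q%:R)) * expR (- (s * u)))).
    rewrite ler_wpM2r ?expR_ge0// mulr_natl mulr2n.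
    by apply: lerD; apply: H => //; rewrite sqrrN.
  rewrite -mulrA -expRD.
  have -> : 8 * (s ^+ 2 * A ^+ 2 / q%:R) + - (s * u) = - ln (4 * #|T|%:R).
    have -> : ln (4 * #|T|%:R) = u ^+ 2 * q%:R / (32 * A ^+ 2).
      by rewrite uE mulrAC mulfV ?mul1r// gt_eqF// mulr_gt0// exprn_gt0.
    by rewrite /s; field; rewrite !gt_eqF.
  rewrite expRN lnK ?posrE ?mulr_gt0//.
  by rewrite le_eqVlt; apply/orP; left; apply/eqP; field; rewrite gt_eqF.
have goodP : 2^-1 <= \sum_(e | good e) tilt a e.
  have := sum_tilt a; rewrite (bigID good)/=; lra.
(* The good patterns carry at least half of the tilted mass, and the tilted law has small [L_2]
   norm, so they must be numerous. *)
have := sumr_sqr_CauchySchwarz good (fun=> 1) (tilt a).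
under eq_bigr do rewrite mul1r.
under [X in _ <= X * _]eq_bigr do rewrite expr1n.
set S := \sum_(e | good e) 1 => CS.
have S0 : 0 <= S by exact: sumr_ge0.
have sq : \sum_(e | good e) tilt a e ^+ 2 <= expR q%:R / #|{ffun J * 'I_q -> bool}|%:R.
  rewrite ler_pdivlMr; last by rewrite card_ffun card_bool natrX exprn_gt0.
  apply: (@le_trans _ _ (expR (\sum_k a k ^+ 2))).
    apply: le_trans (sum_tilt_sqr a); rewrite mulrC ler_wpM2l//.
    rewrite [leRHS](bigID good)/= lerDl.
    by apply: sumr_ge0 => e _; exact: sqr_ge0.
  rewrite ler_expR sum_pair /a/=.
  under eq_bigr do rewrite sumr_const card_ord -mulr_natl.
  by rewrite -mulr_sumr ler_piMr// ltW.
have : 4^-1 <= S * (expR q%:R / #|{ffun J * 'I_q -> bool}|%:R).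
  apply: (@le_trans _ _ (S * \sum_(e | good e) tilt a e ^+ 2)); last exact: ler_wpM2l.
  apply: le_trans CS.
  have -> : 4^-1 = 2^-1 ^+ 2 :> R by field.
  by rewrite lerXn2r ?nnegrE//; apply: le_trans goodP.
rewrite expRN => H.
rewrite ler_pdivrMr// ler_pdivrMr ?expR_gt0//.
move: H; rewrite mulrA ler_pdivlMr; last by rewrite card_ffun card_bool natrX exprn_gt0.
lra.
Qed.

(** Packing argument. The good sign patterns of points more than 2 u apart are disjoint, and each
    point owns a fraction exp (- q) / 4 of all patterns, so a separated family has at most 4 exp (q)
    <= 2^(4 q) members. One of maximal size is a net of radius 2 u. *)
Lemma exists_net : exists2 C : R, 0 < C &
  forall (J T : finType) (v : T -> J -> R) (A b : R) (q : nat),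
  0 < A -> (forall t, \sum_j v t j ^+ 2 <= A ^+ 2) -> (0 < q)%N -> (0 < #|T|)%N ->
  0 <= b ->
  exists y : nat -> J -> R, forall x : J -> R, \sum_j x j ^+ 2 <= b ^+ 2 ->
  exists2 i, (i < 2 ^ (4 * q))%N &
  forall t, `|\sum_j (x j - y i j) * v t j| <=
    C * A * b * Num.sqrt (ln (8 * #|T|%:R) / q%:R).
Proof.
exists 16 => // J T v A b q A0 vA q0 T0 b0.
have qR : 0 < q%:R :> R by rewrite ltr0n.
have TR : 1 <= #|T|%:R :> R by rewrite ler1n.
set D := ln (8 * #|T|%:R).
have [bz|bnz] := eqVneq b 0.
  exists (fun=> fun=> 0) => x xb; exists 0%N; first by rewrite expn_gt0.
  move=> t; rewrite bz mulr0 mul0r.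
  have x0 j : x j = 0.
    apply/eqP; rewrite -sqrf_eq0; apply/eqP.
    move: xb; rewrite bz expr0n => xb.
    have : \sum_j x j ^+ 2 = 0.
      by apply/eqP; rewrite eq_le xb sumr_ge0// => i _; exact: sqr_ge0.
    move/psumr_eq0P; apply => // i _; exact: sqr_ge0.
  by rewrite big1 ?normr0// => j _; rewrite x0 subr0 mul0r.
have {bnz}bpos : 0 < b by rewrite lt_neqAle eq_sym bnz.
pose L : R := ln (4 * #|T|%:R).
have L0 : 0 <= L by rewrite ln_ge0//; lra.
have LD : L <= D by rewrite ler_ln ?posrE//; lra.
pose u := A * Num.sqrt (32 * L / q%:R).
have u0 : 0 <= u by rewrite mulr_ge0 ?sqrtr_ge0// ltW.
have uE : u ^+ 2 * q%:R = 32 * A ^+ 2 * L.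
  rewrite exprMn sqr_sqrtr; last by rewrite divr_ge0 ?mulr_ge0// ltW.
  by field; rewrite gt_eqF.
pose far (x y : J -> R) := exists t, 2 * u < `|\sum_j (x j - y j) * v t j|.
pose P n := exists f : nat -> J -> R, (forall i, (i < n)%N -> \sum_j f i j ^+ 2 <= 1) /\
  (forall i k, (i < k < n)%N -> far (f i) (f k)).
have Pbound n : P n -> (n <= 2 ^ (4 * q))%N.
  move=> [f [f1 ffar]].
  pose N : R := #|{ffun J * 'I_q -> bool}|%:R.
  have N0 : 0 < N by rewrite /N card_ffun card_bool natrX exprn_gt0.
  pose good i (e : {ffun J * 'I_q -> bool}) :=
    [forall t, `|\sum_j (f i j - sign_mean e j) * v t j| <= u].
  have disj e i k : (i < k < n)%N -> good i e -> good k e -> False.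
    move=> ikn /forallP gi /forallP gk; have [t] := ffar _ _ ikn.
    apply/negP; rewrite -leNgt.
    have -> : \sum_j (f i j - f k j) * v t j =
       \sum_j (f i j - sign_mean e j) * v t j - \sum_j (f k j - sign_mean e j) * v t j.
      by rewrite -sumrB; apply: eq_bigr => j _; ring.
    by apply: (le_trans (ler_normB _ _)); rewrite mulr_natl mulr2n lerD.
  have tot : \sum_(i < n) \sum_(e | good i e) 1 <= N.
    under eq_bigr do rewrite big_mkcond.
    rewrite exchange_big/= /N -sumr_const; apply: ler_sum => e _.
    rewrite -big_mkcond/=.
    have [/existsP[i gi]|/existsPn none] := boolP [exists i : 'I_n, good i e].
      rewrite (bigD1 i)//= big1 ?addr0// => k /andP[gk ki].
      have [lt|gt|/val_inj eq] := ltngtP i k.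
      - by exfalso; apply: (disj e i k) => //; rewrite lt/=.
      - by exfalso; apply: (disj e k i) => //; rewrite gt/=.
      - by move: ki; rewrite eq eqxx.
    by rewrite big1// => i gi; move: (none i); rewrite gi.
  have low : n%:R * (N * expR (- q%:R) / 4) <= N.
    apply: le_trans tot; rewrite mulr_natl.
    rewrite -[X in _ *+ X](card_ord n) -sumr_const; apply: ler_sum => i _.
    by apply: (many_good_signs A0 vA q0 T0 u0 uE); exact: f1.
  rewrite -(ler_nat R) natrX; apply: (@le_trans _ _ (4 * expR q%:R)).
    move: low; have -> : n%:R * (N * expR (- q%:R) / 4) = N * (n%:R * expR (- q%:R) / 4).
      by ring.
    rewrite -[leRHS]mulr1 ler_pM2l// ler_pdivrMr// mul1r expRN.
    by rewrite ler_pdivrMr ?expR_gt0// mulrC.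
  rewrite -[q%:R]mulr1 expRM_natl exprM.
  have e3 : expR 1 <= 4 :> R.
    have h := expR_ge1Dx (- 2^-1 : R).
    have -> : expR 1 = (expR (- 2^-1) ^+ 2)^-1 :> R.
      by rewrite -expRM_natl -expRN; congr expR; rewrite mulrN opprK mulfV.
    have -> : 4 = (2^-1 ^+ 2)^-1 :> R by field.
    rewrite lef_pV2 ?posrE ?exprn_gt0 ?expR_gt0// lerXn2r ?nnegrE ?expR_ge0//; lra.
  apply: (@le_trans _ _ (4 ^+ q * 4 ^+ q)).
    apply: ler_pM; rewrite ?expR_ge0 ?exprn_ge0 ?expR_ge0//.
      by rewrite -{1}[4]expr1 ler_weXn2l//; lra.
    by rewrite lerXn2r ?nnegrE ?expR_ge0.
  rewrite -exprMn lerXn2r ?nnegrE ?exprn_ge0//.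
  by rewrite -!natrM -natrX ler_nat.
have [n Pn nmax] : exists2 n, P n & forall k, P k -> (k <= n)%N.
  have exP : exists n, (fun n => `[< P n >]) n.
    exists 0%N; apply/asboolP; exists (fun=> fun=> 0); split => //.
    by move=> i k; rewrite ltn0 andbF.
  have ubP n : (fun n => `[< P n >]) n -> (n <= 2 ^ (4 * q))%N.
    by move=> /asboolP /Pbound.
  case: (ex_maxnP exP ubP) => n /asboolP Pn nmax; exists n => // k Pk; apply: nmax; exact/asboolP.
have nle := Pbound _ Pn.
have {Pn}[f [f1 ffar]] := Pn.
exists (fun i j => b * f i j) => x xb.
pose z j := x j / b.
have z1 : \sum_j z j ^+ 2 <= 1.
  under eq_bigr do rewrite expr_div_n.
  by rewrite -mulr_suml ler_pdivrMr ?exprn_gt0// mul1r.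
have [i iln iP] : exists2 i, (i < n)%N & ~ far (f i) z.
  apply: contrapT => none.
  have : P n.+1.
    exists (fun i => if (i < n)%N then f i else z); split=> [i _|i k /andP[ik]].
      by case: ifPn => // /f1.
    rewrite ltnS => kn; rewrite (leq_trans ik kn).
    case: ltnP => [kn'|nk]; first by apply: ffar; rewrite ik.
    apply: contrapT => nfar; apply: none; exists i => //.
    exact: leq_trans ik kn.
  by move=> /nmax; rewrite ltnn.
exists i; first exact: leq_trans iln nle.
move=> t.
have -> : \sum_j (x j - b * f i j) * v t j = - b * \sum_j (f i j - z j) * v t j.
  rewrite mulr_sumr; apply: eq_bigr => j _; rewrite /z.
  by field; rewrite gt_eqF.
rewrite normrM normrN (ger0_norm b0).
have {}iP : `|\sum_j (f i j - z j) * v t j| <= 2 * u.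
  by rewrite leNgt; apply/negP => lt; apply: iP; exists t.
have -> : 16 * A * b * Num.sqrt (D / q%:R) = b * (16 * A * Num.sqrt (D / q%:R)) by ring.
rewrite ler_wpM2l//; apply: (le_trans iP).
have -> : 2 * u = A * (2 * Num.sqrt (32 * L / q%:R)) by rewrite /u; ring.
have -> : 16 * A * Num.sqrt (D / q%:R) = A * (16 * Num.sqrt (D / q%:R)) by ring.
rewrite ler_wpM2l ?(ltW A0)//.
rewrite -(@ler_pXn2r _ 2)// ?nnegrE ?mulr_ge0 ?sqrtr_ge0//.
have D0 : 0 <= D := le_trans L0 LD.
rewrite !exprMn !sqr_sqrtr ?divr_ge0 ?mulr_ge0 ?(ltW qR)//.
rewrite !mulrA ler_wpM2r ?invr_ge0 ?(ltW qR)//.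
rewrite expr2; lra.
Qed.

(** Draw [q] indices with probability proportional to [|z j|] and average the signed functionals;
    the expectation is exact and the exponential moments control the deviation in all [t]. *)
Lemma exists_sparse : exists2 C : R, 0 < C &
  forall (J T : finType) (w : T -> J -> R) (A B : R) (q : nat) (z : J -> R),
  0 < B -> (forall t j, `|w t j| <= B) -> (0 < q)%N -> (0 < #|T|)%N ->
  \sum_j `|z j| <= A ->
  exists (l : seq J) (c : J -> R), (size l <= q)%N /\
  forall t, `|\sum_j z j * w t j - \sum_(j <- l) c j * w t j| <=
    C * A * B * Num.sqrt (ln (8 * #|T|%:R) / q%:R).
Proof.
exists 8 => // J T w A B q z B0 wB q0 T0 zA.
have qR : 0 < q%:R :> R by rewrite ltr0n.
have TR : 1 <= #|T|%:R :> R by rewrite ler1n.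
set D := ln (8 * #|T|%:R).
have D0 : 0 < D by rewrite ln_gt0//; lra.
set L := \sum_j `|z j| in zA.
have L0 : 0 <= L by exact: sumr_ge0.
have A0 : 0 <= A := le_trans L0 zA.
have [L_eq0|L_neq0] := eqVneq L 0.
  exists [::], (fun=> 0); split => // t.
  have z0 j : z j = 0.
    by apply/normr0_eq0; apply: (psumr_eq0P _ L_eq0).
  rewrite big_nil subr0 big1 ?normr0; last by move=> j _; rewrite z0 mul0r.
  by rewrite !mulr_ge0 ?sqrtr_ge0// ltW.
have {L_neq0}L_gt0 : 0 < L by rewrite lt_neqAle eq_sym L_neq0.
pose sg j : bool := z j < 0.
have sgE j : bsign R (sg j) * `|z j| = z j.
  rewrite /bsign /sg; case: ltrP => [lt0|ge0].
    by rewrite ltr0_norm// expr1 mulN1r opprK.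
  by rewrite ger0_norm// expr0 mul1r.
pose W t := (\sum_j z j * w t j) / L.
have WE t : \sum_j `|z j| / L * (bsign R (sg j) * w t j) = W t.
  rewrite /W mulr_suml; apply: eq_bigr => j _.
  by rewrite -{2}(sgE j); ring.
have sumz : \sum_j `|z j| / L = 1 by rewrite -mulr_suml divff// gt_eqF.
have WB t : `|W t| <= B.
  rewrite -WE; apply: (le_trans (ler_norm_sum _ _ _)).
  rewrite -[B]mul1r -sumz mulr_suml; apply: ler_sum => j _.
  rewrite normrM ger0_norm ?divr_ge0// ler_wpM2l ?divr_ge0//.
  by rewrite normrM norm_bsign mul1r.
(* Chosen so that the exponent 2 (2 B s)^2 q of [exists_sample_exp] equals D / 2. *)
pose s := Num.sqrt (D / q%:R) / (4 * B).
have sq0 : 0 < Num.sqrt (D / q%:R) by rewrite sqrtr_gt0 divr_gt0.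
have s0 : 0 < s by rewrite divr_gt0// mulr_gt0.
(* The boolean in the index carries both signs of the deviation, so that one exponential sum bounds
   absolute values. *)
pose h (j : J) (u : T * bool) : R :=
  s * (bsign R u.2 * (bsign R (sg j) * w u.1 j - W u.1)).
have [|||l lq lP] := @exists_sample_exp R J _ (fun j => `|z j| / L) h (s * (2 * B)) _ sumz _ _ q.
- by move=> j; rewrite divr_ge0.
- move=> u; rewrite /h.
  transitivity (s * bsign R u.2 * (\sum_j `|z j| / L * (bsign R (sg j) * w u.1 j) -
     (\sum_j `|z j| / L) * W u.1)).
    rewrite mulr_suml -sumrB mulr_sumr; apply: eq_bigr => j _; ring.
  by rewrite WE sumz mul1r subrr mulr0.
- move=> j u; rewrite /h normrM (ger0_norm (ltW s0)) ler_wpM2l ?(ltW s0)//.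
  rewrite normrM norm_bsign mul1r mulr_natl mulr2n.
  apply: (le_trans (ler_normB _ _)); rewrite lerD//.
  by rewrite normrM norm_bsign mul1r.
exists l, (fun j => bsign R (sg j) * (L / q%:R)); split; first by rewrite lq.
move=> t; set S := \sum_(j <- l) bsign R (sg j) * w t j.
have -> : \sum_j z j * w t j - \sum_(j <- l) bsign R (sg j) * (L / q%:R) * w t j =
    - (L / q%:R) * (S - q%:R * W t).
  have -> : \sum_(j <- l) bsign R (sg j) * (L / q%:R) * w t j = L / q%:R * S.
    by rewrite mulr_sumr; apply: eq_bigr => j _; ring.
  have -> : \sum_j z j * w t j = L * W t by rewrite /W mulrCA divff ?mulr1// gt_eqF.
  by field; rewrite gt_eqF.
suff H b : s * (bsign R b * (S - q%:R * W t)) <= 2 * D.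
  have {}H : `|S - q%:R * W t| <= 8 * B * q%:R * Num.sqrt (D / q%:R).
    have E : 8 * B * q%:R * Num.sqrt (D / q%:R) = 2 * D / s.
      rewrite /s; set r := Num.sqrt _ in sq0 *.
      have r2 : D = r ^+ 2 * q%:R by rewrite sqr_sqrtr ?divfK ?gt_eqF// divr_ge0// ltW.
      by rewrite r2; field; rewrite !gt_eqF.
    rewrite E ler_pdivlMr// mulrC.
    case: (lerP 0 (S - q%:R * W t)) => h0.
      by have := H false; rewrite /bsign expr0 mul1r ger0_norm.
    by have := H true; rewrite /bsign expr1 mulN1r ltr0_norm.
  rewrite normrM normrN (@ger0_norm _ (L / q%:R)); last by rewrite divr_ge0// ltW.
  apply: (@le_trans _ _ (L / q%:R * (8 * B * q%:R * Num.sqrt (D / q%:R)))).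
    by rewrite ler_wpM2l// divr_ge0// ltW.
  have -> : L / q%:R * (8 * B * q%:R * Num.sqrt (D / q%:R)) =
    L * (8 * B * Num.sqrt (D / q%:R)) by field; rewrite gt_eqF.
  have -> : 8 * A * B * Num.sqrt (D / q%:R) = A * (8 * B * Num.sqrt (D / q%:R)) by ring.
  by rewrite ler_wpM2r// !mulr_ge0// ltW.
have hE : s * (bsign R b * (S - q%:R * W t)) = \sum_(j <- l) h j (t, b).
  rewrite /h/= -mulr_sumr; congr (_ * _); rewrite -mulr_sumr; congr (_ * _).
  by rewrite sumrB big_const_seq count_predT lq iter_addr_0 mulr_natl.
rewrite hE -ler_expR; apply: (@le_trans _ _ (\sum_u expR (\sum_(j <- l) h j u))).
  rewrite (bigD1 (t, b))//= lerDl; apply: sumr_ge0 => u _; exact: expR_ge0.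
apply: (le_trans lP).
have -> : 2 * (s * (2 * B)) ^+ 2 * q%:R = D / 2.
  rewrite /s; set r := Num.sqrt _ in sq0 *.
  have r2 : D = r ^+ 2 * q%:R by rewrite sqr_sqrtr ?divfK ?gt_eqF// divr_ge0// ltW.
  by rewrite r2; field; rewrite gt_eqF.
apply: (@le_trans _ _ (expR D * expR D)).
  apply: ler_pM; rewrite ?expR_ge0//; last by rewrite ler_expR; lra.
  rewrite lnK ?posrE; last lra.
  by rewrite card_prod card_bool natrM; lra.
by rewrite -expRD ler_expR; lra.
Qed.

End nets.

(** * Integrals of bounded functions on the torus *)

Section bounded_measurable.
Context d (T : measurableType d) (R : realType).
Variable mu : {finite_measure set T -> \bar R}.
Implicit Types f g h : T -> R.

(** An algebra of functions, all integrable for a finite measure; the basis functions and the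
    truncated kernels stay in it, which keeps the integrability obligations light. *)
Definition bmeas f := measurable_fun [set: T] f /\ exists M, forall x, `|f x| <= M.

Definition Rint f := mu.-integrable [set: T] (EFin \o f).

Lemma bmeas_cst (c : R) : bmeas (fun=> c).
Proof. by split; [exact: measurable_cst|exists `|c|]. Qed.

Lemma bmeas_add f g : bmeas f -> bmeas g -> bmeas (fun x => f x + g x).
Proof.
move=> [mf [M fM]] [mg [N gN]]; split; first exact: measurable_funD.
by exists (M + N) => x; rewrite (le_trans (ler_normD _ _))// lerD.
Qed.

Lemma bmeas_mul f g : bmeas f -> bmeas g -> bmeas (fun x => f x * g x).
Proof.
move=> [mf [M fM]] [mg [N gN]]; split; first exact: measurable_funM.
by exists (M * N) => x; rewrite normrM ler_pM.
Qed.

Lemma bmeas_abs f : bmeas f -> bmeas (fun x => `|f x|).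
Proof.
move=> [mf [M fM]]; split; first exact: measurableT_comp.
by exists M => x; rewrite normr_id.
Qed.

Lemma bmeas_sum (I : Type) (r : seq I) (f : I -> T -> R) :
  (forall i, bmeas (f i)) -> bmeas (fun x => \sum_(i <- r) f i x).
Proof.
move=> bf; elim: r => [|i r IH].
  by under eq_fun do rewrite big_nil; exact: bmeas_cst.
by under eq_fun do rewrite big_cons; exact: bmeas_add.
Qed.

Lemma bmeas_prod (I : Type) (r : seq I) (f : I -> T -> R) :
  (forall i, bmeas (f i)) -> bmeas (fun x => \prod_(i <- r) f i x).
Proof.
move=> bf; elim: r => [|i r IH].
  by under eq_fun do rewrite big_nil; exact: bmeas_cst.
by under eq_fun do rewrite big_cons; exact: bmeas_mul.
Qed.

Lemma Rint_dom f g : measurable_fun [set: T] f -> (forall x, `|f x| <= `|g x|) ->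
  Rint g -> Rint f.
Proof.
move=> mf fg; apply: le_integrable => //; first exact/measurable_EFinP.
by move=> x _ /=; rewrite lee_fin.
Qed.

Lemma measurable_Rint f : Rint f -> measurable_fun [set: T] f.
Proof. by move=> /measurable_int /measurable_EFinP. Qed.

Lemma Rint_cst (c : R) : Rint (fun=> c).
Proof.
apply: measurable_bounded_integrable => //.
- by rewrite -ge0_fin_numE// fin_num_measure.
- by exists `|c|; split; [exact: num_real|move=> y cy x _ /=; exact: ltW].
Qed.

Lemma bmeas_Rint f : bmeas f -> Rint f.
Proof.
move=> [mf [M fM]]; apply: (Rint_dom mf _ (Rint_cst M)) => x.
by rewrite (le_trans (fM x))// ler_norm.
Qed.

Lemma Rint_add f g : Rint f -> Rint g ->
  Rint (fun x => f x + g x).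
Proof. by move=> i_f i_g; exact: (integrableD measurableT i_f i_g). Qed.

Lemma Rint_scale (c : R) f : Rint f -> Rint (fun x => c * f x).
Proof. by move=> i_f; exact: (integrableZl measurableT c i_f). Qed.

Lemma Rint_abs f : Rint f -> Rint (fun x => `|f x|).
Proof. by move=> /integrable_abse. Qed.

Lemma Rint_bmul f g : bmeas f -> Rint g -> Rint (fun x => f x * g x).
Proof.
move=> [mf [M fM]] ig; apply: (@Rint_dom _ (fun x => M * g x)).
- by apply: measurable_funM => //; exact: measurable_Rint.
- by move=> x; rewrite !normrM ler_wpM2r// (le_trans (fM x))// ler_norm.
- exact: Rint_scale.
Qed.

Lemma Rint_bigsum (I : Type) (r : seq I) (f : I -> T -> R) :
  (forall i, Rint (f i)) -> Rint (fun x => \sum_(i <- r) f i x).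
Proof.
move=> bf; elim: r => [|i r IH].
  by under eq_fun do rewrite big_nil; exact: Rint_cst.
by under eq_fun do rewrite big_cons; exact: Rint_add.
Qed.

Lemma Rintegral_bigsum (I : Type) (r : seq I) (f : I -> T -> R) :
  (forall i, Rint (f i)) ->
  \int[mu]_x (\sum_(i <- r) f i x) = \sum_(i <- r) \int[mu]_x f i x.
Proof.
move=> bf; elim: r => [|i r IH].
  rewrite big_nil; under eq_Rintegral do rewrite big_nil.
  by rewrite Rintegral_cst// mul0r.
under eq_Rintegral do rewrite big_cons.
rewrite RintegralD//; [by rewrite IH big_cons|exact: bf|exact: Rint_bigsum].
Qed.

(** Expand the nonnegative integral of (u - s / V)^2, where [s] is the partial Fourier sum. A common
    bound [V] replaces normalisation because some [n i] may vanish, as for the sine of frequency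
    zero. *)
Lemma Bessel (I : finType) (e : I -> T -> R) (n : I -> R) (V : R) (u : T -> R) :
  (forall i, bmeas (e i)) -> 0 < V ->
  (forall i, n i <= V) ->
  (forall i j, \int[mu]_x (e i x * e j x) = (i == j)%:R * n i) ->
  Rint u -> Rint (fun x => u x ^+ 2) ->
  \sum_i (\int[mu]_x (e i x * u x)) ^+ 2 <= V * \int[mu]_x (u x ^+ 2).
Proof.
move=> be V0 nV orth iu iu2.
pose c i := \int[mu]_x (e i x * u x).
have ie i : Rint (fun x => e i x * u x) by exact: Rint_bmul.
pose s x := \sum_i c i * e i x.
have bs : bmeas s by apply: bmeas_sum => i; exact: bmeas_mul (bmeas_cst _) (be i).
have ius : Rint (fun x => s x * u x) by exact: Rint_bmul.
have is2 : Rint (fun x => s x ^+ 2).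
  by apply: bmeas_Rint; under eq_fun do rewrite expr2; exact: bmeas_mul.
have Eus : \int[mu]_x (s x * u x) = \sum_i c i ^+ 2.
  rewrite /s; under eq_Rintegral do rewrite mulr_suml.
  rewrite Rintegral_bigsum; last first.
    by move=> i; under eq_fun do rewrite -mulrA; exact: Rint_scale.
  apply: eq_bigr => i _; under eq_Rintegral do rewrite -mulrA.
  by rewrite (RintegralZl _ measurableT (ie i)).
have Es2 : \int[mu]_x (s x ^+ 2) = \sum_i c i ^+ 2 * n i.
  have iee i j : Rint (fun x => c i * e i x * (c j * e j x)).
    apply: bmeas_Rint; apply: bmeas_mul;
      exact: bmeas_mul (bmeas_cst _) (be _).
  transitivity (\int[mu]_x (\sum_i \sum_j c i * e i x * (c j * e j x))).
    apply: eq_Rintegral => x _; rewrite /s expr2 mulr_suml.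
    by apply: eq_bigr => i _; rewrite mulr_sumr.
  rewrite Rintegral_bigsum; last by move=> i; exact: Rint_bigsum.
  apply: eq_bigr => i _; rewrite Rintegral_bigsum//.
  rewrite (bigD1 i)//= big1 ?addr0.
    under eq_Rintegral do rewrite mulrACA.
    rewrite RintegralZl//; last by apply: bmeas_Rint; exact: bmeas_mul.
    by rewrite orth eqxx mul1r expr2.
  move=> j ji; under eq_Rintegral do rewrite mulrACA.
  rewrite RintegralZl//; last by apply: bmeas_Rint; exact: bmeas_mul.
  by rewrite orth eq_sym (negbTE ji) mul0r mulr0.
have : 0 <= \int[mu]_x (u x - V^-1 * s x) ^+ 2.
  by apply: Rintegral_ge0 => x _; exact: sqr_ge0.
have -> : \int[mu]_x (u x - V^-1 * s x) ^+ 2 =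
    \int[mu]_x (u x ^+ 2) + (- (2 / V)) * (\sum_i c i ^+ 2) + V^-1 ^+ 2 * \sum_i c i ^+ 2 * n i.
  rewrite -Eus -Es2 -!RintegralZl// -!RintegralD//.
  - by apply: eq_Rintegral => x _; field; rewrite gt_eqF.
  - by apply: Rint_add => //; exact: Rint_scale.
  - exact: Rint_scale.
  - exact: Rint_scale.
rewrite -/c; set S := \sum_i c i ^+ 2.
have : \sum_i c i ^+ 2 * n i <= V * S.
  rewrite mulr_sumr; apply: ler_sum => i _.
  by rewrite mulrC ler_wpM2r// sqr_ge0.
move=> h1 h2; rewrite -(ler_pM2l (_ : 0 < V^-1)) ?invr_gt0// mulKf ?gt_eqF//.
have h3 : V^-1 ^+ 2 * \sum_i c i ^+ 2 * n i <= V^-1 ^+ 2 * (V * S).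
  by rewrite ler_wpM2l// exprn_ge0// invr_ge0 ltW.
have E : V^-1 ^+ 2 * (V * S) = V^-1 * S by field; rewrite gt_eqF.
have E' : - (2 / V) * S = - (2 * (V^-1 * S)) by ring.
rewrite E in h3; rewrite E' in h2; lra.
Qed.

End bounded_measurable.

(** * Lebesgue measure on the circle and integrals of tensor products *)

Section circle.
Variable R : realType.
Local Notation mc := (circle_measure R).

Lemma circle_integral (f : R -> R) : bmeas (f : measurableTypeR R -> R) ->
  \int[mc]_x f x = \int[lebesgue_measure]_(x in `[0, 2 * pi]) f x.
Proof.
move=> bf; rewrite /Rintegral; congr fine.
have mC : measurable (@circle R) := @measurable_circle R.
rewrite (@negligible_integral _ _ _ _ _ (~` @circle R))//.
- rewrite setTD setCK; apply: eq_measure_integral => A mA AC.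
  by rewrite /circle_measure/= /mfrestr /mrestr setIidl.
- exact: measurableC.
- exact: bmeas_Rint.
- by rewrite /circle_measure/= /mfrestr /mrestr setICl measure0.
Qed.

Lemma circle_measureT : fine (mc [set: _]) = 2 * pi.
Proof.
rewrite /circle_measure/= /mfrestr /mrestr setTI lebesgue_measure_itv/= lte_fin.
by rewrite mulr_gt0 ?pi_gt0//= oppr0 addr0.
Qed.

Lemma continuous_bmeas (f : R -> R) (M : R) : continuous f -> (forall x, `|f x| <= M) ->
  bmeas (f : measurableTypeR R -> R).
Proof.
by move=> fc fM; split; [exact: continuous_measurable_fun|exists M].
Qed.

Lemma continuous_cos_affine (w c : R) : continuous (fun x : R => cos (c + x * w)).
Proof.
move=> x; have -> : (fun x0 : R => cos (c + x0 * w)) = cos \o (fun x0 => c + x0 * w) by [].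
apply: continuous_comp; last exact: continuous_cos.
apply/differentiable_continuous/derivable1_diffP.
by have [] := is_derive_affine c w x.
Qed.

Lemma bmeas_cos_affine (w c : R) : bmeas (fun x : measurableTypeR R => cos (c + x * w)).
Proof.
apply: (@continuous_bmeas (fun x => cos (c + x * w)) 1); first exact: continuous_cos_affine.
by move=> x; rewrite ler_norml cos_geN1 cos_le1.
Qed.

Lemma sinD_2pin (n : nat) (x : R) : sin (x + 2 * pi * n%:R) = sin x.
Proof.
have -> : 2 * pi * n%:R = (pi *+ 2) *+ n :> R by rewrite -(mulr_natl pi) mulr_natr.
exact: (periodicn (@sinD2pi R)).
Qed.

(** Frequencies are differences of naturals so that both terms of a product-to-sum formula are
    covered. *)
Lemma circle_integral_cos (m n : nat) (c : R) : m != n ->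
  \int[mc]_x cos (c + x * (m%:R - n%:R)) = 0.
Proof.
move=> mn; set w := m%:R - n%:R.
have w0 : w != 0 by rewrite subr_eq0 eqr_nat.
rewrite circle_integral; last exact: bmeas_cos_affine.
pose F (x : R) := w^-1 * sin (c + x * w).
have dF (x : R) : is_derive x (1 : R) F (cos (c + x * w)).
  have h1 : is_derive (c + x * w) (1 : R) (fun y => w^-1 * sin y) (w^-1 * cos (c + x * w)).
    by apply: is_derive_eq; rewrite /= ?scaler0 ?add0r.
  have := @is_derive1_comp R (fun y => w^-1 * sin y) (fun x => c + x * w) x _ _ h1 (is_derive_affine c w x).
  by rewrite mulrAC mulVf// mul1r.
have Fc : continuous F.
  move=> x; apply/differentiable_continuous/derivable1_diffP.
  by have [] := dF x.
have cc := @continuous_cos_affine w c.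
have pi0 : 0 < 2 * pi :> R by rewrite mulr_gt0// pi_gt0.
rewrite /Rintegral (@continuous_FTC2 _ _ F)//.
- rewrite /F mul0r addr0 /= /w mulrBr addrA.
  rewrite -[sin (c + _ - _)](sinD_2pin n) subrK sinD_2pin subrr.
  by [].
- exact: continuous_subspaceT.
- split => [x _||].
  + by have [] := dF x.
  + exact/cvg_at_right_filter/Fc.
  + exact/cvg_at_left_filter/Fc.
- by move=> x _; rewrite derive1E; have [_ ->] := dF x.
Qed.

End circle.

Section torus_integral.
Variable R : realType.
Local Notation mc := (circle_measure R).
Local Notation mu := (torus_measure R).

Lemma integrable_tcons d (f : rpoint R d.+1 -> R) : bmeas f ->
  (mc \x mu d)%E.-integrable setT (EFin \o (fun z => f (@tcons R d z))).
Proof.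
move=> [mf [M fM]]; apply: measurable_bounded_integrable => //.
- apply: (@le_lt_trans _ _ (mc setT * mu d setT)%E).
    by rewrite -product_measure1E// setXTT.
  by rewrite lte_mul_pinfty// ?ltey_eq fin_num_measure.
- exact: (measurableT_comp mf (@measurable_tcons R d)).
- exists `|M|; split; [exact: num_real|move=> y cy z _ /=].
  by rewrite (le_trans (fM _))// (le_trans (ler_norm _))// ltW.
Qed.

Lemma torus_integral_cons d (f : rpoint R d.+1 -> R) : bmeas f ->
  \int[mu d.+1]_x f x = \int[(mc \x mu d)%E]_z f (tcons z).
Proof.
move=> bf; rewrite /Rintegral; congr fine.
have mt := @measurable_tcons R d.
transitivity (\int[pushforward (mc \x mu d)%E (@tcons R d)]_x (f x)%:E)%E.
  exact: eq_measure_integral.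
rewrite integral_pushforward//.
- by apply/measurable_EFinP; case: bf.
- by rewrite preimage_setT; exact: integrable_tcons.
Qed.

Lemma torus_integral_consM d (g : R -> R) (h : rpoint R d -> R)
    (f : rpoint R d.+1 -> R) : bmeas f ->
  bmeas (g : measurableTypeR R -> R) -> bmeas h ->
  (forall z x, f (tcons (z, x)) = g z * h x) ->
  \int[mu d.+1]_x f x = (\int[mc]_z g z) * (\int[mu d]_x h x).
Proof.
move=> bf bg bh fgh; rewrite torus_integral_cons// /Rintegral -integral12_prod_meas1; last first.
  exact: integrable_tcons.
rewrite /fubini_F.
have ih := bmeas_Rint (mu d) bh; have ig := bmeas_Rint mc bg.
transitivity (fine (\int[mc]_x ((\int[mu d]_y h y) * g x)%:E)).
  congr fine; apply: eq_integral => z _.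
  transitivity (\int[mu d]_y ((g z)%:E * (h y)%:E))%E.
    by apply: eq_integral => y _; rewrite fgh.
  rewrite integralZl// mulrC EFinM; congr (_ * _)%E.
  by rewrite /Rintegral fineK//; exact: integrable_fin_num.
rewrite [RHS]mulrC; exact: (RintegralZl _ measurableT ig).
Qed.

Lemma bmeas_coord d (h : R -> R) (j : 'I_d) : bmeas (h : measurableTypeR R -> R) ->
  bmeas (fun x : rpoint R d => h (tnth x j)).
Proof.
move=> [mh [M hM]]; split; last by exists M.
exact: (measurableT_comp mh (measurable_tnth j)).
Qed.

Lemma bmeas_tensor d (h : 'I_d -> R -> R) :
  (forall j, bmeas (h j : measurableTypeR R -> R)) ->
  bmeas (fun x : rpoint R d => \prod_j h j (tnth x j)).
Proof. by move=> bh; apply: bmeas_prod => j; exact: bmeas_coord. Qed.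

Lemma torus_integral_tensor d (h : 'I_d -> R -> R) :
  (forall j, bmeas (h j : measurableTypeR R -> R)) ->
  \int[mu d]_x \prod_j h j (tnth x j) = \prod_j \int[mc]_z h j z.
Proof.
elim: d h => [|d IH] h bh.
  rewrite big_ord0; under eq_Rintegral do rewrite big_ord0.
  rewrite Rintegral_cst// mul1r.
  transitivity (fine (@dirac _ _ (nil_tuple R : rpoint R 0) R [set: rpoint R 0])) => //.
  by rewrite diracT.
rewrite big_ord_recl -IH//; apply: torus_integral_consM => //.
- exact: bmeas_tensor.
- exact: (@bmeas_tensor d (fun j => h (lift ord0 j)) (fun j => bh _)).
move=> z x; rewrite big_ord_recl/=; congr (h _ _ * _).
by apply: eq_bigr => j _; rewrite /tcons/= tnthS.
Qed.

Lemma torus_measureT d : fine (mu d [set: _]) = (2 * pi) ^+ d.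
Proof.
have := @torus_integral_tensor d (fun=> fun=> 1 : R) (fun=> bmeas_cst _ 1).
under eq_Rintegral do rewrite big1//.
rewrite Rintegral_cst// mul1r => ->.
under eq_bigr do rewrite Rintegral_cst// mul1r circle_measureT.
by rewrite prodr_const card_ord.
Qed.

(** The indicator of the cylinder is a tensor product with one factor of integral zero. *)
Lemma torus_negligible_coord d (j : 'I_d) (N : set R) : measurable N ->
  mc N = 0%E -> mu d [set x | N (tnth x j)] = 0%E.
Proof.
move=> mN N0.
have mI : bmeas (\1_N : measurableTypeR R -> R).
  split; first exact: measurable_indic.
  by exists 1 => x; rewrite indicE; case: (_ \in _); rewrite ?normr1 ?normr0.
pose h (i : 'I_d) : R -> R := if i == j then \1_N else fun=> 1.
have bh i : bmeas (h i : measurableTypeR R -> R).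
  by rewrite /h; case: ifP => _ //; exact: bmeas_cst.
have := torus_integral_tensor bh.
rewrite [RHS](bigD1 j)//= {2}/h eqxx.
have -> : \int[mc]_z \1_N z = 0.
  transitivity (fine (mc N)); last by rewrite N0.
  by rewrite /Rintegral integral_indic// setIT.
rewrite mul0r.
have -> : \int[mu d]_x \prod_i h i (tnth x i) = \int[mu d]_x \1_[set x | N (tnth x j)] x.
  apply: eq_Rintegral => x _; rewrite (bigD1 j)//= big1 ?mulr1; last first.
    by move=> i /negbTE ij; rewrite /h ij.
  by rewrite /h eqxx !indicE.
have mS : measurable [set x : rpoint R d | N (tnth x j)].
  have := @measurable_tnth _ (measurableTypeR R) d j measurableT N mN.
  by rewrite setTI.
rewrite /Rintegral integral_indic// setIT => h0.
apply/eqP; rewrite -[X in X == _]fineK ?fin_num_measure//.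
by rewrite h0.
Qed.

End torus_integral.

(** * Dyadic blocks of the Bessel kernel *)

Section fejer.
Variable R : realType.
Implicit Types (t x y : R) (n k h s : nat).

Definition csum n t : R := \sum_(j < n.+1) cos (j%:R * t).
Definition ssum n t : R := \sum_(j < n.+1) sin (j%:R * t).

(* [n.+1] times the Fejer kernel *)
Definition fejer n t : R := csum n t ^+ 2 + ssum n t ^+ 2.

(** Multiplicity of the pair of frequencies [h] and [- h] merged in a cosine series. *)
Definition cmul h : R := if h is 0%N then 1 else 2.

Definition dirichlet n t : R := \sum_(h < n.+1) cmul h * cos (h%:R * t).

Lemma fejer_ge0 n t : 0 <= fejer n t.
Proof. by rewrite addr_ge0// sqr_ge0. Qed.

Lemma cmul_ge0 h : 0 <= cmul h. Proof. by case: h. Qed.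

Lemma cmul_le2 h : cmul h <= 2. Proof. by case: h => [|h] /=; lra. Qed.

Lemma fejer0 t : fejer 0 t = 1.
Proof.
by rewrite /fejer /csum /ssum !big_ord1 mul0r cos0 sin0 expr1n expr0n addr0.
Qed.

Lemma dirichletS n t : dirichlet n.+1 t = dirichlet n t + 2 * cos (n.+1%:R * t).
Proof. by rewrite /dirichlet big_ord_recr. Qed.

(** Dirichlet kernels are the increments of the Fejer sums; this drives the second summation by
    parts. *)
Lemma fejerS n t : fejer n.+1 t = fejer n t + dirichlet n.+1 t.
Proof.
rewrite /fejer /csum /ssum.
rewrite big_ord_recr [\sum_(j < n.+2) sin _]big_ord_recr/=.
set C := \sum_(j < n.+1) cos _; set S := \sum_(j < n.+1) sin _.
set c := cos (n.+1%:R * t); set s := sin (n.+1%:R * t).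
have cs : c ^+ 2 + s ^+ 2 = 1 := cos2Dsin2 _.
have -> : dirichlet n.+1 t = 1 + 2 * (c * C + s * S).
  rewrite /dirichlet big_ord_recl/= mul0r cos0 mulr1; congr (1 + _).
  rewrite /C /S !mulr_sumr -big_split/= mulr_sumr (reindex_inj rev_ord_inj)/=.
  apply: eq_bigr => j _; congr (_ * _).
  rewrite /c /s -cosB; congr cos; rewrite -mulrBl; congr (_ * _).
  rewrite /bump/= add1n subSS -natrB; last by rewrite ltnW// ltn_ord.
  by congr (_%:R); rewrite subSn// -ltnS ltn_ord.
have -> : (C + c) ^+ 2 + (S + s) ^+ 2 =
  C ^+ 2 + S ^+ 2 + (c ^+ 2 + s ^+ 2 + 2 * (c * C + s * S)) by ring.
by rewrite cs.
Qed.

Lemma fejerE n t : fejer n t = \sum_(h < n.+1) (n.+1 - h)%:R * (cmul h * cos (h%:R * t)).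
Proof.
elim: n => [|n IH].
  by rewrite fejer0 big_ord1 mul0r cos0 !mulr1.
rewrite fejerS IH /dirichlet [X in _ + X]big_ord_recr [RHS]big_ord_recr/= addrA -big_split/=.
rewrite subSnn mul1r; congr (_ + _); apply: eq_bigr => h _.
have -> : (n.+2 - h = (n.+1 - h).+1)%N by rewrite subSn// ltnW.
by rewrite -[(n.+1 - h).+1%:R]natr1 mulrDl mul1r.
Qed.

(** Truncated subtraction makes the coefficients above [n] vanish, so kernels of different degrees
    share one range of frequencies. *)
Lemma fejerE_wide n (B : nat) t : (n < B)%N ->
  fejer n t = \sum_(h < B) (n.+1 - h)%:R * (cmul h * cos (h%:R * t)).
Proof.
move=> nB; rewrite fejerE.
rewrite -(big_mkord xpredT (fun h => (n.+1 - h)%:R * (cmul h * cos (h%:R * t)))).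
rewrite -[RHS](big_mkord xpredT (fun h => (n.+1 - h)%:R * (cmul h * cos (h%:R * t)))).
rewrite [RHS](big_cat_nat _ nB)//= [X in _ = _ + X]big_nat_cond [X in _ = _ + X]big1 ?addr0// => h.
by rewrite andbT => /andP[nh _]; move: nh; rewrite -subn_eq0 => /eqP ->; rewrite mul0r.
Qed.

Lemma fejer_le n t : fejer n t <= 2 * n.+1%:R ^+ 2.
Proof.
have H (f : 'I_n.+1 -> R) : (forall j, `|f j| <= 1) -> (\sum_j f j) ^+ 2 <= n.+1%:R ^+ 2.
  move=> f1; rewrite -real_normK ?num_real// lerXn2r ?nnegrE//.
  apply: (le_trans (ler_norm_sum _ _ _)); apply: (le_trans (ler_sum _ (fun j _ => f1 j))).
  by rewrite sumr_const card_ord.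
rewrite mulr_natl mulr2n; apply: lerD; apply: H => j.
  by rewrite ler_norml cos_geN1 cos_le1.
by rewrite ler_norml sin_geN1 sin_le1.
Qed.

(** The geometric sum of exponentials is multiplied by 1 - exp (i t); [re] and [im] are the two
    parts of the resulting identity, and |1 - exp (i t)|^2 = 2 (1 - cos t). *)
Lemma fejer_off_le n t : cos t != 1 -> fejer n t <= 2 / (1 - cos t).
Proof.
move=> c1; have c1' : 0 < 1 - cos t by rewrite subr_gt0 lt_neqAle c1 cos_le1.
have re : (1 - cos t) * csum n t + sin t * ssum n t = 1 - cos (n.+1%:R * t).
  rewrite /csum /ssum; elim: n => [|n IH].
    by rewrite !big_ord1 mul0r cos0 sin0 mul1r mulr0 addr0 mulr1.
  rewrite [\sum_(j < n.+2) cos _]big_ord_recr [\sum_(j < n.+2) sin _]big_ord_recr/= !mulrDr addrACA IH.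
  by rewrite -[n.+2%:R]natr1 [(n.+1%:R + 1) * t]mulrDl mul1r cosD; ring.
have im : (1 - cos t) * ssum n t - sin t * csum n t = - sin (n.+1%:R * t).
  rewrite /csum /ssum; elim: n {re} => [|n IH].
    by rewrite !big_ord1 mul0r cos0 sin0 mul1r mulr0 mulr1 sub0r.
  rewrite [\sum_(j < n.+2) cos _]big_ord_recr [\sum_(j < n.+2) sin _]big_ord_recr/= !mulrDr opprD addrACA IH.
  by rewrite -[n.+2%:R]natr1 [(n.+1%:R + 1) * t]mulrDl mul1r sinD; ring.
have s1 := cos2Dsin2 t; have s2 := cos2Dsin2 (n.+1%:R * t).
have : (1 - cos t) * fejer n t = 1 - cos (n.+1%:R * t).
  have : ((1 - cos t) ^+ 2 + sin t ^+ 2) * fejer n t =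
      (1 - cos (n.+1%:R * t)) ^+ 2 + (- sin (n.+1%:R * t)) ^+ 2.
    by rewrite -re -im /fejer; ring.
  have -> : (1 - cos t) ^+ 2 + sin t ^+ 2 = 2 * (1 - cos t).
    have -> : (1 - cos t) ^+ 2 + sin t ^+ 2 = 1 - 2 * cos t + (cos t ^+ 2 + sin t ^+ 2) by ring.
    by rewrite s1; ring.
  have -> : (1 - cos (n.+1%:R * t)) ^+ 2 + (- sin (n.+1%:R * t)) ^+ 2 = 2 * (1 - cos (n.+1%:R * t)).
    set c := cos (_ * t) in s2 *; set s := sin (_ * t) in s2 *.
    have -> : (1 - c) ^+ 2 + (- s) ^+ 2 = 1 - 2 * c + (c ^+ 2 + s ^+ 2) by ring.
    by rewrite s2; ring.
  by rewrite -mulrA => /(mulfI _); apply; rewrite pnatr_eq0.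
move=> H; rewrite ler_pdivlMr// mulrC H.
by have := cos_geN1 (n.+1%:R * t); lra.
Qed.

Lemma dirichlet_bound n t : cos t != 1 -> `|dirichlet n.+1 t| <= 2 / (1 - cos t).
Proof.
move=> c1; have -> : dirichlet n.+1 t = fejer n.+1 t - fejer n t.
  by rewrite fejerS addrAC subrr add0r.
have := fejer_off_le n.+1 c1; have := fejer_off_le n c1.
have := fejer_ge0 n.+1 t; have := fejer_ge0 n t.
by rewrite ler_norml => *; lra.
Qed.

End fejer.

(** * Summation by parts and dyadic blocks in one variable *)

Section bessel_kernel.
Variables (R : realType) (r : R).
Hypotheses (r_gt0 : 0 < r) (r_lt1 : r < 1).
Implicit Types (t x y : R) (n k h s : nat).

Definition lam k : R := if k is 0%N then 1 else k%:R `^ (- r).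
Definition dlam k : R := lam k - lam k.+1.
Definition ddlam k : R := dlam k - dlam k.+1.

Lemma lam_gt0 k : 0 < lam k.
Proof. by case: k => [|k] //=; rewrite powR_gt0. Qed.

Lemma lam_le k l : (k <= l)%N -> lam l <= lam k.
Proof.
have lam1 n : lam n.+1 <= 1.
  rewrite /= powRN invf_le1 ?powR_gt0//.
  apply: (@le_trans _ _ (1 `^ r)); first by rewrite powR1.
  by rewrite ge0_ler_powR ?nnegrE ?(ltW r_gt0)// ler1n.
case: k l => [|k] [|l]//; rewrite ltnS => kl /=.
rewrite !powRN lef_pV2 ?posrE ?powR_gt0//.
by rewrite ge0_ler_powR ?nnegrE ?(ltW r_gt0)// ler_nat.
Qed.

Lemma dlam_ge0 k : 0 <= dlam k.
Proof. by rewrite subr_ge0 lam_le. Qed.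

(** Convexity of the sequence k^(-r): write its terms as squares, use the arithmetic-geometric
    inequality and (k + 1) (k + 3) <= (k + 2)^2. It fails at index 0, where [lam] takes the value 1
    twice. *)
Lemma ddlam_ge0 k : 0 <= ddlam k.+1.
Proof.
suff : 2 * lam k.+2 <= lam k.+1 + lam k.+3 by rewrite /ddlam /dlam; lra.
pose u (m : nat) : R := m%:R `^ (- r / 2).
have uE m : lam m.+1 = u m.+1 ^+ 2.
  by rewrite /u -powR_mulrn ?powR_ge0// -powRrM divfK.
have : 2 * (u k.+1 * u k.+3) <= u k.+1 ^+ 2 + u k.+3 ^+ 2.
  by have := sqr_ge0 (u k.+1 - u k.+3); nra.
rewrite -!uE; apply: le_trans.
rewrite ler_wpM2l// uE expr2 /u -!powRM// mulNr !powRN lef_pV2 ?posrE ?powR_gt0//.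
have r20 : 0 <= r / 2 by rewrite divr_ge0// ltW.
apply: ge0_ler_powR; rewrite ?nnegrE ?mulr_ge0//; first exact: ltW.
by rewrite -!natrM ler_nat; nia.
Qed.

Lemma ddlam0_bound : `|ddlam 0| <= 1.
Proof.
have -> : ddlam 0 = lam 2 - 1 by rewrite /ddlam /dlam /= powR1; ring.
have h1 := lam_gt0 2; have h2 : lam 2 <= 1 := lam_le (leq0n 2).
rewrite ler_norml; apply/andP; split; lra.
Qed.

Definition partial_bessel n t : R :=
  1 + 2 * \sum_(1 <= k < n.+1) k%:R `^ (- r) * cos (k%:R * t).

(** The two boundary terms vanish in the limit wherever [cos t] is not 1, by the off-diagonal bounds
    on the Fejer and Dirichlet kernels. *)
Lemma Abel_twice n t : partial_bessel n.+1 t =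
  \sum_(k < n) ddlam k * fejer k t + dlam n * fejer n t + lam n.+1 * dirichlet n.+1 t.
Proof.
elim: n => [|n IH].
  rewrite /partial_bessel big_nat1 big_ord0 add0r fejer0 dirichletS.
  by rewrite /dirichlet big_ord1/= /dlam/= powR1 mul0r cos0; ring.
have -> : partial_bessel n.+2 t = partial_bessel n.+1 t + 2 * (lam n.+2 * cos (n.+2%:R * t)).
  by rewrite /partial_bessel big_nat_recr//= mulrDr addrA.
have -> : \sum_(k < n.+1) ddlam k * fejer k t =
    \sum_(k < n) ddlam k * fejer k t + ddlam n * fejer n t by rewrite big_ord_recr.
rewrite IH fejerS [dirichlet n.+2 t]dirichletS /ddlam /dlam; ring.
Qed.

Definition zsum n t : R := \sum_(k < n) ddlam k * fejer k t.

Lemma sum_ddlam (a b : nat) : (a <= b)%N -> \sum_(a <= k < b) ddlam k = dlam a - dlam b.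
Proof.
move=> ab; rewrite -(subnKC ab); elim: (b - a)%N => [|n IH].
  by rewrite addn0 big_geq// subrr.
by rewrite addnS big_nat_recr ?leq_addr//= IH /ddlam; ring.
Qed.

Lemma zsum_cvg t : cos t != 1 -> exists l : R, zsum n t @[n --> \oo] --> l.
Proof.
move=> c1; set M := 2 / (1 - cos t).
have M0 : 0 <= M by apply: (le_trans (fejer_ge0 0 t)); exact: fejer_off_le.
(* The shift sets apart the term with [ddlam 0], the only one that may be negative; the rest is a
   nondecreasing sequence, bounded since [ddlam] telescopes. *)
suff : cvgn (fun n => zsum n.+1 t).
  move=> H; exists (limn (fun n => zsum n.+1 t)).
  by rewrite -(cvg_shiftS (fun n => zsum n t)).
apply: nondecreasing_is_cvgn.
  apply/nondecreasing_seqP => n; rewrite /zsum [leRHS]big_ord_recr/= lerDl.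
  by rewrite mulr_ge0 ?fejer_ge0//; exact: ddlam_ge0.
exists (ddlam 0 * fejer 0 t + dlam 1 * M) => _ [n _ <-].
rewrite /zsum big_ord_recl/= lerD2l.
apply: (@le_trans _ _ (\sum_(i < n) ddlam i.+1 * M)).
  apply: ler_sum => i _; rewrite ler_wpM2l ?ddlam_ge0//; exact: fejer_off_le.
rewrite -mulr_suml ler_wpM2r//.
have -> : \sum_(i < n) ddlam i.+1 = \sum_(1 <= k < n.+1) ddlam k.
  by rewrite big_add1/= big_mkord.
rewrite sum_ddlam//.
by rewrite gerBl dlam_ge0.
Qed.

Lemma lam_cvg0 : lam n @[n --> \oo] --> (0 : R).
Proof.
rewrite -(cvg_shiftS lam).
apply/cvgrPdist_lt => e e0.
near=> n; rewrite sub0r normrN ger0_norm ?ltW ?lam_gt0//= powRN.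
rewrite invf_plt ?posrE ?powR_gt0//.
have -> : e^-1 = (e^-1 `^ r^-1) `^ r.
  by rewrite -powRrM mulVf ?powRr1 ?invr_ge0 ?ltW// gt_eqF.
rewrite gt0_ltr_powR ?nnegrE ?powR_ge0//.
apply: (@lt_le_trans _ _ n%:R); last by rewrite ler_nat.
near: n; exact: nbhs_infty_gtr.
Unshelve. all: by end_near.
Qed.

(** Identifies the series of Fejer kernels with the conditionally convergent cosine series that
    defines [Fr1]. *)
Lemma Fr1_cvg t : cos t != 1 -> zsum n t @[n --> \oo] --> Fr1 r t.
Proof.
move=> c1; have [l zl] := zsum_cvg c1; set M := 2 / (1 - cos t).
suff : partial_bessel n t @[n --> \oo] --> l.
  move=> pl; suff -> : Fr1 r t = l by [].
  have : (partial_bessel n t - 1) / 2 @[n --> \oo] --> (l - 1) / 2.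
    by apply: cvgMl; apply: cvgB => //; exact: cvg_cst.
  have -> : (fun n => (partial_bessel n t - 1) / 2) =
      (fun n => \sum_(1 <= k < n.+1) k%:R `^ (- r) * cos (k%:R * t)).
    by apply/funext => n; rewrite /partial_bessel; field.
  by move=> /cvg_lim; rewrite /Fr1 => ->//; field.
rewrite -(cvg_shiftS (fun n => partial_bessel n t)).
have -> : (fun n => partial_bessel n.+1 t) =
    (fun n => zsum n t + (dlam n * fejer n t + lam n.+1 * dirichlet n.+1 t)).
  by apply/funext => n; rewrite Abel_twice addrA.
rewrite -[l]addr0; apply: cvgD => //.
have H : 2 * M * lam n @[n --> \oo] --> (0 : R).
  by rewrite -[X in _ --> X](mulr0 (2 * M)); apply: cvgMr; exact: lam_cvg0.
apply: (@squeeze_cvgr _ _ _ _ (fun n => - (2 * M * lam n)) (fun n => 2 * M * lam n)) => //.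
  near=> n; rewrite -ler_norml; apply: (le_trans (ler_normD _ _)).
  rewrite !normrM (ger0_norm (dlam_ge0 n)) (ger0_norm (ltW (lam_gt0 _))).
  rewrite (ger0_norm (fejer_ge0 _ _)).
  have h1 := fejer_off_le n c1; have h2 := dirichlet_bound n c1.
  have h3 := lam_gt0 n.+1; have h4 := lam_le (leqnSn n); have h5 := dlam_ge0 n.
  have h6 : dlam n <= lam n by rewrite /dlam gerBl ltW.
  have M0 : 0 <= M by apply: le_trans h1; exact: fejer_ge0.
  rewrite -/M in h1 h2.
  have k1 : dlam n * fejer n t <= lam n * M by rewrite ler_pM ?fejer_ge0.
  have k2 : lam n.+1 * `|dirichlet n.+1 t| <= lam n * M by rewrite ler_pM ?(ltW h3).
  by lra.
by rewrite -oppr0; exact: cvgN.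
Unshelve. all: by end_near.
Qed.

(* Block [s] starts at [2 ^ s - 1], so that block [0] is the constant term. *)
Definition kernel1 s t : R := \sum_((2 ^ s).-1 <= k < (2 ^ s.+1).-1) ddlam k * fejer k t.

(** The single size of a block: it bounds the [L_1] norm up to 2 pi, the sup norm up to 4 * 2^s, and
    every Fourier coefficient [kcoef]. *)
Definition omega s : R := \sum_((2 ^ s).-1 <= k < (2 ^ s.+1).-1) `|ddlam k| * k.+1%:R.

Lemma pow2_pred_le s : ((2 ^ s).-1 <= (2 ^ s.+1).-1)%N.
Proof. by rewrite -!subn1 leq_sub2r// leq_exp2l. Qed.

Lemma sum_kernel1 n t : \sum_(s < n) kernel1 s t = zsum (2 ^ n).-1 t.
Proof.
elim: n => [|n IH]; first by rewrite big_ord0 /zsum big_ord0.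
rewrite big_ord_recr/= IH /zsum /kernel1.
rewrite -(big_mkord xpredT (fun k => ddlam k * fejer k t)).
by rewrite -[RHS](big_mkord xpredT (fun k => ddlam k * fejer k t)) -big_cat_nat// pow2_pred_le.
Qed.

Lemma sum_kernel1_cvg t : cos t != 1 ->
  \sum_(s < n) kernel1 s t @[n --> \oo] --> Fr1 r t.
Proof.
move=> c1; under eq_fun do rewrite sum_kernel1.
apply: (cvg_comp _ (fun n => zsum n t) _ (Fr1_cvg c1)).
move=> A [N _ NA]; exists N.+1 => // n /= Nn; apply: NA => /=.
rewrite -ltnS prednK ?expn_gt0//.
exact: (leq_trans Nn (ltnW (ltn_expl _ _))).
Qed.

Lemma lam_pow2 s : lam (2 ^ s) = (2 `^ (- r)) ^+ s.
Proof.
have : (0 < 2 ^ s)%N by rewrite expn_gt0.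
rewrite /lam; case E : (2 ^ s)%N => [|n]// _; rewrite -E natrX.
rewrite -[in LHS]powR_mulrn// -powRrM -[in RHS]powR_mulrn ?powR_ge0//.
by rewrite -powRrM mulrC.
Qed.

(** Beyond the first block all [ddlam] are nonnegative, so the weighted sum is computed by parts and
    is at most A [dlam] A + [lam] A, with A = 2^(s + 1) - 1 the first index of block s + 1. *)
Lemma omega_le s : omega s <= 4 * (2 `^ (- r)) ^+ s.
Proof.
case: s => [|s].
  rewrite /omega expn0 expn1/= big_nat1 expr0 mulr1 mulr1.
  by have := ddlam0_bound; lra.
set A := (2 ^ s.+1).-1; set B := (2 ^ s.+2).-1.
have A1 : (0 < A)%N by rewrite /A -subn1 subn_gt0 -{1}(expn0 2) ltn_exp2l.
have AB : (A <= B)%N := pow2_pred_le _.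
have E : omega s.+1 = A%:R * dlam A + lam A - lam B - B%:R * dlam B.
  rewrite /omega -/A -/B -(subnKC AB); elim: (B - A)%N => [|n IH].
    by rewrite addn0 big_geq//; ring.
  rewrite addnS big_nat_recr ?leq_addr// IH.
  rewrite ger0_norm; last by rewrite -(prednK A1) addSn ddlam_ge0.
  by rewrite -[LHS]/(_ + _) /ddlam -natr1 /dlam; ring.
have {}E : omega s.+1 <= A%:R * dlam A + lam A.
  by rewrite E; have := lam_gt0 B; have := dlam_ge0 B; have : 0 <= B%:R :> R by []; nra.
have AR : 1 <= A%:R :> R by rewrite ler1n.
(* The products k [lam] k = k^(1 - r) increase with k, as r < 1. *)
have dA : A%:R * dlam A <= lam A.
  have lamE m : (0 < m)%N -> m%:R * lam m = m%:R `^ (1 - r) :> R.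
    by case: m => // m _; rewrite powRB ?pnatr_eq0 ?implybT// powRr1// /lam powRN.
  have h1 : A%:R * lam A <= A.+1%:R * lam A.+1.
    by rewrite !lamE// ge0_ler_powR ?nnegrE ?ler_nat// subr_ge0 ltW.
  rewrite /dlam mulrBr; have := lam_gt0 A.+1; have := lam_gt0 A.
  move: h1; rewrite -natr1; set x := lam A.+1; set y := lam A; set z : R := A%:R in AR *.
  by move=> *; nra.
apply: (le_trans E); apply: (@le_trans _ _ (2 * lam A)); first lra.
apply: (@le_trans _ _ (2 * lam (2 ^ s))).
  rewrite ler_wpM2l// lam_le// /A -ltnS prednK ?expn_gt0//.
  by rewrite ltn_exp2l.
rewrite lam_pow2 exprS mulrA.
have h2 : 1 <= 2 * 2 `^ (- r).
  rewrite powRN ler_pdivlMr ?powR_gt0// mul1r.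
  rewrite -[leRHS](powRr1 (_ : 0 <= 2))// ler_powR// ?ltW//; lra.
have h3 : 0 <= (2 `^ (- r)) ^+ s by rewrite exprn_ge0// powR_ge0.
have -> : 4 * 2 `^ (- r) * (2 `^ (- r)) ^+ s = (2 * 2 `^ (- r)) * (2 * (2 `^ (- r)) ^+ s) by ring.
by rewrite ler_peMl// mulr_ge0.
Qed.

Lemma kernel1_le_fejer s t : `|kernel1 s t| <=
  \sum_((2 ^ s).-1 <= k < (2 ^ s.+1).-1) `|ddlam k| * fejer k t.
Proof.
apply: (le_trans (ler_norm_sum _ _ _)); apply: ler_sum => k _.
by rewrite normrM (ger0_norm (fejer_ge0 _ _)).
Qed.

Lemma kernel1_sup s t : `|kernel1 s t| <= 2 * omega s * 2 ^+ s.+1.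
Proof.
apply: (le_trans (kernel1_le_fejer _ _)).
rewrite /omega mulr_sumr mulr_suml !big_nat; apply: ler_sum => k /andP[_ k2].
rewrite mulrCA -[leRHS]mulrA ler_wpM2l//.
apply: (le_trans (fejer_le _ _)); rewrite expr2 mulrA ler_wpM2l ?mulr_ge0//.
rewrite -natrX ler_nat (leq_trans k2)// leq_pred//.
Qed.

Definition kcoef s h : R := \sum_((2 ^ s).-1 <= k < (2 ^ s.+1).-1) ddlam k * (k.+1 - h)%:R.

Lemma kcoef_le s h : `|kcoef s h| <= omega s.
Proof.
apply: (le_trans (ler_norm_sum _ _ _)); apply: ler_sum => k _.
by rewrite normrM ler_wpM2l// ger0_norm// ler_nat leq_subr.
Qed.

Lemma kcoef_eq0 s h : (2 ^ s.+1 <= h)%N -> kcoef s h = 0.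
Proof.
move=> sh; rewrite /kcoef big_nat big1// => k /andP[_ k2].
have /eqP -> : (k.+1 - h == 0)%N.
  by rewrite subn_eq0 (leq_trans k2)// (leq_trans (leq_pred _)).
by rewrite mulr0.
Qed.

Lemma kernel1E s (B : nat) t : (2 ^ s.+1 <= B)%N ->
  kernel1 s t = \sum_(h < B) kcoef s h * (cmul R h * cos (h%:R * t)).
Proof.
move=> sB; rewrite /kernel1 /kcoef.
under [RHS]eq_bigr do rewrite mulr_suml.
rewrite exchange_big/= !big_nat; apply: eq_bigr => k /andP[_ k2].
rewrite (@fejerE_wide _ _ B) ?mulr_sumr; last first.
  by apply: leq_trans sB; apply: (leq_trans k2); rewrite leq_pred.
by apply: eq_bigr => h _; rewrite mulrA.
Qed.

End bessel_kernel.

(** * Tensor products of the blocks *)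

Section levels.
Variable R : realType.

Definition level (d L : nat) (s : {ffun 'I_d -> 'I_L}) : nat := \sum_j s j.

(** All coordinates but the first, each at most [l], determine an element of level [l]. *)
Lemma card_level (d L l : nat) :
  (#|[set s : {ffun 'I_d.+1 -> 'I_L} | level s == l]%SET| <= l.+1 ^ d)%N.
Proof.
pose f (s : {ffun 'I_d.+1 -> 'I_L}) : {ffun 'I_d -> 'I_l.+1} :=
  [ffun j => inord (s (lift ord0 j))].
rewrite -(@card_in_imset _ _ f); last first.
  move=> s s'; rewrite !inE /level => /eqP sl /eqP s'l ff.
  have les (t : {ffun 'I_d.+1 -> 'I_L}) (j : 'I_d) : (\sum_j t j = l -> t (lift ord0 j) < l.+1)%N.
    by move=> <-; rewrite ltnS (bigD1 (lift ord0 j))//= leq_addr.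
  have e1 (j : 'I_d) : s (lift ord0 j) = s' (lift ord0 j) :> nat.
    move/ffunP/(_ j): ff; rewrite !ffunE => /(congr1 val)/=.
    by rewrite !inordK ?les.
  apply/ffunP => j; apply: val_inj => /=.
  have [k ->|->] := unliftP ord0 j; first exact: e1.
  move: sl; rewrite -s'l big_ord_recl [RHS]big_ord_recl.
  under eq_bigr do rewrite e1.
  exact: addIn.
apply: (leq_trans (max_card _)).
by rewrite card_ffun !card_ord.
Qed.

Lemma sum_level_le (d L m n : nat) (P : pred {ffun 'I_d.+1 -> 'I_L}) (F : nat -> R) :
  (forall l, 0 <= F l) -> (forall s, P s -> (m <= level s < n)%N) ->
  \sum_(s | P s) F (level s) <= \sum_(m <= l < n) l.+1%:R ^+ d * F l.
Proof.
move=> F0 Pn; rewrite big_geq_mkord; case: n Pn => [|n] Pn.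
  rewrite big_pred0 => [|s].
    by apply: sumr_ge0 => i _; rewrite mulr_ge0// exprn_ge0.
  by apply/negP => /Pn; rewrite ltn0 andbF.
rewrite (partition_big (fun s => inord (level s) : 'I_n.+1) (fun i => m <= i)%N); last first.
  by move=> s /Pn /andP[ms sn]; rewrite inordK.
apply: ler_sum => i mi.
rewrite (eq_bigr (fun=> F i)); last first.
  by move=> s /andP[/Pn /andP[_ sn] /eqP <-]; rewrite inordK.
rewrite -[leLHS]/(\sum_(s in [pred s | P s && (inord (level s) == i)]) F i).
rewrite sumr_const -[leLHS]mulr_natl ler_wpM2r//.
rewrite -natrX ler_nat; apply: leq_trans (card_level d L i).
apply: subset_leq_card; apply/fintype.subsetP => s; rewrite !inE => /andP[/Pn/andP[_ sn] /eqP <-].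
by rewrite inordK.
Qed.

Lemma geometric_le (x : R) n : 0 <= x < 1 -> \sum_(i < n) x ^+ i <= (1 - x)^-1.
Proof.
move=> /andP[x0 x1]; rewrite -[leRHS]mul1r ler_pdivlMr ?subr_gt0//.
have -> : (\sum_(i < n) x ^+ i) * (1 - x) = 1 - x ^+ n.
  by rewrite -[1 - x]opprB mulrN mulrC -subrX1 opprB.
by rewrite gerBl exprn_ge0.
Qed.

(** Induction on [d] with the square root of [x]: half of the decay absorbs one factor [i.+1], and
    the other half goes to the induction hypothesis. *)
Lemma poly_exp_bounded (d : nat) (x : R) : 0 <= x < 1 ->
  exists2 C : R, 0 <= C & forall i, i.+1%:R ^+ d * x ^+ i <= C.
Proof.
elim: d x => [|d IH] x /andP[x0 x1].
  by exists 1 => // i; rewrite expr0 mul1r exprn_ile1// ltW.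
pose y := Num.sqrt x.
have y0 : 0 <= y := sqrtr_ge0 _.
have yy : y ^+ 2 = x := sqr_sqrtr x0.
have y1 : y < 1 by rewrite -(@ltr_pXn2r _ 2)// ?nnegrE// yy expr1n.
have [C C0 CP] := IH y (introT andP (conj y0 y1)).
exists (C * (1 - y)^-1) => [|i]; first by rewrite mulr_ge0// invr_ge0 subr_ge0 ltW.
have -> : i.+1%:R ^+ d.+1 * x ^+ i = (i.+1%:R ^+ d * y ^+ i) * (i.+1%:R * y ^+ i).
  by rewrite exprS -yy -exprM mul2n -addnn exprD; ring.
apply: ler_pM => //; rewrite ?mulr_ge0 ?exprn_ge0//.
apply: le_trans (geometric_le i.+1 (introT andP (conj y0 y1))).
rewrite mulr_natl -[X in _ *+ X](card_ord i.+1) -sumr_const; apply: ler_sum => k _.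
by rewrite ler_wiXn2l// ?ltW// -ltnS.
Qed.

Lemma poly_geometric_bounded (d : nat) (x : R) : 0 <= x < 1 ->
  exists2 C : R, 0 <= C & forall n, \sum_(i < n) i.+1%:R ^+ d * x ^+ i <= C.
Proof.
move=> /andP[x0 x1]; pose y := Num.sqrt x.
have y0 : 0 <= y := sqrtr_ge0 _.
have yy : y ^+ 2 = x := sqr_sqrtr x0.
have y1 : y < 1 by rewrite -(@ltr_pXn2r _ 2)// ?nnegrE// yy expr1n.
have y01 : 0 <= y < 1 by rewrite y0.
have [C C0 CP] := poly_exp_bounded d y01.
exists (C * (1 - y)^-1) => [|n]; first by rewrite mulr_ge0// invr_ge0 subr_ge0 ltW.
apply: (@le_trans _ _ (C * \sum_(i < n) y ^+ i)).
  rewrite mulr_sumr; apply: ler_sum => i _.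
  by rewrite -yy -exprM mul2n -addnn exprD mulrA ler_wpM2r// exprn_ge0.
by rewrite ler_wpM2l// geometric_le.
Qed.

(** Levels are counted from [n] and n + i + 1 <= (n + 1) (i + 1) is used: the power of [n.+1] comes
    out, and what remains is a convergent series that ignores the cap [L]. *)
Lemma sum_high_levels (d : nat) (x : R) : 0 <= x < 1 ->
  exists2 C : R, 0 <= C &
  forall (L n : nat) (P : pred {ffun 'I_d.+1 -> 'I_L}),
    (forall s, P s -> (n < level s)%N) ->
    \sum_(s | P s) x ^+ level s <= C * x ^+ n * n.+1%:R ^+ d.
Proof.
move=> /[dup] x01 /andP[x0 x1]; have [C C0 CP] := poly_geometric_bounded d x01.
exists C => // L n P Pn.
pose N := (\max_(s | P s) level s).+1.
have PN s : P s -> (n <= level s < N)%N.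
  by move=> Ps; rewrite (ltnW (Pn _ Ps)) ltnS /N /=; exact: (leq_bigmax_cond _ Ps).
apply: (le_trans (sum_level_le (F := fun l => x ^+ l) _ PN)).
  by move=> l; rewrite exprn_ge0.
have [Nn|nN] := leqP N n.
  by rewrite big_geq// !mulr_ge0 ?exprn_ge0.
rewrite -{1}[n]add0n big_addn big_mkord.
apply: (@le_trans _ _ (\sum_(i < N - n) (x ^+ n * n.+1%:R ^+ d) * (i.+1%:R ^+ d * x ^+ i))).
  apply: ler_sum => i _; rewrite exprD.
  have -> : x ^+ n * n.+1%:R ^+ d * (i.+1%:R ^+ d * x ^+ i) =
    (n.+1%:R ^+ d * i.+1%:R ^+ d) * (x ^+ i * x ^+ n) by ring.
  rewrite ler_wpM2r ?mulr_ge0 ?exprn_ge0//.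
  rewrite -exprMn lerXn2r ?nnegrE// -natrM ler_nat; nia.
rewrite -mulr_sumr -[leRHS]mulrA [leRHS]mulrC ler_wpM2l//.
by rewrite mulr_ge0 ?exprn_ge0.
Qed.

(** Read from the top level downwards, the sum is dominated by a geometric series of ratio
    [w^-1]. *)
Lemma sum_low_levels (d : nat) (w : R) : 1 < w ->
  exists2 C : R, 0 <= C &
  forall (L n : nat) (P : pred {ffun 'I_d.+1 -> 'I_L}),
    (forall s, P s -> (level s <= n)%N) ->
    \sum_(s | P s) w ^+ level s <= C * w ^+ n * n.+1%:R ^+ d.
Proof.
move=> w1; have w0 : 0 < w := lt_trans ltr01 w1.
have wi : 0 <= w^-1 < 1 by rewrite invr_ge0 ltW//= invf_lt1.
exists (1 - w^-1)^-1 => [|L n P Pn].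
  by rewrite invr_ge0 subr_ge0 ltW//; case/andP: wi.
apply: (le_trans (sum_level_le (m := 0) (n := n.+1) (F := fun l => w ^+ l) _ _)).
- by move=> l; rewrite exprn_ge0// ltW.
- by move=> s /Pn.
rewrite big_mkord; apply: (@le_trans _ _ (\sum_(i < n.+1) n.+1%:R ^+ d * w ^+ i)).
  apply: ler_sum => i _; rewrite ler_wpM2r ?exprn_ge0 ?(ltW w0)//.
  by rewrite lerXn2r ?nnegrE// ler_nat.
rewrite -mulr_sumr mulrC ler_wpM2r ?exprn_ge0//.
rewrite (reindex_inj rev_ord_inj)/=.
apply: (@le_trans _ _ (\sum_(i < n.+1) w ^+ n * w^-1 ^+ i)).
  apply: ler_sum => i _; rewrite subSS exprVn.
  by rewrite exprB ?unitfE ?gt_eqF// -ltnS.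
by rewrite -mulr_sumr mulrC ler_wpM2r ?exprn_ge0 ?(ltW w0)// geometric_le.
Qed.

(** With truncated subtraction the exponent is the distance between [s] and [k]; each side
    contributes a geometric series. *)
Lemma sum_dist_le (v : R) (L s : nat) : 0 <= v < 1 ->
  \sum_(k < L) v ^+ ((s - k) + (k - s)) <= 2 / (1 - v).
Proof.
move=> /[dup] v01 /andP[v0 v1].
have h n : \sum_(i < n) v ^+ i <= (1 - v)^-1 := geometric_le n v01.
have -> : 2 / (1 - v) = (1 - v)^-1 + (1 - v)^-1 by rewrite mulr_natl mulr2n.
rewrite -(big_mkord xpredT (fun k => v ^+ ((s - k) + (k - s)))).
have pos k : 0 <= v ^+ k by rewrite exprn_ge0.
apply: (@le_trans _ _ (\sum_(0 <= k < s + L) v ^+ ((s - k) + (k - s)))).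
  by rewrite (big_cat_nat (leq0n _) (leq_addl s L))/= lerDl sumr_ge0.
rewrite (big_cat_nat (leq0n _) (leq_addr L s))/= lerD//.
  rewrite big_mkord (reindex_inj rev_ord_inj)/=.
  apply: le_trans (h s.+1); rewrite [leRHS]big_ord_recl/= ler_wpDl//.
  apply: ler_sum => i _; rewrite /bump/= add1n.
  have -> : (s - (s - i.+1) + (s - i.+1 - s) = i.+1)%N by have := ltn_ord i; lia.
  by [].
rewrite -{1}[s]add0n big_addn addKn big_mkord.
apply: le_trans (h L); apply: ler_sum => i _.
by have -> : (s - (i + s) + (i + s - s) = i)%N by lia.
Qed.

End levels.

(** * The real trigonometric basis of the torus *)

Section basis.
Variable R : realType.
Local Notation mc := (circle_measure R).
Local Notation mu := (torus_measure R).
Implicit Types (h k : nat) (b : bool).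

(** The factor gives every function the same squared norm 2 pi, except the sine of frequency zero,
    which vanishes. It also makes the addition formula [ubas_sum] reproduce the cosine series with
    multiplicities. *)
Definition ubas h b (x : R) : R :=
  Num.sqrt (cmul R h) * (if b then sin (h%:R * x) else cos (h%:R * x)).

Lemma sqrt_cmul_le h : Num.sqrt (cmul R h) <= 2.
Proof.
rewrite -(@ler_pXn2r _ 2)// ?nnegrE ?sqrtr_ge0// sqr_sqrtr ?cmul_ge0//.
by have := cmul_le2 R h; lra.
Qed.

Lemma ubas_le h b x : `|ubas h b x| <= 2.
Proof.
rewrite normrM ger0_norm ?sqrtr_ge0// -[leRHS]mulr1 ler_pM ?sqrtr_ge0 ?sqrt_cmul_le//.
by case: b; rewrite ler_norml ?sin_geN1 ?sin_le1 ?cos_geN1 ?cos_le1.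
Qed.

Lemma sin_cosE (x : R) : sin x = cos (- (pi / 2) + x).
Proof. by rewrite addrC cosB cos_pihalf sin_pihalf mulr0 mulr1 add0r. Qed.

Lemma bmeas_ubas h b : bmeas (ubas h b : measurableTypeR R -> R).
Proof.
apply: bmeas_mul; first exact: bmeas_cst.
have H c : bmeas (fun x : measurableTypeR R => cos (c + h%:R * x)).
  by under eq_fun do rewrite mulrC; exact: bmeas_cos_affine.
case: b; first by under eq_fun do rewrite sin_cosE; exact: H.
by have := H 0; under eq_fun do rewrite add0r.
Qed.

Lemma circle_integral_cos_affine (m n : nat) (c : R) :
  \int[mc]_x cos (c + x * (m%:R - n%:R)) = (m == n)%:R * (2 * pi * cos c).
Proof.
have [->|mn] := eqVneq m n; last by rewrite mul0r circle_integral_cos.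
under eq_Rintegral do rewrite subrr mulr0 addr0.
by rewrite Rintegral_cst// circle_measureT mul1r mulrC.
Qed.

Definition ubas_norm h b : R := if b && (h == 0%N) then 0 else 2 * pi.

Lemma ubas_norm_ge0 h b : 0 <= ubas_norm h b.
Proof. by rewrite /ubas_norm; case: ifP => // _; rewrite mulr_ge0// pi_ge0. Qed.

Lemma ubas_norm_le h b : ubas_norm h b <= 2 * pi.
Proof. by rewrite /ubas_norm; case: ifP => // _; rewrite mulr_ge0// pi_ge0. Qed.

Lemma ubas_phase h b (x : R) :
  ubas h b x = Num.sqrt (cmul R h) * cos ((if b then - (pi / 2) else 0) + h%:R * x).
Proof. by case: b; rewrite /ubas ?sin_cosE ?add0r. Qed.

(** Sines are cosines with phase - pi / 2, so that one product-to-sum formula covers all four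
    cases. *)
Lemma ubas_orth h b k b' :
  \int[mc]_z (ubas h b z * ubas k b' z) = ((h == k) && (b == b'))%:R * ubas_norm h b.
Proof.
pose s := Num.sqrt (cmul R h) * Num.sqrt (cmul R k).
pose c b : R := if b then - (pi / 2) else 0.
have H z : ubas h b z * ubas k b' z =
    s / 2 * (cos ((c b - c b') + z * (h%:R - k%:R)) +
             cos ((c b + c b') + z * ((h + k)%:R - 0%:R))).
  rewrite !ubas_phase -/(c b) -/(c b').
  have -> : c b - c b' + z * (h%:R - k%:R) = (c b + h%:R * z) - (c b' + k%:R * z) by ring.
  have -> : c b + c b' + z * ((h + k)%:R - 0%:R) = (c b + h%:R * z) + (c b' + k%:R * z).
    by rewrite natrD; ring.
  move: (c b + _) (c b' + _) => A B; by rewrite cosB cosD /s; field.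
have ib (e : R) (m n : nat) : Rint mc (fun z : R => cos (e + z * (m%:R - n%:R))).
  by apply: bmeas_Rint; exact: bmeas_cos_affine.
under eq_Rintegral do rewrite H.
rewrite RintegralZl//; last by apply: Rint_add; exact: ib.
rewrite RintegralD//; [|exact: ib|exact: ib].
rewrite !circle_integral_cos_affine.
have hk0 : ((h + k)%N == 0%N) = (h == k) && (h == 0%N).
  by rewrite addn_eq0; case: (h) (k) => [|h'] [|k'] //=; rewrite andbF.
have sE : h = k -> s = cmul R h.
  by move=> hk; rewrite /s -hk -expr2 sqr_sqrtr ?cmul_ge0.
rewrite hk0; have [hk|hk] := eqVneq h k; last by rewrite /= !mul0r addr0 mulr0.
rewrite sE// /ubas_norm /c; clear; case: b b' => [] [] /=.
- by rewrite subrr cos0 -opprD -splitr cosN cospi; case: (h) => [|h'] /=; field.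
- by rewrite subr0 addr0 cosN cos_pihalf !mulr0 addr0 !mulr0 mul0r.
- by rewrite !add0r opprK cosN cos_pihalf !mulr0 addr0 !mulr0 mul0r.
- by rewrite subr0 addr0 cos0; case: (h) => [|h'] /=; field.
Qed.

Lemma ubas_sum h (x y : R) :
  \sum_(b : bool) ubas h b x * ubas h b y = cmul R h * cos (h%:R * (x - y)).
Proof.
rewrite big_bool/= /ubas mulrBr cosB.
have := sqr_sqrtr (cmul_ge0 R h); set q := Num.sqrt _ => <-; ring.
Qed.

Lemma sin_cos_lipschitz (x y : R) : `|sin x - sin y| <= `|x - y| /\ `|cos x - cos y| <= `|x - y|.
Proof.
wlog yx : x y / y <= x.
  move=> H; have [/H//|/ltW/H] := leP y x.
  by rewrite (distrC (sin y)) (distrC (cos y)) (distrC y).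
have lip (f g : R -> R) : (forall z, is_derive z (1 : R) f (g z)) -> (forall z, `|g z| <= 1) ->
    `|f x - f y| <= `|x - y|.
  move=> df g1; have fc : continuous f.
    by move=> z; apply/differentiable_continuous/derivable1_diffP; have [] := df z.
  have [c _ ->] := MVT_segment yx (fun z _ => df z) (continuous_subspaceT fc).
  by rewrite normrM ler_piMl.
split.
  by apply: (lip _ cos) => z; rewrite ler_norml cos_geN1 cos_le1.
by apply: (lip _ (fun z => - sin z)) => z; rewrite normrN ler_norml sin_geN1 sin_le1.
Qed.

Lemma ubas_lipschitz h b (x y : R) : `|ubas h b x - ubas h b y| <= 2 * h%:R * `|x - y|.
Proof.
rewrite /ubas -mulrBr normrM ger0_norm ?sqrtr_ge0// -mulrA.
apply: ler_pM; rewrite ?sqrtr_ge0 ?sqrt_cmul_le//.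
have -> : h%:R * `|x - y| = `|h%:R * x - h%:R * y| by rewrite -mulrBr normrM ger0_norm.
by have [] := sin_cos_lipschitz (h%:R * x) (h%:R * y); case: b.
Qed.

Definition ebas d B (al : {ffun 'I_d -> 'I_B * bool}) (x : rpoint R d) : R :=
  \prod_j ubas (al j).1 (al j).2 (tnth x j).

Lemma bmeas_ebas d B (al : {ffun 'I_d -> 'I_B * bool}) : bmeas (ebas al).
Proof. by apply: (@bmeas_tensor R d (fun j => ubas (al j).1 (al j).2)) => j; exact: bmeas_ubas. Qed.

Lemma prod_norm_le (I : finType) (f : I -> R) (M : R) : (forall i, `|f i| <= M) ->
  `|\prod_i f i| <= M ^+ #|I|.
Proof.
move=> fM; rewrite normr_prod -prodr_const.
by apply: ler_prod => i _; rewrite normr_ge0 fM.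
Qed.

Lemma ebas_le d B (al : {ffun 'I_d -> 'I_B * bool}) x : `|ebas al x| <= 2 ^+ d.
Proof.
have := @prod_norm_le _ _ 2 (fun j : 'I_d => ubas_le (al j).1 (al j).2 (tnth x j)).
by rewrite card_ord.
Qed.

Lemma prod_lipschitz (d : nat) (f g : 'I_d -> R) (D : R) :
  (forall i, `|f i| <= 2) -> (forall i, `|g i| <= 2) -> (forall i, `|f i - g i| <= D) ->
  `|\prod_i f i - \prod_i g i| <= d%:R * 2 ^+ d * D.
Proof.
elim: d f g => [|d IH] f g f2 g2 fg; first by rewrite !big_ord0 subrr normr0 !mul0r.
rewrite !big_ord_recl; set F := \prod_(i < d) _; set G := \prod_(i < d) _.
have -> : f ord0 * F - g ord0 * G = f ord0 * (F - G) + (f ord0 - g ord0) * G by ring.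
apply: (le_trans (ler_normD _ _)); rewrite !normrM.
have IH' : `|F - G| <= d%:R * 2 ^+ d * D by exact: IH.
have G2 : `|G| <= 2 ^+ d by have := @prod_norm_le 'I_d _ 2 (fun j => g2 (lift ord0 j)); rewrite card_ord.
have D0 : 0 <= D := le_trans (normr_ge0 _) (fg ord0).
have h1 : `|f ord0| * `|F - G| <= 2 * (d%:R * 2 ^+ d * D) by rewrite ler_pM.
have h2 : `|f ord0 - g ord0| * `|G| <= D * 2 ^+ d by rewrite ler_pM.
apply: (le_trans (lerD h1 h2)).
have : 0 <= D * 2 ^+ d by rewrite mulr_ge0// exprn_ge0.
rewrite -natr1 exprS; set p := 2 ^+ d; nra.
Qed.

Lemma ebas_lipschitz d B (al : {ffun 'I_d -> 'I_B * bool}) x y (dl : R) :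
  (forall j, `|tnth x j - tnth y j| <= dl) ->
  `|ebas al x - ebas al y| <= d%:R * 2 ^+ d * (2 * B%:R * dl).
Proof.
move=> xy; apply: prod_lipschitz => j; rewrite ?ubas_le//.
apply: (le_trans (ubas_lipschitz _ _ _ _)); apply: ler_pM => //; rewrite ?mulr_ge0//.
by rewrite ler_wpM2l// ler_nat ltnW.
Qed.

Lemma ebas_orth d B (al be : {ffun 'I_d -> 'I_B * bool}) :
  \int[mu d]_x (ebas al x * ebas be x) =
  (al == be)%:R * \prod_j ubas_norm (al j).1 (al j).2.
Proof.
transitivity (\int[mu d]_x \prod_j
    (ubas (al j).1 (al j).2 (tnth x j) * ubas (be j).1 (be j).2 (tnth x j))).
  by apply: eq_Rintegral => x _; rewrite -big_split.
rewrite (@torus_integral_tensor R d (fun j z => ubas (al j).1 (al j).2 z * ubas (be j).1 (be j).2 z)); last first.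
  by move=> j; apply: bmeas_mul; exact: bmeas_ubas.
under eq_bigr do rewrite ubas_orth.
have [->|ab] := eqVneq al be.
  by rewrite mul1r; apply: eq_bigr => j _; rewrite !eqxx mul1r.
have [j jP] : exists j, al j != be j.
  apply/existsP; rewrite -negb_forall; apply: contra ab => /forallP H.
  by apply/eqP/ffunP => j; apply/eqP.
rewrite mul0r (bigD1 j)//=.
case: (al j) (be j) jP => [h b] [k b'] /=.
by rewrite xpair_eqE -val_eqE/= => /negbTE ->; rewrite !mul0r.
Qed.

Lemma ebas_norm_le d B (al : {ffun 'I_d -> 'I_B * bool}) :
  \prod_j ubas_norm (al j).1 (al j).2 <= (2 * pi) ^+ d.
Proof.
have -> : (2 * pi) ^+ d = \prod_(j < d) (2 * pi : R) by rewrite prodr_const card_ord.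
by apply: ler_prod => j _; rewrite ubas_norm_ge0 ubas_norm_le.
Qed.

Lemma Bessel_torus d B (u : rpoint R d -> R) :
  Rint (mu d) u -> Rint (mu d) (fun x => u x ^+ 2) ->
  \sum_(al : {ffun 'I_d -> 'I_B * bool}) (\int[mu d]_x (ebas al x * u x)) ^+ 2 <=
  (2 * pi) ^+ d * \int[mu d]_x (u x ^+ 2).
Proof.
move=> iu iu2; apply: (@Bessel _ _ _ (mu d) _ (@ebas d B)
  (fun al => \prod_j ubas_norm (al j).1 (al j).2)) => //.
- by move=> al; exact: bmeas_ebas.
- by rewrite exprn_gt0// mulr_gt0// pi_gt0.
- by move=> al; exact: ebas_norm_le.
- by move=> al be; exact: ebas_orth.
Qed.

End basis.

Section kernels.
Variables (R : realType) (r : R).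
Hypotheses (r_gt0 : 0 < r) (r_lt1 : r < 1).
Local Notation mc := (circle_measure R).
Local Notation mu := (torus_measure R).

Lemma bmeas_fejer n (c : R) : bmeas (fun z : measurableTypeR R => fejer n (c - z)).
Proof.
under eq_fun do rewrite fejerE.
apply: bmeas_sum => h; apply: bmeas_mul; first exact: bmeas_cst.
apply: bmeas_mul; first exact: bmeas_cst.
have -> : (fun z : measurableTypeR R => cos (h%:R * (c - z))) =
    (fun z : measurableTypeR R => cos (h%:R * c + z * (- h%:R))).
  by apply/funext => z; congr cos; ring.
exact: bmeas_cos_affine.
Qed.

Lemma circle_integral_fejer n (c : R) : \int[mc]_z fejer n (c - z) = 2 * pi * n.+1%:R.
Proof.
have H h z : (n.+1 - h)%:R * (cmul R h * cos (h%:R * (c - z))) =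
    (n.+1 - h)%:R * cmul R h * cos (h%:R * c + z * (0%:R - h%:R)).
  by rewrite mulrA; congr (_ * cos _); ring.
under eq_Rintegral do rewrite fejerE.
have ih (h : nat) : Rint mc (fun z : R => cos (h%:R * c + z * (0%:R - h%:R))).
  by apply: bmeas_Rint; exact: bmeas_cos_affine.
rewrite Rintegral_bigsum; last first.
  by move=> h; under eq_fun do rewrite H; exact: Rint_scale.
rewrite big_ord_recl/= big1 ?addr0.
  under eq_Rintegral do rewrite H.
  rewrite (RintegralZl _ measurableT (ih _)) circle_integral_cos_affine eqxx.
  by rewrite [0%:R * c]mul0r cos0 subn0 /=; ring.
move=> h _; under eq_Rintegral do rewrite H.
by rewrite (RintegralZl _ measurableT (ih _)) circle_integral_cos_affine mul0r mulr0.
Qed.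

Lemma bmeas_kernel1 s (c : R) : bmeas (fun z : measurableTypeR R => kernel1 r s (c - z)).
Proof.
apply: bmeas_sum => k; apply: bmeas_mul; first exact: bmeas_cst.
exact: bmeas_fejer.
Qed.

Lemma circle_integral_kernel1 s (c : R) :
  \int[mc]_z `|kernel1 r s (c - z)| <= 2 * pi * omega r s.
Proof.
apply: (@le_trans _ _ (\int[mc]_z
    (\sum_((2 ^ s).-1 <= k < (2 ^ s.+1).-1) `|ddlam r k| * fejer k (c - z)))).
  apply: le_Rintegral => //.
  - by apply: bmeas_Rint; apply: bmeas_abs; exact: bmeas_kernel1.
  - apply: bmeas_Rint; apply: bmeas_sum => k; apply: bmeas_mul; first exact: bmeas_cst.
    exact: bmeas_fejer.
  - by move=> z _; exact: kernel1_le_fejer.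
rewrite Rintegral_bigsum; last first.
  by move=> k; apply: Rint_scale; apply: bmeas_Rint; exact: bmeas_fejer.
rewrite /omega mulr_sumr; apply: ler_sum => k _.
rewrite (RintegralZl _ measurableT (bmeas_Rint _ (bmeas_fejer _ _))) circle_integral_fejer.
by rewrite mulrCA.
Qed.

Definition kern d L (s : {ffun 'I_d -> 'I_L}) (x y : rpoint R d) : R :=
  \prod_j kernel1 r (s j) (tnth x j - tnth y j).

Lemma bmeas_kern d L (s : {ffun 'I_d -> 'I_L}) x : bmeas (kern s x).
Proof.
by apply: (@bmeas_tensor R d (fun j z => kernel1 r (s j) (tnth x j - z))) => j; exact: bmeas_kernel1.
Qed.

Lemma prod_pow_level d L (s : {ffun 'I_d -> 'I_L}) (x : R) :
  \prod_j x ^+ s j = x ^+ level s.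
Proof. by rewrite /level -expr_sum. Qed.

Lemma torus_integral_kern d L (s : {ffun 'I_d -> 'I_L}) x :
  \int[mu d]_y `|kern s x y| <= (8 * pi) ^+ d * (2 `^ (- r)) ^+ level s.
Proof.
under eq_Rintegral do rewrite normr_prod.
rewrite (@torus_integral_tensor R d (fun j z => `|kernel1 r (s j) (tnth x j - z)|)); last first.
  by move=> j; apply: bmeas_abs; exact: bmeas_kernel1.
have -> : (8 * pi) ^+ d = \prod_(j < d) (8 * pi : R) by rewrite prodr_const card_ord.
rewrite -prod_pow_level -big_split/=.
apply: ler_prod => j _; apply/andP; split; first by apply: Rintegral_ge0.
apply: (le_trans (circle_integral_kernel1 _ _)).
have -> : 8 * pi * (2 `^ (- r)) ^+ s j = 2 * pi * (4 * (2 `^ (- r)) ^+ s j) by ring.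
by rewrite ler_wpM2l ?omega_le// mulr_ge0// pi_ge0.
Qed.

Lemma kern_sup d L (s : {ffun 'I_d -> 'I_L}) x y :
  `|kern s x y| <= 16 ^+ d * (2 * 2 `^ (- r)) ^+ level s.
Proof.
have -> : 16 ^+ d = \prod_(j < d) (16 : R) by rewrite prodr_const card_ord.
rewrite normr_prod -prod_pow_level -big_split/=.
apply: ler_prod => j _; rewrite normr_ge0/=.
apply: (le_trans (kernel1_sup _ _ _)).
have -> : 16 * (2 * 2 `^ (- r)) ^+ s j = 2 * (4 * (2 `^ (- r)) ^+ s j) * 2 ^+ (s j).+1.
  by rewrite exprMn exprS; ring.
by rewrite ler_wpM2r ?exprn_ge0// ler_wpM2l// omega_le.
Qed.

Definition kcoefs d L B (s : {ffun 'I_d -> 'I_L}) (al : {ffun 'I_d -> 'I_B * bool}) : R :=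
  \prod_j kcoef r (s j) (al j).1.

(** Separating [x] from [y] lets a block act through finitely many Fourier coefficients of the
    function. *)
Lemma kern_expand d L B (s : {ffun 'I_d -> 'I_L}) x y :
  (forall j, 2 ^ (s j).+1 <= B)%N ->
  kern s x y = \sum_(al : {ffun 'I_d -> 'I_B * bool}) kcoefs s al * (ebas al x * ebas al y).
Proof.
move=> sB; rewrite /kern.
have E j : kernel1 r (s j) (tnth x j - tnth y j) =
   \sum_(a : 'I_B * bool) kcoef r (s j) a.1 * (ubas a.1 a.2 (tnth x j) * ubas a.1 a.2 (tnth y j)).
  rewrite (kernel1E _ _ (sB j)).
  rewrite -(pair_bigA _ (fun (h : 'I_B) b => kcoef r (s j) h * (ubas h b (tnth x j) * ubas h b (tnth y j))))/=.
  by apply: eq_bigr => h _; rewrite -mulr_sumr ubas_sum.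
under eq_bigr do rewrite E.
rewrite (bigA_distr_bigA (fun j (a : 'I_B * bool) =>
  kcoef r (s j) a.1 * (ubas a.1 a.2 (tnth x j) * ubas a.1 a.2 (tnth y j)))).
by apply: eq_bigr => al _; rewrite /kcoefs /ebas -!big_split.
Qed.

End kernels.

(** * Square sum of the weights of the low levels *)

Section hilbert_schmidt.
Variables (R : realType) (r : R).
Hypotheses (r_gt0 : 0 < r) (r_lt : r < 2^-1).
Local Notation a := (2 `^ (- r) : R).

Let r_lt1 : r < 1. Proof. by apply: lt_trans r_lt _; rewrite invf_lt1// ltr1n. Qed.

(** Block [s] has frequencies below 2^(s + 1), so two blocks overlap only below 2^(min (s, t) + 1).
    Writing 2^min as sqrt 2^(s + t) times sqrt 2^(- |s - t|) exhibits the almost orthogonality of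
    distant blocks. *)
Lemma kcoef_corr (B s t : nat) :
  \sum_(x : 'I_B * bool) `|kcoef r s x.1| * `|kcoef r t x.1| <=
  64 * ((Num.sqrt 2 * a) ^+ s * (Num.sqrt 2 * a) ^+ t * Num.sqrt 2^-1 ^+ ((s - t) + (t - s))).
Proof.
have q0 : 0 < Num.sqrt 2 :> R by rewrite sqrtr_gt0.
have q2 : Num.sqrt 2 ^+ 2 = 2 :> R by rewrite sqr_sqrtr.
have qv : Num.sqrt 2 * Num.sqrt 2^-1 = 1 :> R by rewrite -sqrtrM// divff// sqrtr1.
pose m := minn s t.
have -> : 64 * ((Num.sqrt 2 * a) ^+ s * (Num.sqrt 2 * a) ^+ t * Num.sqrt 2^-1 ^+ ((s - t) + (t - s))) =
    2 * (2 ^ m.+1)%:R * (4 * a ^+ s * (4 * a ^+ t)).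
  rewrite !exprMn; set D := ((s - t) + (t - s))%N.
  have st : (s + t = 2 * m + D)%N by rewrite /D /m; lia.
  have -> : Num.sqrt 2 ^+ s * a ^+ s * (Num.sqrt 2 ^+ t * a ^+ t) * Num.sqrt 2^-1 ^+ D =
    (Num.sqrt 2 ^+ (s + t) * Num.sqrt 2^-1 ^+ D) * (a ^+ s * a ^+ t) by rewrite exprD; ring.
  have qvD : Num.sqrt 2 ^+ D * Num.sqrt 2^-1 ^+ D = 1 :> R by rewrite -exprMn qv expr1n.
  by rewrite st exprD exprM q2 -(mulrA (2 ^+ m)) qvD mulr1 natrX exprS; ring.
rewrite -(pair_bigA _ (fun (h : 'I_B) (b : bool) => `|kcoef r s h| * `|kcoef r t h|))/=.
have cst (h : 'I_B) : \sum_(b : bool) `|kcoef r s h| * `|kcoef r t h| =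
   2 * (`|kcoef r s h| * `|kcoef r t h|) by rewrite big_bool/=; ring.
under eq_bigr do rewrite cst.
rewrite -mulr_sumr -!mulrA ler_wpM2l//.
set M := 4 * _.
have M0 : 0 <= M by rewrite !mulr_ge0// exprn_ge0// powR_ge0.
rewrite (bigID (fun h : 'I_B => (h < 2 ^ m.+1)%N))/= [X in _ + X]big1 => [|h]; last first.
  rewrite -leqNgt /m => hm.
  have [st|st] := leqP s t.
    by rewrite kcoef_eq0 ?normr0 ?mul0r//; move: hm; rewrite (minn_idPl st).
  by rewrite [X in _ * `|X|]kcoef_eq0 ?normr0 ?mulr0//; move: hm; rewrite (minn_idPr (ltnW st)).
rewrite addr0; apply: (@le_trans _ _ (\sum_(h < B | (h < 2 ^ m.+1)%N) M)).
  apply: ler_sum => h _; rewrite /M mulrA; apply: ler_pM => //.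
    by apply: (le_trans (kcoef_le _ _ _)); exact: omega_le.
  by apply: (le_trans (kcoef_le _ _ _)); exact: omega_le.
rewrite -[leLHS]/(\sum_(h in [pred h : 'I_B | (h < 2 ^ m.+1)%N]) M).
rewrite sumr_const -[leLHS]mulr_natl ler_wpM2r// ler_nat.
rewrite -[leqRHS]card_ord.
have f_inj : {in [pred h : 'I_B | (h < 2 ^ m.+1)%N] &, injective (fun h : 'I_B => inord h : 'I_(2 ^ m.+1).-1.+1)}.
  move=> h k; rewrite !inE => hm km /(congr1 val)/=.
  by rewrite !inordK ?prednK ?expn_gt0// => /val_inj.
by rewrite -(card_in_imset f_inj) (leq_trans (max_card _))// !card_ord prednK ?expn_gt0.
Qed.

(** Schur test: expand the square, bound the correlations coordinatewise, and sum the decay in the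
    distance of [s] and [t]. This saves the extra power of [n] that a triangle inequality over the
    levels would cost. *)
Lemma sum_kcoefs_sqr (d : nat) : exists2 C : R, 0 < C &
  forall (L B n : nat) (P : pred {ffun 'I_d.+1 -> 'I_L}),
    (forall s, P s -> (level s <= n)%N) ->
    \sum_(al : {ffun 'I_d.+1 -> 'I_B * bool}) (\sum_(s | P s) kcoefs r s al) ^+ 2 <=
    C * (2 * a ^+ 2) ^+ n * n.+1%:R ^+ d.
Proof.
have a0 : 0 < a by rewrite powR_gt0.
have q0 : 0 < Num.sqrt 2 :> R by rewrite sqrtr_gt0.
pose w := Num.sqrt 2 * a; pose v : R := Num.sqrt 2^-1.
have w2 : w ^+ 2 = 2 * a ^+ 2 by rewrite exprMn sqr_sqrtr.
have w0 : 0 < w by rewrite mulr_gt0.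
(* Here r < 1/2 enters: [w ^+ 2] is 2^(1 - 2 r), so the top levels dominate. *)
have w1 : 1 < w ^+ 2.
  rewrite w2 -powR_mulrn ?powR_ge0// -powRrM -{1}[2](powRr1 (ler0n R 2)) -powRD ?implybT//.
  have e0 : 0 < 1 + - r * 2 by have := r_lt; lra.
    by have := @gt0_ltr_powR R _ e0 1 2; rewrite powR1 !nnegrE; apply => //; rewrite ltr1n.
  by apply/implyP.
have v01 : 0 <= v < 1.
  have : (2^-1 : R) < 1 by rewrite invf_lt1// ltr1n.
  by rewrite sqrtr_ge0/= -(@ltr_sqrt _ _ 1)// sqrtr1.
have /andP[v0 v1] := v01.
have [C C0 CP] := sum_low_levels d w1.
exists ((64 * (2 / (1 - v))) ^+ d.+1 * (C + 1)) => [|L B n P Pn].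
  rewrite mulr_gt0 ?exprn_gt0 ?mulr_gt0 ?invr_gt0 ?subr_gt0 ?v1//.
  by rewrite ltr_wpDl.
pose X (s t : {ffun 'I_d.+1 -> 'I_L}) := \prod_j
  (64 * (w ^+ s j * w ^+ t j * v ^+ ((s j - t j) + (t j - s j)))).
pose Y (s t : {ffun 'I_d.+1 -> 'I_L}) := \prod_j
  (64 * v ^+ ((s j - t j) + (t j - s j))).
have XE s t : X s t = w ^+ level s * w ^+ level t * Y s t.
  by rewrite -!prod_pow_level /Y -!big_split/=; apply: eq_bigr => j _; ring.
have Y0 s t : 0 <= Y s t.
  by apply: prodr_ge0 => j _; rewrite mulr_ge0// exprn_ge0// v0.
have YC s t : Y s t = Y t s.
  by apply: eq_bigr => j _; rewrite addnC.
have Ysum s : \sum_t Y s t <= (64 * (2 / (1 - v))) ^+ d.+1.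
  rewrite /Y -(bigA_distr_bigA (fun j (k : 'I_L) => 64 * v ^+ ((s j - k) + (k - s j)))).
  have -> : (64 * (2 / (1 - v))) ^+ d.+1 = \prod_(j < d.+1) (64 * (2 / (1 - v)) : R).
    by rewrite prodr_const card_ord.
  apply: ler_prod => j _; rewrite -mulr_sumr ler_wpM2l ?sum_dist_le// andbT.
  by rewrite mulr_ge0// sumr_ge0// => i _; rewrite exprn_ge0// v0.
apply: (@le_trans _ _ (\sum_(s | P s) \sum_(t | P t) X s t)).
  apply: (@le_trans _ _ (\sum_(al : {ffun 'I_d.+1 -> 'I_B * bool})
     \sum_(s | P s) \sum_(t | P t) `|kcoefs r s al| * `|kcoefs r t al|)).
    apply: ler_sum => al _; rewrite -real_normK ?num_real//.
    under [leRHS]eq_bigr do rewrite -mulr_sumr.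
    rewrite -mulr_suml -expr2 lerXn2r ?nnegrE ?ler_norm_sum//.
    by apply: sumr_ge0.
  rewrite exchange_big/=; apply: ler_sum => s _.
  rewrite exchange_big/=; apply: ler_sum => t _.
  rewrite /kcoefs; under eq_bigr do rewrite !normr_prod -big_split/=.
  rewrite -(bigA_distr_bigA (fun j (x : 'I_B * bool) => `|kcoef r (s j) x.1| * `|kcoef r (t j) x.1|)).
  apply: ler_prod => j _; rewrite kcoef_corr andbT.
  by apply: sumr_ge0 => x _; rewrite mulr_ge0.
(* The product of the two weights is replaced by half the sum of their squares, which decouples [s]
   from [t]. *)
apply: (@le_trans _ _ (\sum_(s | P s) \sum_(t | P t)
    (2^-1 * ((w ^+ 2) ^+ level s * Y s t) + 2^-1 * ((w ^+ 2) ^+ level t * Y t s)))).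
  apply: ler_sum => s _; apply: ler_sum => t _; rewrite XE -!exprM !(mulnC 2) !exprM (YC t s).
  by have := Y0 s t; have := sqr_ge0 (w ^+ level s - w ^+ level t);
    move: (w ^+ level s) (w ^+ level t) (Y s t) => x y z; nra.
under eq_bigr do rewrite big_split/=; rewrite big_split/= [X in _ + X]exchange_big/=.
set Z := \sum_(s | P s) \sum_(t | P t) _; have -> : Z + Z = 2 * Z by ring.
apply: (@le_trans _ _ (\sum_(s | P s) (w ^+ 2) ^+ level s * (64 * (2 / (1 - v))) ^+ d.+1)).
  rewrite /Z; under eq_bigr do rewrite -mulr_sumr; rewrite -mulr_sumr mulrA divff// mul1r.
  apply: ler_sum => s _; rewrite -mulr_sumr ler_wpM2l ?exprn_ge0// ?(ltW w0)//.
  by apply: le_trans (Ysum s); rewrite [leRHS](bigID P)/= lerDl sumr_ge0.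
rewrite -mulr_suml mulrC -!mulrA ler_wpM2l//.
  by rewrite exprn_ge0// mulr_ge0// divr_ge0// subr_ge0 ltW// v1.
rewrite -w2; apply: (le_trans (CP _ _ _ Pn)); rewrite [leRHS]mulrA.
have wn0 : 0 <= (w ^+ 2) ^+ n by rewrite !exprn_ge0// ltW.
rewrite ler_wpM2r ?exprn_ge0//; apply: ler_wpM2r => //; lra.
Qed.

End hilbert_schmidt.

(** * Convolution with the Bessel kernel *)

Section cos_eq1.
Variable R : realType.
Local Notation mc := (circle_measure R).

Lemma cos_eq1_nat (k : nat) (t : R) : cos t = 1 -> cos (k%:R * t) = 1 /\ sin (k%:R * t) = 0.
Proof.
move=> c1; have s0 : sin t = 0.
  have := cos2Dsin2 t; rewrite c1 expr1n -[RHS]addr0 => /addrI/eqP.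
  by rewrite sqrf_eq0 => /eqP.
elim: k => [|k [IHc IHs]]; first by rewrite mul0r cos0 sin0.
have -> : k.+1%:R * t = k%:R * t + t by rewrite -natr1 mulrDl mul1r.
by rewrite cosD sinD IHc IHs c1 s0 !mulr0 !mul1r mul0r subr0 addr0.
Qed.

Lemma measurable_cos_eq1 (c : R) : measurable [set z : measurableTypeR R | cos (c - z) = 1].
Proof.
have mf : measurable_fun [set: measurableTypeR R] (fun z : measurableTypeR R => cos (c - z)).
  have -> : (fun z : measurableTypeR R => cos (c - z)) = (fun z : measurableTypeR R => cos (c + z * -1)).
    by apply/funext => z; rewrite mulrN1.
  by have [] := bmeas_cos_affine (-1 : R) c.
have := mf measurableT [set 1%R] (measurable_set1 _); rewrite setTI.
by congr measurable.
Qed.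

(* On the set where [cos (c - z) = 1] the Fejer kernel is [n.+1 ^+ 2], whereas
   its integral is of order [n.+1]. *)
Lemma circle_cos_eq1_null (c : R) : mc [set z | cos (c - z) = 1] = 0%E.
Proof.
set N := [set z | _]; have mN : measurable N := measurable_cos_eq1 c.
have finN : mc N \is a fin_num by rewrite fin_num_measure.
rewrite -(fineK finN); congr EFin; apply/eqP; rewrite eq_le fine_ge0 ?andbT//.
have H (n : nat) : n.+1%:R * fine (mc N) <= 2 * pi.
  have bI : bmeas (\1_N : measurableTypeR R -> R).
    split; first exact: measurable_indic.
    by exists 1 => x; rewrite indicE; case: (_ \in _); rewrite ?normr1 ?normr0.
  have IE : \int[mc]_z (n.+1%:R ^+ 2 * \1_N z) = n.+1%:R ^+ 2 * fine (mc N).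
    rewrite RintegralZl//; last exact: bmeas_Rint.
    by congr (_ * _); rewrite /Rintegral integral_indic// setIT.
  have : \int[mc]_z (n.+1%:R ^+ 2 * \1_N z) <= \int[mc]_z fejer n (c - z).
    apply: le_Rintegral => //.
    - by apply: Rint_scale; exact: bmeas_Rint.
    - by apply: bmeas_Rint; exact: bmeas_fejer.
    - move=> z _; rewrite indicE; have [/set_mem zN|_] := boolP (z \in N); last first.
        by rewrite mulr0 fejer_ge0.
      rewrite mulr1 /fejer /csum.
      under eq_bigr do rewrite (cos_eq1_nat _ zN).1.
      by rewrite big_const_ord iter_addr_0 lerDl sqr_ge0.
  rewrite IE circle_integral_fejer expr2 -mulrA [leRHS]mulrC ler_pM2l//.
have := H (Num.truncn (2 * pi / fine (mc N))).
have [//|x0] := leP (fine (mc N)) 0; rewrite -ler_pdivlMr// => h.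
by have := truncnS_gt (2 * pi / fine (mc N)); rewrite ltNge h.
Qed.

End cos_eq1.

Lemma cvg_prod_ord (R : realType) (d : nat) (f : 'I_d -> nat -> R) (l : 'I_d -> R) :
  (forall j, f j n @[n --> \oo] --> l j) ->
  \prod_j f j n @[n --> \oo] --> \prod_j l j.
Proof.
elim: d f l => [|d IH] f l fl.
  by rewrite big_ord0; under eq_fun do rewrite big_ord0; exact: cvg_cst.
rewrite big_ord_recl; under eq_fun do rewrite big_ord_recl.
by apply: cvgM; [exact: fl|apply: (IH (fun j => f (lift ord0 j))) => j; exact: fl].
Qed.

Section measurable_Fr1.
Variables (R : realType) (r : R).
Hypotheses (r_gt0 : 0 < r) (r_lt1 : r < 1).

(** At multiples of 2 pi the [limn] may be a default value, but it is the same one everywhere; this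
    is what measurability of [Fr1] requires there. *)
Lemma Fr1_cos_eq1 (t : R) : cos t = 1 -> Fr1 r t = Fr1 r 0.
Proof.
move=> c1; rewrite /Fr1.
have h n : \sum_(1 <= k < n.+1) k%:R `^ (- r) * cos (k%:R * t) =
    \sum_(1 <= k < n.+1) k%:R `^ (- r) * cos (k%:R * 0).
  by apply: eq_bigr => k _; rewrite (cos_eq1_nat _ c1).1 mulr0 cos0.
by under eq_fun do rewrite h.
Qed.

Lemma measurable_Fr1 (c : R) :
  measurable_fun [set: measurableTypeR R] (fun z : measurableTypeR R => Fr1 r (c - z)).
Proof.
pose h n (z : measurableTypeR R) := if cos (c - z) == 1 then Fr1 r 0
  else \sum_(s < n) kernel1 r s (c - z).
apply: (@measurable_fun_cvg _ _ _ _ h) => [n|z _].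
  apply: measurable_fun_ifT => //.
    apply: measurable_fun_eqr => //.
    have -> : (fun z : measurableTypeR R => cos (c - z)) = (fun z : measurableTypeR R => cos (c + z * -1)).
      by apply/funext => z; rewrite mulrN1.
    by have [] := bmeas_cos_affine (-1 : R) c.
  by have [] : bmeas (fun z : measurableTypeR R => \sum_(s < n) kernel1 r s (c - z))
    by apply: bmeas_sum => s; exact: bmeas_kernel1.
rewrite /h; have [c1|c1] := eqVneq (cos (c - z)) 1.
  by rewrite (Fr1_cos_eq1 c1); exact: cvg_cst.
exact: sum_kernel1_cvg.
Qed.

End measurable_Fr1.

Section torus_convolution.
Variables (R : realType) (r p : R).
Hypotheses (r_gt0 : 0 < r) (r_lt1 : r < 1) (p_gt1 : 1 < p) (p_r : p^-1 < r).
Local Notation mu := (torus_measure R).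
Local Notation a := (2 `^ (- r) : R).

Let p_gt0 : 0 < p := lt_trans ltr01 p_gt1.

(* With [h = (2 `^ p^-1) ^+ k] this is [t <= h + h `^ (1 - p) * t `^ p]; at this
   height the [L_1] and sup bounds of the kernels of level [k] balance. *)
Lemma powR_split_le (t : R) (k : nat) : 0 <= t ->
  t <= (2 `^ p^-1) ^+ k + (2 `^ p^-1 / 2) ^+ k * t `^ p.
Proof.
move=> t0; set b := 2 `^ p^-1; have b0 : 0 < b by rewrite powR_gt0.
have bp : b `^ p = 2 by rewrite -powRrM mulVf ?powRr1 ?gt_eqF.
have [tb|/ltW bt] := leP t (b ^+ k).
  by rewrite ler_wpDr// mulr_ge0 ?powR_ge0// exprn_ge0// divr_ge0// ltW.
rewrite ler_wpDl ?exprn_ge0 ?(ltW b0)//.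
have bk0 : 0 < b ^+ k by rewrite exprn_gt0.
have -> : t `^ p = t * t `^ (p - 1).
  have e1 : p = 1 + (p - 1) by rewrite addrC subrK.
  by rewrite -{2}(powRr1 t0) -powRD -e1// gt_eqF.
have : (b ^+ k) `^ (p - 1) <= t `^ (p - 1).
  by rewrite ge0_ler_powR ?nnegrE ?subr_ge0 ?(ltW p_gt1)// ltW.
have -> : (b ^+ k) `^ (p - 1) = (2 / b) ^+ k.
  rewrite -powR_mulrn ?ltW// -powRrM mulrC powRrM powR_mulrn ?powR_ge0//; congr (_ ^+ k).
  by rewrite powRB ?bp ?powRr1 ?ltW// ?gt_eqF// implybT.
move=> h; have h2 : t * 1 <= t * ((b / 2) ^+ k * t `^ (p - 1)).
  apply: ler_wpM2l => //.
  have e1 : (b / 2) ^+ k * (2 / b) ^+ k = 1 by rewrite -exprMn (_ : b / 2 * (2 / b) = 1) ?expr1n//; field; rewrite gt_eqF.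
  by rewrite -[leLHS]e1; apply: ler_wpM2l h; rewrite exprn_ge0// divr_ge0// ltW.
by move: h2; rewrite mulr1 mulrCA.
Qed.

Local Notation theta := (2 `^ p^-1 * a).

Lemma theta_gt0 : 0 < theta. Proof. by rewrite mulr_gt0 ?powR_gt0. Qed.

(** This is the embedding condition: blocks of level k, acting on [L_p], contribute of order
    [theta ^+ k]. *)
Lemma theta_lt1 : theta < 1.
Proof.
rewrite -powRD ?implybT//; last by apply/implyP.
have e0 : 0 < r - p^-1 by rewrite subr_gt0.
have -> : p^-1 + - r = - (r - p^-1) by rewrite opprB.
rewrite powRN invf_lt1 ?powR_gt0//.
by have := @gt0_ltr_powR R _ e0 1 2; rewrite powR1 !nnegrE; apply => //; rewrite ltr1n.
Qed.

Section fixed.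
Variables (d : nat) (u : rpoint R d -> R).
Hypotheses (mu_u : measurable_fun [set: rpoint R d] u).
Hypotheses (ip : Rint (mu d) (fun y => `|u y| `^ p)).
Local Notation K := (\int[mu d]_y (`|u y| `^ p)).

Lemma Rint_of_power : Rint (mu d) u.
Proof.
apply: (@Rint_dom _ _ _ _ _ (fun y => 1 + `|u y| `^ p)) => //.
- move=> y; have := powR_split_le 0 (normr_ge0 (u y)); rewrite !expr0 mul1r => h.
  by rewrite (le_trans h)// ler_norm.
- by apply: Rint_add => //; exact: Rint_cst.
Qed.

(** After splitting [|u|] at a height depending on the level, the low part meets the [L_1] norm of
    the kernel and the high part its sup norm; both products equal theta to the level. *)
Lemma kern_abs_integral L (s : {ffun 'I_d -> 'I_L}) x :
  \int[mu d]_y (`|kern r s x y| * `|u y|) <= ((8 * pi) ^+ d + 16 ^+ d * K) * theta ^+ level s.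
Proof.
set k := level s; set b := 2 `^ p^-1; have b0 : 0 < b by rewrite powR_gt0.
have ik : Rint (mu d) (fun y => `|kern r s x y|).
  by apply: bmeas_Rint; apply: bmeas_abs; exact: bmeas_kern.
apply: (@le_trans _ _ (\int[mu d]_y (b ^+ k * `|kern r s x y| +
     (16 ^+ d * (2 * a) ^+ k * (b / 2) ^+ k) * `|u y| `^ p))).
  apply: le_Rintegral => //.
  - apply: Rint_bmul; first by apply: bmeas_abs; exact: bmeas_kern.
    by apply: Rint_abs; exact: Rint_of_power.
  - by apply: Rint_add; exact: Rint_scale.
  move=> y _; apply: (@le_trans _ _ (`|kern r s x y| * (b ^+ k + (b / 2) ^+ k * `|u y| `^ p))).
    by rewrite ler_wpM2l// powR_split_le.
  rewrite mulrDr [X in X + _]mulrC lerD2l mulrA ler_wpM2r ?powR_ge0//.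
  by rewrite ler_wpM2r ?exprn_ge0 ?divr_ge0 ?(ltW b0)// kern_sup.
rewrite RintegralD//; [|exact: Rint_scale|exact: Rint_scale].
rewrite !RintegralZl// [leRHS]mulrDl; apply: lerD.
  rewrite [leRHS]mulrC exprMn -mulrA ler_wpM2l ?exprn_ge0 ?(ltW b0)// mulrC.
  by rewrite torus_integral_kern.
rewrite le_eqVlt; apply/orP; left; apply/eqP.
have -> : (b * a) ^+ k = (2 * a) ^+ k * (b / 2) ^+ k.
  by rewrite -exprMn; congr (_ ^+ _); field.
ring.
Qed.

Lemma sum_theta_level L : \sum_(s : {ffun 'I_d -> 'I_L}) theta ^+ level s <= (1 - theta)^-1 ^+ d.
Proof.
under eq_bigr do rewrite -prod_pow_level.
rewrite -(bigA_distr_bigA (fun (j : 'I_d) (k : 'I_L) => theta ^+ k)).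
have -> : (1 - theta)^-1 ^+ d = \prod_(j < d) (1 - theta)^-1 by rewrite prodr_const card_ord.
apply: ler_prod => j _; rewrite geometric_le ?(ltW theta_gt0) ?theta_lt1// andbT.
by apply: sumr_ge0 => i _; rewrite exprn_ge0// ltW// theta_gt0.
Qed.

Lemma sum_kern_abs_integral L x : \sum_(s : {ffun 'I_d -> 'I_L})
  \int[mu d]_y (`|kern r s x y| * `|u y|) <=
  ((8 * pi) ^+ d + 16 ^+ d * K) * (1 - theta)^-1 ^+ d.
Proof.
apply: (@le_trans _ _ (\sum_(s : {ffun 'I_d -> 'I_L}) ((8 * pi) ^+ d + 16 ^+ d * K) * theta ^+ level s)).
  by apply: ler_sum => s _; exact: kern_abs_integral.
rewrite -mulr_sumr ler_wpM2l ?sum_theta_level//.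
rewrite addr_ge0// ?exprn_ge0 ?mulr_ge0 ?pi_ge0//.
by apply: Rintegral_ge0 => y _; exact: powR_ge0.
Qed.

Local Notation shift x y := [tuple tnth x j - tnth y j | j < d].

Lemma sum_kern L (x y : rpoint R d) : \sum_(s : {ffun 'I_d -> 'I_L}) kern r s x y =
  \prod_j \sum_(t < L) kernel1 r t (tnth x j - tnth y j).
Proof. by rewrite bigA_distr_bigA. Qed.

Lemma sum_kern_abs L (x y : rpoint R d) : \sum_(s : {ffun 'I_d -> 'I_L}) `|kern r s x y| =
  \prod_j \sum_(t < L) `|kernel1 r t (tnth x j - tnth y j)|.
Proof. by rewrite bigA_distr_bigA/=; apply: eq_bigr => s _; rewrite normr_prod. Qed.

Lemma torus_cos_neq1_ae (x : rpoint R d) :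
  \forall y \ae mu d, forall j, cos (tnth x j - tnth y j) != 1.
Proof.
apply: filter_forall => j.
exists [set y : rpoint R d | cos (tnth x j - tnth y j) = 1]; split.
- have := @measurable_tnth _ (measurableTypeR R) d j measurableT _ (measurable_cos_eq1 (tnth x j)).
  by rewrite setTI.
- apply: (@torus_negligible_coord R d j [set z | cos (tnth x j - z) = 1]).
    exact: measurable_cos_eq1.
  exact: circle_cos_eq1_null.
by move=> y /= /negP; rewrite negbK => /eqP.
Qed.

(** Dominated convergence, at every [x] and not merely almost every one. The majorant is the limit
    of the sums of absolute values, integrable by monotone convergence and the uniform bound
    [sum_kern_abs_integral]. *)
Lemma conv_cvg (x : rpoint R d) :
  Rint (mu d) (fun y => Fr r (shift x y) * u y) /\
  \int[mu d]_y (\sum_(s : {ffun 'I_d -> 'I_L}) kern r s x y * u y) @[L --> \oo] -->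
  \int[mu d]_y (Fr r (shift x y) * u y).
Proof.
pose f (L : nat) y := \sum_(s : {ffun 'I_d -> 'I_L}) kern r s x y * u y.
pose g (L : nat) y := \sum_(s : {ffun 'I_d -> 'I_L}) `|kern r s x y| * `|u y|.
have Rf L : Rint (mu d) (f L).
  apply: Rint_bigsum => s; apply: Rint_bmul; first exact: bmeas_kern.
  exact: Rint_of_power.
have Rg1 L (s : {ffun 'I_d -> 'I_L}) : Rint (mu d) (fun y => `|kern r s x y| * `|u y|).
  apply: Rint_bmul; first by apply: bmeas_abs; exact: bmeas_kern.
  by apply: Rint_abs; exact: Rint_of_power.
have Rg L : Rint (mu d) (g L) by apply: Rint_bigsum.
have fg L y : `|f L y| <= g L y.
  by apply: (le_trans (ler_norm_sum _ _ _)); apply: ler_sum => s _; rewrite normrM.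
have g0 L y : 0 <= g L y by apply: le_trans (fg L y).
have gmono y : {homo (fun L => (g L y)%:E) : n m / (n <= m)%N >-> (n <= m)%E}.
  move=> n m nm; rewrite lee_fin /g -!mulr_suml ler_wpM2r// !sum_kern_abs.
  apply: ler_prod => j _; rewrite sumr_ge0//= -!(big_mkord xpredT (fun t => `|kernel1 r t _|)).
  by rewrite (big_cat_nat (leq0n _) nm)/= lerDl sumr_ge0.
have mg L : measurable_fun [set: rpoint R d] (fun y => (g L y)%:E).
  by apply/measurable_EFinP; exact: measurable_Rint.
(* Taken in the extended reals, because the absolute sums may diverge at some points. *)
pose G y := limn (fun L => (g L y)%:E).
have gG y : (g L y)%:E @[L --> \oo] --> G y.
  by apply: ereal_nondecreasing_is_cvgn; exact: gmono.
have mG : measurable_fun [set: rpoint R d] G.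
  apply: (@emeasurable_fun_cvg _ _ _ _ (fun L y => (g L y)%:E) G mg) => y _.
  exact: gG.
have leG L y : ((g L y)%:E <= G y)%E.
  apply: lime_ge; first exact: gG.
  by near=> n; apply: gmono; near: n; exact: nbhs_infty_ge.
pose M := ((8 * pi) ^+ d + 16 ^+ d * K) * (1 - theta)^-1 ^+ d.
have iG : (mu d).-integrable [set: rpoint R d] G.
  apply/integrableP; split => //.
  have -> : (\int[mu d]_y `|G y|)%E = (\int[mu d]_y G y)%E.
    by apply: eq_integral => y _; rewrite gee0_abs// (le_trans _ (leG 0%N y))// lee_fin.
  rewrite /G monotone_convergence//; last first.
    by move=> n y _; rewrite lee_fin.
  apply: (@le_lt_trans _ _ M%:E); last exact: ltry.
  apply: lime_le.
    apply: ereal_nondecreasing_is_cvgn => n m nm; apply: ge0_le_integral => // y _; first [by rewrite lee_fin|exact: gmono].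
  apply: nearW => n; rewrite -[leLHS]fineK; last exact: (integrable_fin_num measurableT (Rg n)).
  rewrite lee_fin -/(Rintegral _ _ _) /g Rintegral_bigsum//.
  exact: sum_kern_abs_integral.
have mF : measurable_fun [set: rpoint R d] (fun y => (Fr r (shift x y) * u y)%:E).
  apply/measurable_EFinP; apply: measurable_funM => //.
  rewrite /Fr; apply: measurable_prod => j _.
  under eq_fun do rewrite tnth_mktuple.
  apply: (measurableT_comp (measurable_Fr1 r_gt0 r_lt1 (tnth x j))); exact: measurable_tnth.
have fF : \forall y \ae mu d, setT y ->
    (f L y)%:E @[L --> \oo] --> (Fr r (shift x y) * u y)%:E.
  have [N [mN N0 subN]] := torus_cos_neq1_ae x; exists N; split => //.
  apply: subset_trans subN; apply: subsetC => y ycos _.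
  apply: cvg_EFin; first by apply: nearW.
  have -> : fine \o (fun L => (f L y)%:E) =
      fun L => \prod_j (\sum_(t < L) kernel1 r t (tnth x j - tnth y j)) * u y.
    by apply/funext => L; rewrite /= /f -mulr_suml sum_kern.
  apply: cvgMl; apply: cvg_prod_ord => j; rewrite tnth_mktuple.
  by apply: sum_kernel1_cvg => //; exact: ycos.
have fG : \forall y \ae mu d, forall n : nat, setT y -> (`|(f n y)%:E| <= G y)%E.
  by apply: aeW => y n _; rewrite (le_trans _ (leG n y))// lee_fin.
have [iF _ H] := dominated_convergence measurableT (fun L => measurable_int _ (Rf L)) mF fF iG fG.
split => //; apply: fine_cvg; rewrite fineK; last exact: (integrable_fin_num measurableT iF).
exact: H.
Unshelve. all: by end_near.
Qed.

End fixed.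
End torus_convolution.

Lemma cvg_norm_le (R : realType) (u : nat -> R) (l M : R) :
  u n @[n --> \oo] --> l -> (\forall n \near \oo, `|u n| <= M) -> `|l| <= M.
Proof.
move=> ul uM; have H : `|u n| @[n --> \oo] --> `|l| by exact: cvg_norm.
by rewrite -(cvg_lim _ H)//; apply: limr_le => //; apply/cvg_ex; exists `|l|.
Qed.

Section convolution_bounds.
Variables (R : realType) (r : R).
Hypotheses (r_gt0 : 0 < r) (r_lt1 : r < 1).
Local Notation mu := (torus_measure R).
Local Notation a := (2 `^ (- r) : R).

Definition bessel_conv d (u : rpoint R d -> R) (x : rpoint R d) : R :=
  \int[mu d]_y (Fr r [tuple tnth x j - tnth y j | j < d] * u y).

Section power.
Variables (p : R).
Hypotheses (p_gt1 : 1 < p) (p_r : p^-1 < r).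

Lemma conv_le d (u : rpoint R d -> R) (x : rpoint R d) :
  measurable_fun [set: rpoint R d] u -> Rint (mu d) (fun y => `|u y| `^ p) ->
  `|bessel_conv u x| <= ((8 * pi) ^+ d + 16 ^+ d * \int[mu d]_y (`|u y| `^ p)) *
     (1 - 2 `^ p^-1 * a)^-1 ^+ d.
Proof.
move=> mu_u ip; have [_ H] := conv_cvg r_gt0 r_lt1 p_gt1 p_r mu_u ip x.
apply: (cvg_norm_le H); apply: nearW => L.
have Rk (s : {ffun 'I_d -> 'I_L}) : Rint (mu d) (fun y => kern r s x y * u y).
  by apply: Rint_bmul; [exact: bmeas_kern|exact: Rint_of_power ip].
rewrite Rintegral_bigsum//; apply: (le_trans (ler_norm_sum _ _ _)).
apply: le_trans (sum_kern_abs_integral r_gt0 r_lt1 p_gt1 p_r mu_u ip L x).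
apply: ler_sum => s _; apply: (le_trans (le_normr_Rintegral measurableT (Rk s))).
by under eq_Rintegral do rewrite normrM.
Qed.

(** The bound of [conv_le] is not homogeneous; applying it to [u] divided by [dl] makes it linear in
    [dl]. *)
Lemma conv_homogeneous_le d (u : rpoint R d -> R) (x : rpoint R d) (dl : R) : 0 < dl ->
  measurable_fun [set: rpoint R d] u -> Rint (mu d) (fun y => `|u y| `^ p) ->
  \int[mu d]_y (`|u y| `^ p) <= dl `^ p ->
  `|bessel_conv u x| <= ((8 * pi) ^+ d + 16 ^+ d) * (1 - 2 `^ p^-1 * a)^-1 ^+ d * dl.
Proof.
move=> dl0 mu_u ip udl.
pose v y := dl^-1 * u y.
have vE y : `|v y| `^ p = dl `^ (- p) * `|u y| `^ p.
  rewrite /v normrM gtr0_norm ?invr_gt0// powRM ?invr_ge0 ?(ltW dl0)//.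
  by congr (_ * _); rewrite -powR_inv1 ?(ltW dl0)// -powRrM mulN1r.
have mv : measurable_fun [set: rpoint R d] v by exact: measurable_funM.
have iv : Rint (mu d) (fun y => `|v y| `^ p).
  by under eq_fun do rewrite vE; exact: Rint_scale.
have := conv_le x mv iv.
have -> : bessel_conv v x = dl^-1 * bessel_conv u x.
  rewrite /bessel_conv -RintegralZl//; last by have [] := conv_cvg r_gt0 r_lt1 p_gt1 p_r mu_u ip x.
  by apply: eq_Rintegral => y _; rewrite /v mulrCA.
rewrite normrM gtr0_norm ?invr_gt0// mulrC ler_pdivrMr// => h; apply: (le_trans h).
rewrite ler_wpM2r ?(ltW dl0)// ler_wpM2r//.
  rewrite exprn_ge0// invr_ge0 subr_ge0 ltW//; exact: theta_lt1.
rewrite lerD2l -[leRHS]mulr1 ler_wpM2l ?exprn_ge0//.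
under eq_Rintegral do rewrite vE.
rewrite RintegralZl// powRN mulrC ler_pdivrMr ?powR_gt0// mul1r//.
Qed.

End power.

Definition lowk d n (x y : rpoint R d) : R :=
  \sum_(s : {ffun 'I_d -> 'I_n.+1} | (level s <= n)%N) kern r s x y.

(** A multi-index of level at most [n] has all coordinates at most [n], so the cap does not
    matter. *)
Lemma sum_cube_low d L n (x y : rpoint R d) : (n < L)%N ->
  \sum_(s : {ffun 'I_d -> 'I_L} | (level s <= n)%N) kern r s x y = lowk n x y.
Proof.
move=> nL; pose w (s : {ffun 'I_d -> 'I_n.+1}) : {ffun 'I_d -> 'I_L} :=
  [ffun j => widen_ord nL (s j)].
pose w' (s : {ffun 'I_d -> 'I_L}) : {ffun 'I_d -> 'I_n.+1} := [ffun j => inord (s j)].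
have lw s : level (w s) = level s by apply: eq_bigr => j _; rewrite ffunE.
rewrite (reindex_onto w w')/=.
  apply: eq_big => [s|s _].
    rewrite lw; case: leqP => //= sn; apply/eqP/ffunP => j; rewrite !ffunE.
    by apply: val_inj; rewrite /= inordK.
  by apply: eq_bigr => j _; rewrite ffunE.
move=> s sn; apply/ffunP => j; rewrite !ffunE; apply: val_inj => /=.
rewrite inordK// ltnS; apply: leq_trans sn.
by rewrite /level (bigD1 j)//= leq_addr.
Qed.

Lemma bmeas_power d (v : rpoint R d -> R) (q : R) : 0 <= q ->
  bmeas v -> Rint (mu d) (fun y => `|v y| `^ q).
Proof.
move=> q0 [mv [M vM]].
apply: (@Rint_dom _ _ _ _ _ (fun y => M `^ q)); last exact: Rint_cst.
  apply: (measurableT_comp (measurable_powR q)); exact: measurableT_comp.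
move=> y; rewrite !(ger0_norm (powR_ge0 _ _)).
have M0 : 0 <= M := le_trans (normr_ge0 _) (vM y).
by apply: ge0_ler_powR; rewrite ?nnegrE.
Qed.

(** The difference is the limit of the sums over levels above [n], where each block costs [V] times
    its [L_1] norm. *)
Lemma conv_low d : exists2 C : R, 0 < C & forall (v : rpoint R d.+1 -> R) (V : R) (n : nat) x,
  measurable_fun [set: rpoint R d.+1] v -> (forall y, `|v y| <= V) ->
  `|bessel_conv v x - \int[mu d.+1]_y (lowk n x y * v y)| <= C * V * a ^+ n * n.+1%:R ^+ d.
Proof.
have a01 : 0 <= a < 1.
  rewrite powR_ge0/= powRN invf_lt1 ?powR_gt0//.
  by have := @gt0_ltr_powR R _ r_gt0 1 2; rewrite powR1 !nnegrE; apply => //; rewrite ltr1n.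
have [C C0 CP] := sum_high_levels d a01.
exists ((8 * pi) ^+ d.+1 * (C + 1)) => [|v V n x mv vV].
  by rewrite mulr_gt0 ?exprn_gt0 ?mulr_gt0 ?pi_gt0// ltr_wpDl.
have V0 : 0 <= V := le_trans (normr_ge0 _) (vV x).
have bv : bmeas v by split => //; exists V.
(* Any exponent with q > 1 and 1 / q < r would do to invoke [conv_cvg], since [v] is bounded. *)
pose q := 1 + r^-1.
have q1 : 1 < q by rewrite ltrDl invr_gt0.
have qr : q^-1 < r by rewrite invf_plt ?posrE ?(lt_trans ltr01 q1)// ltrDr.
have [_ H] := conv_cvg r_gt0 r_lt1 q1 qr mv (bmeas_power (ltW (lt_trans ltr01 q1)) bv) x.
apply: (cvg_norm_le (cvgB H (cvg_cst (\int[mu d.+1]_y (lowk n x y * v y))))).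
near=> L; rewrite /GRing.sub_fun/=.
have nL : (n < L)%N by near: L; exact: nbhs_infty_gt.
have Rk (s : {ffun 'I_d.+1 -> 'I_L}) : Rint (mu d.+1) (fun y => kern r s x y * v y).
  by apply: Rint_bmul; [exact: bmeas_kern|exact: bmeas_Rint].
have Rl (P : pred {ffun 'I_d.+1 -> 'I_L}) (s : {ffun 'I_d.+1 -> 'I_L}) : Rint (mu d.+1) (fun y => if P s then kern r s x y * v y else 0).
  by case: (P s) => //; exact: Rint_cst.
have -> : \int[mu d.+1]_y (lowk n x y * v y) =
    \sum_(s : {ffun 'I_d.+1 -> 'I_L} | (level s <= n)%N) \int[mu d.+1]_y (kern r s x y * v y).
  transitivity (\int[mu d.+1]_y \sum_(s : {ffun 'I_d.+1 -> 'I_L})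
      (if (level s <= n)%N then kern r s x y * v y else 0)).
    apply: eq_Rintegral => y _; rewrite -(sum_cube_low x y nL) mulr_suml.
    by rewrite big_mkcond.
  rewrite Rintegral_bigsum; last by move=> s; exact: (Rl (fun s => level s <= n)%N).
  rewrite [RHS]big_mkcond/=; apply: eq_bigr => s _; case: ifP => // _.
  by rewrite Rintegral_cst// mul0r.
rewrite Rintegral_bigsum// (bigID (fun s => level s <= n)%N)/= addrAC subrr add0r.
apply: (le_trans (ler_norm_sum _ _ _)).
apply: (@le_trans _ _ (\sum_(s : {ffun 'I_d.+1 -> 'I_L} | ~~ (level s <= n)%N)
   V * ((8 * pi) ^+ d.+1 * a ^+ level s))).
  apply: ler_sum => s _; apply: (le_trans (le_normr_Rintegral measurableT (Rk s))).
  apply: (@le_trans _ _ (\int[mu d.+1]_y (V * `|kern r s x y|))).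
    have Rka : Rint (mu d.+1) (fun y => `|kern r s x y|).
      by apply: bmeas_Rint; apply: bmeas_abs; exact: bmeas_kern.
    apply: le_Rintegral => //.
    - exact: (Rint_abs (Rk s)).
    - exact: Rint_scale.
    - by move=> y _; rewrite normrM mulrC ler_wpM2r.
  rewrite RintegralZl//; last by apply: bmeas_Rint; apply: bmeas_abs; exact: bmeas_kern.
  by rewrite ler_wpM2l// torus_integral_kern.
rewrite -mulr_sumr -mulr_sumr.
have -> : (8 * pi) ^+ d.+1 * (C + 1) * V * a ^+ n * n.+1%:R ^+ d =
  V * ((8 * pi) ^+ d.+1 * ((C + 1) * a ^+ n * n.+1%:R ^+ d)) by ring.
rewrite ler_wpM2l// ler_wpM2l ?exprn_ge0 ?mulr_ge0 ?pi_ge0//.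
apply: (le_trans (CP _ n _ _)); first by move=> s; rewrite -ltnNge.
have an0 : 0 <= a ^+ n by rewrite exprn_ge0// powR_ge0.
by rewrite ler_wpM2r ?exprn_ge0// ler_wpM2r// lerDl.
Unshelve. all: by end_near.
Qed.

Definition lowcoef d n (al : {ffun 'I_d -> 'I_(2 ^ n.+1) * bool}) : R :=
  \sum_(s : {ffun 'I_d -> 'I_n.+1} | (level s <= n)%N) kcoefs r s al.

Lemma low_expand d n (v : rpoint R d -> R) x : Rint (mu d) v ->
  \int[mu d]_y (lowk n x y * v y) =
  \sum_al lowcoef al * (\int[mu d]_y (@ebas R d (2 ^ n.+1) al y * v y)) * ebas al x.
Proof.
move=> iv.
have Re (al : {ffun 'I_d -> 'I_(2 ^ n.+1) * bool}) : Rint (mu d) (fun y => ebas al y * v y).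
  by apply: Rint_bmul => //; exact: bmeas_ebas.
transitivity (\int[mu d]_y \sum_(al : {ffun 'I_d -> 'I_(2 ^ n.+1) * bool})
    ((lowcoef al * ebas al x) * (ebas al y * v y))).
  apply: eq_Rintegral => y _; rewrite /lowk mulr_suml.
  have kE (s : {ffun 'I_d -> 'I_n.+1}) : kern r s x y * v y =
      \sum_(al : {ffun 'I_d -> 'I_(2 ^ n.+1) * bool}) kcoefs r s al * (ebas al x * ebas al y) * v y.
    rewrite (@kern_expand R r _ _ (2 ^ n.+1)) ?mulr_suml// => j.
    by rewrite leq_exp2l.
  under eq_bigr do rewrite kE.
  rewrite exchange_big/=; apply: eq_bigr => al _.
  by rewrite /lowcoef !mulr_suml; apply: eq_bigr => s _; ring.
rewrite Rintegral_bigsum; last by move=> al; exact: Rint_scale.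
by apply: eq_bigr => al _; rewrite (RintegralZl _ measurableT (Re al)) mulrAC.
Qed.

End convolution_bounds.

(** * Cutting a function at geometric heights *)

Section layers.
Variables (R : realType) (l : R) (T : Type) (u : T -> R).
Hypothesis l_gt1 : 1 < l.

Let l_gt0 : 0 < l := lt_trans ltr01 l_gt1.

Definition cut (k : nat) (y : T) : R := if `|u y| <= l ^+ k then u y else 0.
Definition layer (i : nat) (y : T) : R := if i is k.+1 then cut k.+1 y - cut k y else cut 0 y.
Definition tail (k : nat) (y : T) : R := u y - cut k y.

Lemma layerE i y : layer i y = if (if i is k.+1 then l ^+ k < `|u y| else true) && (`|u y| <= l ^+ i)
  then u y else 0.
Proof.
case: i => [|i] //=; rewrite /cut ltNge; case: (leP (`|u y|) (l ^+ i)) => /= h; last by rewrite subr0.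
by rewrite (le_trans h) ?subrr// exprS ler_peMl ?exprn_ge0 ?(ltW l_gt0) ?(ltW l_gt1).
Qed.

Lemma sum_layer k y : \sum_(i < k.+1) layer i y + tail k y = u y.
Proof.
suff -> : \sum_(i < k.+1) layer i y = cut k y by rewrite /tail addrC subrK.
elim: k => [|k IH]; first by rewrite big_ord1.
by rewrite big_ord_recr/= IH addrC subrK.
Qed.

Lemma layer_le i y : `|layer i y| <= l ^+ i.
Proof. by rewrite layerE; case: ifP => [/andP[]//|_]; rewrite normr0 exprn_ge0// ltW. Qed.

(** On a layer of index i >= 1 the function exceeds l^(i - 1), so two of its [p] powers are kept and
    the others are traded for decay. The factor l^(p - 2) pays for the index shift, and the summand
    1 for layer 0. *)
Lemma layer_sqr_le (p : R) i y : 2 < p ->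
  layer i y ^+ 2 <= l `^ (p - 2) * (l `^ (2 - p)) ^+ i * (1 + `|u y| `^ p).
Proof.
move=> p2; have p0 : 0 < p by apply: lt_trans p2.
have q0 : 0 < p - 2 by rewrite subr_gt0.
have L1 : 1 <= l `^ (p - 2).
  by have := @ge0_ler_powR R _ (ltW q0) 1 l; rewrite powR1 !nnegrE; apply => //; exact: ltW.
rewrite layerE; case: ifP => [|_]; last first.
  by rewrite expr0n/= !mulr_ge0 ?exprn_ge0 ?powR_ge0// addr_ge0// powR_ge0.
case: i => [|i] /=; rewrite -real_normK ?num_real//.
  rewrite expr0 mulr1 => u1.
  apply: (@le_trans _ _ 1); first by rewrite exprn_ile1.
  rewrite -[leLHS]mulr1 ler_pM// lerDl powR_ge0//.
move=> /andP[ul _]; have u0 : 0 < `|u y| by apply: lt_trans ul; rewrite exprn_gt0.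
have -> : l `^ (p - 2) * (l `^ (2 - p)) ^+ i.+1 = (l ^+ i) `^ (2 - p).
  rewrite exprS mulrA -powRD ?(gt_eqF l_gt0) ?implybT//.
  have -> : p - 2 + (2 - p) = 0 by ring.
  rewrite powRr0 mul1r -powR_mulrn ?powR_ge0// -powRrM.
  by rewrite -[l ^+ i]powR_mulrn ?(ltW l_gt0)// -powRrM mulrC.
rewrite mulrDr mulr1 ler_wpDl ?powR_ge0//.
have -> : `|u y| ^+ 2 = `|u y| `^ (2 - p) * `|u y| `^ p.
  by rewrite -powRD ?(gt_eqF u0) ?implybT// subrK powR_mulrn.
rewrite ler_wpM2r ?powR_ge0//.
have -> : 2 - p = - (p - 2) by ring.
rewrite !powRN lef_pV2 ?posrE ?powR_gt0 ?exprn_gt0//.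
by apply: ge0_ler_powR; rewrite ?nnegrE ?exprn_ge0 ?(ltW l_gt0) ?(ltW q0) ?(ltW ul).
Qed.

Lemma tail_power_le (p q : R) k y : 0 < q -> q < p ->
  `|tail k y| `^ q <= (l ^+ k) `^ (q - p) * `|u y| `^ p.
Proof.
move=> q0 qp; rewrite /tail /cut; case: (leP `|u y| (l ^+ k)) => [_|ul].
  by rewrite subrr normr0 powR0 ?mulr_ge0 ?powR_ge0// gt_eqF.
have u0 : 0 < `|u y| by apply: lt_trans ul; rewrite exprn_gt0.
rewrite subr0.
have -> : `|u y| `^ q = `|u y| `^ (q - p) * `|u y| `^ p.
  by rewrite -powRD ?(gt_eqF u0) ?implybT// subrK.
rewrite ler_wpM2r ?powR_ge0//.
have pq : 0 < p - q by rewrite subr_gt0.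
have -> : q - p = - (p - q) by ring.
rewrite !powRN lef_pV2 ?posrE ?powR_gt0 ?exprn_gt0//.
by apply: ge0_ler_powR; rewrite ?nnegrE ?exprn_ge0 ?(ltW l_gt0) ?(ltW pq) ?(ltW ul).
Qed.

End layers.

(** * The three approximation methods *)

Section schemes.
Variables (R : realType) (d : nat).
Local Notation X := (rpoint R d).
Local Notation idx B := {ffun 'I_d -> 'I_B * bool}.

Definition sum_set (S1 S2 : set (X -> R)) : set (X -> R) :=
  [set f | exists g h, [/\ S1 g, S2 h & f = fun x => g x + h x]].

(* [Cx k S] reads: the elements of [S] are described at cost [k]. The family [w]
   of functionals stands for evaluations at the points of a grid. *)
Record approx_scheme (Cx : nat -> set (set (X -> R))) : Prop := ApproxScheme {
  scheme_zero : exists2 S, Cx 0%N S & S (fun=> 0);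
  scheme_add : forall k1 k2 S1 S2, Cx k1 S1 -> Cx k2 S2 -> Cx (k1 + k2)%N (sum_set S1 S2);
  scheme_main : exists2 C : R, 0 < C &
    forall (B : nat) (T : finType) (kap : idx B -> R) (w : T -> idx B -> R) (A b : R) (q : nat),
    0 < A -> 0 <= b -> (0 < q)%N -> (0 < #|T|)%N ->
    \sum_j kap j ^+ 2 <= A ^+ 2 -> (forall t j, `|w t j| <= 2 ^+ d) ->
    exists2 S, Cx (4 * q)%N S & forall z : idx B -> R, \sum_j z j ^+ 2 <= b ^+ 2 ->
    exists2 ze : idx B -> R, S (fun x => \sum_j ze j * ebas j x) &
    forall t, `|\sum_j (kap j * z j - ze j) * w t j| <=
      C * A * b * Num.sqrt (ln (8 * #|T|%:R) / q%:R) }.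

Definition in_span (k : nat) (S : set (X -> R)) : Prop :=
  exists2 g : 'I_k -> X -> R, (forall i, bmeas (g i)) &
    forall f, S f -> exists c : 'I_k -> R, f = fun x => \sum_i c i * g i x.

(** The list is indexed by all naturals so that a pair of indices can be coded in base 2^k and costs
    add. *)
Definition in_list (k : nat) (S : set (X -> R)) : Prop :=
  exists2 y : nat -> X -> R, (forall i, bmeas (y i)) &
    forall f, S f -> exists2 i, (i < 2 ^ k)%N & f = y i.

(** Unlike in [ebas], frequencies are unbounded naturals, so that sparse sums built at different
    degrees can be concatenated. *)
Definition tensor_ubas (t : {ffun 'I_d -> nat * bool}) (x : X) : R :=
  \prod_j ubas (t j).1 (t j).2 (tnth x j).

Definition sparse (k : nat) (S : set (X -> R)) : Prop :=
  forall f, S f -> exists2 l : seq (R * {ffun 'I_d -> nat * bool}), (size l <= k)%N &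
    f = fun x => \sum_(t <- l) t.1 * tensor_ubas t.2 x.

Lemma weighted_sqr_le (B : nat) (T : finType) (kap : idx B -> R) (w : T -> idx B -> R) (A : R) :
  0 < A -> \sum_j kap j ^+ 2 <= A ^+ 2 -> (forall t j, `|w t j| <= 2 ^+ d) ->
  forall t, \sum_j (kap j * w t j) ^+ 2 <= (2 ^+ d * A) ^+ 2.
Proof.
move=> A0 kA wB t; rewrite exprMn.
apply: (@le_trans _ _ (\sum_j (2 ^+ d) ^+ 2 * kap j ^+ 2)).
  apply: ler_sum => j _; rewrite exprMn mulrC ler_wpM2r ?sqr_ge0//.
  by rewrite -real_normK ?num_real// lerXn2r ?nnegrE ?exprn_ge0.
by rewrite -mulr_sumr ler_wpM2l// ?sqr_ge0.
Qed.

(** The cost [4 * q] in [scheme_main] is dictated by the nets, which have 2^(4 q) elements; a scheme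
    that spends it as dimension only gains. *)
Lemma sqrt_budget (T q : nat) : (0 < q)%N -> (0 < T)%N ->
  Num.sqrt (ln (8 * T%:R) / (4 * q)%:R) <= Num.sqrt (ln (8 * T%:R) / q%:R) :> R.
Proof.
move=> q0 T0; apply: ler_wsqrtr.
have l0 : 0 <= ln (8 * T%:R) :> R.
  by rewrite ln_ge0// -natrM ler1n muln_gt0.
rewrite ler_wpM2l// lef_pV2 ?posrE ?ltr0n ?muln_gt0// ler_nat leq_pmull//.
Qed.

(** The weights [kap] are moved from the vector to the functionals, so that a plain Euclidean ball
    is approximated; the nets proceed alike. *)
Lemma in_span_scheme : approx_scheme in_span.
Proof.
split.
- exists [set fun=> 0] => //; exists (fun=> fun=> 0) => [i|f ->]; first exact: bmeas_cst.
  by exists (fun=> 0); apply/funext => x; rewrite big_ord0.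
- move=> k1 k2 S1 S2 [g1 b1 H1] [g2 b2 H2].
  exists (fun i => match fintype.split i with inl i1 => g1 i1 | inr i2 => g2 i2 end).
    by move=> i; case: fintype.split.
  move=> f [g [h [/H1[c1 ->] /H2[c2 ->] ->]]].
  exists (fun i => match fintype.split i with inl i1 => c1 i1 | inr i2 => c2 i2 end).
  apply/funext => x; rewrite big_split_ord/=; congr (_ + _); apply: eq_bigr => i _.
    by rewrite (unsplitK (inl i)).
  by rewrite (unsplitK (inr i)).
have [C C0 CP] := exists_approx_subspace R.
exists (2 ^+ d * C); first by rewrite mulr_gt0 ?exprn_gt0.
move=> B T kap w A b q A0 b0 q0 T0 kA wB.
have q4 : (0 < 4 * q)%N by rewrite muln_gt0.
have A20 : 0 < 2 ^+ d * A by rewrite mulr_gt0 ?exprn_gt0.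
have [g gP] := CP _ _ (fun t j => kap j * w t j) _ _ A20 (weighted_sqr_le A0 kA wB) q4 T0.
pose ze (c : 'I_(4 * q) -> R) j := kap j * \sum_i c i * bsign R (g i j).
exists [set f | exists c, f = fun x => \sum_j ze c j * ebas j x].
  exists (fun i x => \sum_j kap j * bsign R (g i j) * ebas j x) => [i|f [c ->]].
    apply: bmeas_sum => j; apply: bmeas_mul; first exact: bmeas_cst.
    exact: bmeas_ebas.
  exists c; apply/funext => x; under [RHS]eq_bigr do rewrite mulr_sumr.
  rewrite exchange_big/=; apply: eq_bigr => j _.
  by rewrite /ze mulr_sumr mulr_suml; apply: eq_bigr => i _; ring.
move=> z zb; have [c cP] := gP b z b0 zb.
exists (ze c); first by exists c.
move=> t; have -> : \sum_j (kap j * z j - ze c j) * w t j =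
    \sum_j (z j - \sum_i c i * bsign R (g i j)) * (kap j * w t j).
  by apply: eq_bigr => j _; rewrite /ze; ring.
apply: (le_trans (cP t)).
have -> : C * (2 ^+ d * A) * b = 2 ^+ d * C * A * b by ring.
rewrite ler_wpM2l ?sqrt_budget//.
by rewrite !mulr_ge0 ?exprn_ge0// ltW.
Qed.

Lemma in_list_scheme : approx_scheme in_list.
Proof.
split.
- exists [set fun=> 0] => //; exists (fun=> fun=> 0) => [i|f ->]; first exact: bmeas_cst.
  by exists 0%N.
- move=> k1 k2 S1 S2 [y1 b1 H1] [y2 b2 H2].
  exists (fun i x => y1 (i %/ 2 ^ k2)%N x + y2 (i %% 2 ^ k2)%N x).
    by move=> i; apply: bmeas_add.
  move=> f [g [h [/H1[i1 h1 ->] /H2[i2 h2 ->] ->]]].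
  exists (i1 * 2 ^ k2 + i2)%N.
    rewrite expnD; apply: (@leq_trans (i1.+1 * 2 ^ k2)); last by rewrite leq_mul2r h1 orbT.
    by rewrite mulSn addnC ltn_add2r.
  by rewrite divnMDl ?expn_gt0// modnMDl (divn_small h2) (modn_small h2) addn0.
have [C C0 CP] := exists_net R.
exists (2 ^+ d * C); first by rewrite mulr_gt0 ?exprn_gt0.
move=> B T kap w A b q A0 b0 q0 T0 kA wB.
have A20 : 0 < 2 ^+ d * A by rewrite mulr_gt0 ?exprn_gt0.
have [y yP] := CP _ _ (fun t j => kap j * w t j) _ _ _ A20 (weighted_sqr_le A0 kA wB) q0 T0 b0.
exists [set f | exists2 i, (i < 2 ^ (4 * q))%N & f = fun x => \sum_j (kap j * y i j) * ebas j x].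
  exists (fun i x => \sum_j (kap j * y i j) * ebas j x) => // i.
  apply: bmeas_sum => j; apply: bmeas_mul; first exact: bmeas_cst.
  exact: bmeas_ebas.
move=> z zb; have [i i4 iP] := yP z zb.
exists (fun j => kap j * y i j); first by exists i.
move=> t; have -> : \sum_j (kap j * z j - kap j * y i j) * w t j =
    \sum_j (z j - y i j) * (kap j * w t j).
  by apply: eq_bigr => j _; ring.
have -> : 2 ^+ d * C * A * b = C * (2 ^+ d * A) * b by ring.
exact: iP.
Qed.

Lemma sparse_scheme : approx_scheme sparse.
Proof.
split.
- exists [set fun=> 0] => // f ->; exists [::] => //.
  by apply/funext => x; rewrite big_nil.
- move=> k1 k2 S1 S2 H1 H2 f [g [h [/H1[l1 h1 ->] /H2[l2 h2 ->] ->]]].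
  exists (l1 ++ l2); first by rewrite size_cat leq_add.
  by apply/funext => x; rewrite big_cat.
have [C C0 CP] := exists_sparse R.
exists (2 ^+ d * C); first by rewrite mulr_gt0 ?exprn_gt0.
move=> B T kap w A b q A0 b0 q0 T0 kA wB.
exists [set f | exists2 l : seq (R * {ffun 'I_d -> nat * bool}), (size l <= 4 * q)%N &
  f = fun x => \sum_(t <- l) t.1 * tensor_ubas t.2 x] => //.
move=> z zb.
(* For sparse sums the weights stay with [z]: the Cauchy-Schwarz inequality puts the weighted
   coefficients in an ell_1 ball, the domain of Maurey sampling. *)
have zA : \sum_j `|kap j * z j| <= A * b.
  have := @sumr_sqr_CauchySchwarz R _ xpredT (fun j => `|kap j|) (fun j => `|z j|).
  under eq_bigr do rewrite -normrM; move=> CS.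
  rewrite -(@ler_pXn2r _ 2)// ?nnegrE ?mulr_ge0 ?(ltW A0)//; last by apply: sumr_ge0.
  apply: (le_trans CS); rewrite exprMn.
  under eq_bigr do rewrite real_normK ?num_real//.
  under [X in _ * X]eq_bigr do rewrite real_normK ?num_real//.
  by apply: ler_pM => //; apply: sumr_ge0 => j _; exact: sqr_ge0.
have d20 : 0 < 2 ^+ d :> R by rewrite exprn_gt0.
have [l [c [lq cP]]] := CP _ _ w _ _ q _ d20 wB q0 T0 zA.
(* The sampled list may repeat indices; [ze] collects their coefficients. *)
pose ze j := \sum_(i <- l) c i * (i == j)%:R.
have zeE (F : idx B -> R) : \sum_j ze j * F j = \sum_(i <- l) c i * F i.
  under eq_bigr do rewrite mulr_suml.
  rewrite exchange_big/=; apply: eq_bigr => i _.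
  rewrite (bigD1 i)//= eqxx mulr1 big1 ?addr0// => j /negbTE ji.
  by rewrite eq_sym ji mulr0 mul0r.
exists ze.
  exists [seq (c i, [ffun j => (nat_of_ord (i j).1, (i j).2)]) | i <- l].
    by rewrite size_map (leq_trans lq)// leq_pmull.
  apply/funext => x; rewrite zeE big_map; apply: eq_bigr => i _ /=; congr (_ * _).
  by rewrite /ebas /tensor_ubas; apply: eq_bigr => j _; rewrite ffunE.
move=> t; have -> : \sum_j (kap j * z j - ze j) * w t j =
    \sum_j (kap j * z j) * w t j - \sum_(i <- l) c i * w t i.
  by rewrite -zeE -sumrB; apply: eq_bigr => j _; rewrite mulrBl.
have -> : 2 ^+ d * C * A * b = C * (A * b) * 2 ^+ d by ring.
exact: cP.
Qed.

End schemes.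

(** * From the sup norm to finitely many functionals *)

Section discretization.
Variables (R : realType) (d : nat).
Local Notation X := (rpoint R d).

Definition in_cube (x : X) := forall j, 0 <= tnth x j <= 2 * pi.

Lemma grid_approx (G : nat) (x : R) : (0 < G)%N -> 0 <= x <= 2 * pi ->
  exists i : 'I_G, `|x - 2 * pi * i%:R / G%:R| <= 2 * pi / G%:R.
Proof.
move=> G0 /andP[x0 xpi]; have GR : 0 < G%:R :> R by rewrite ltr0n.
have pi0 : 0 < 2 * pi :> R by rewrite mulr_gt0// pi_gt0.
pose y := x * G%:R / (2 * pi).
have y0 : 0 <= y by apply: divr_ge0; [exact: mulr_ge0|exact: ltW].
have xE : x = 2 * pi * y / G%:R by rewrite /y mulrCA divff ?gt_eqF// mulr1 mulfK ?gt_eqF.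
suff [i iy] : exists i : 'I_G, `|y - i%:R| <= 1.
  exists i; have -> : x - 2 * pi * i%:R / G%:R = (2 * pi / G%:R) * (y - i%:R).
    by rewrite {1}xE; field; rewrite gt_eqF.
  by rewrite normrM ger0_norm ?divr_ge0 ?(ltW pi0)// ler_piMr// divr_ge0// ltW.
have yG : y <= G%:R.
  by rewrite ler_pdivrMr// mulrC ler_wpM2l.
have /andP[n1 n2] := truncn_itv y0.
have [nG|Gn] := ltnP (Num.truncn y) G.
  exists (Ordinal nG) => /=; rewrite ger0_norm ?subr_ge0// lerBlDr.
  by rewrite ltW// addrC natr1.
(* Only the right endpoint 2 pi lies in no cell; the last grid point serves for it. *)
have Gp : (G.-1 < G)%N by rewrite prednK.
exists (Ordinal Gp) => /=.
have yE : y = G%:R.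
  by apply/eqP; rewrite eq_le yG (le_trans _ n1)// ler_nat.
by rewrite yE -[in X in X - _](prednK G0) -natr1 addrAC subrr add0r normr1.
Qed.

(** The grid has 2^O(n) points, hence the logarithm in [scheme_main] is of order [n.+1]; off the
    grid the Lipschitz bounds of the basis control the error. *)
Lemma discretization (Cx : nat -> set (set (X -> R))) : approx_scheme Cx ->
  exists2 C : R, 0 < C &
  forall (n : nat) (kap : {ffun 'I_d -> 'I_(2 ^ n.+1) * bool} -> R) (A b : R) (q : nat),
  0 < A -> 0 <= b -> (0 < q)%N -> \sum_j kap j ^+ 2 <= A ^+ 2 ->
  exists2 S, Cx (4 * q)%N S & forall z, \sum_j z j ^+ 2 <= b ^+ 2 ->
  exists2 y, S y & forall x, in_cube x ->
  `|\sum_j kap j * z j * ebas j x - y x| <= C * A * b * Num.sqrt (n.+1%:R / q%:R).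
Proof.
move=> sch; have [C C0 CP] := scheme_main sch.
(* Chosen so that 8 times the number of functionals is at most 2^(D (n + 1)). *)
pose D := (4 + 2 * (3 * d + 4) * d.+1)%N.
exists (2 * C * Num.sqrt D%:R).
  by rewrite !mulr_gt0// sqrtr_gt0 ltr0n.
move=> n kap A b q A0 b0 q0 kA.
pose J := {ffun 'I_d -> 'I_(2 ^ n.+1) * bool}.
(* The mesh has to beat the number of terms times their Lipschitz constants. Only ln G matters in
   the end, so the exponent is generous. *)
pose G := (2 ^ (n.+2 * (3 * d + 4)))%N.
have G0 : (0 < G)%N by rewrite expn_gt0.
pose T : finType := ({ffun 'I_d -> 'I_G} + J)%type.
pose pt (g : {ffun 'I_d -> 'I_G}) : X := [tuple 2 * pi * (g j)%:R / G%:R | j < d].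
(* The coordinates are added to the grid evaluations: they bound the
   coefficients of the error, hence its oscillation between grid points. *)
pose w (t : T) (j : J) : R := match t with inl g => ebas j (pt g) | inr k => (j == k)%:R end.
have cJ : #|J| = (2 ^ (n.+2 * d))%N.
  rewrite card_ffun card_prod !card_ord card_bool expnM; congr (_ ^ _)%N.
  by rewrite mulnC -expnS.
have cT : #|{: T}| = (G ^ d + #|J|)%N by rewrite card_sum card_ffun !card_ord.
have T0 : (0 < #|{: T}|)%N by rewrite cT addn_gt0 expn_gt0 G0.
have d21 : 1 <= 2 ^+ d :> R by rewrite exprn_ege1// ler1n.
have wB t j : `|w t j| <= 2 ^+ d.
  case: t => [g|k] /=; first exact: ebas_le.
  by apply: le_trans d21; case: (_ == _); rewrite ?normr1 ?normr0.
have [S CS SP] := CP _ T kap w A b q A0 b0 q0 T0 kA wB.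
exists S => // z zb; have [ze Sze zeP] := SP z zb.
exists (fun x => \sum_j ze j * ebas j x) => // x xc.
set eps := C * A * b * _ in zeP.
have eps0 : 0 <= eps := le_trans (normr_ge0 _) (zeP (inl [ffun=> Ordinal G0])).
have le1 (j : J) : `|kap j * z j - ze j| <= eps.
  have := zeP (inr j); rewrite (bigD1 j)//= eqxx mulr1 big1 ?addr0// => k /negbTE kj.
  by rewrite kj mulr0.
have [g gP] : exists g : {ffun 'I_d -> 'I_G}, forall j,
    `|tnth x j - tnth (pt g) j| <= 2 * pi / G%:R.
  have /boolp.choice[g gP] : forall j, exists i : 'I_G, `|tnth x j - 2 * pi * i%:R / G%:R| <= 2 * pi / G%:R.
    by move=> j; apply: grid_approx => //; exact: xc.
  by exists [ffun j => g j] => j; rewrite tnth_mktuple ffunE.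
have small : #|J|%:R * (d%:R * 2 ^+ d * (2 * (2 ^ n.+1)%:R * (2 * pi / G%:R))) <= 1 :> R.
  have GR : 0 < G%:R :> R by rewrite ltr0n.
  have -> : #|J|%:R * (d%:R * 2 ^+ d * (2 * (2 ^ n.+1)%:R * (2 * pi / G%:R))) =
    (#|J| * (d * 2 ^ d * (2 * 2 ^ n.+1 * 2)))%:R * pi / G%:R :> R.
    by rewrite !natrM !natrX; field; rewrite gt_eqF.
  rewrite ler_pdivrMr// mul1r.
  have pi4 : pi <= 4 :> R by have := pihalf_lt2 R; lra.
  apply: (@le_trans _ _ ((#|J| * (d * 2 ^ d * (2 * 2 ^ n.+1 * 2)))%:R * 4)).
    by rewrite ler_wpM2l.
  rewrite -natrM ler_nat cJ /G.
  apply: (@leq_trans (2 ^ (n.+2 * d) * (2 ^ d * 2 ^ d * (2 * 2 ^ n.+1 * 2)) * 2 ^ 2)%N).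
    rewrite leq_mul// leq_mul// leq_mul// leq_mul// ltnW// ltn_expl//.
  have -> : (2 * 2 ^ n.+1 * 2 = 2 ^ n.+3)%N by clear; rewrite !expnS; lia.
  rewrite -!expnD leq_exp2l//.
  by clear; nia.
pose h y := \sum_j (kap j * z j - ze j) * ebas j y.
have -> : \sum_j kap j * z j * ebas j x - \sum_j ze j * ebas j x = h x.
  by rewrite /h -sumrB; apply: eq_bigr => j _; rewrite mulrBl.
have hg : `|h (pt g)| <= eps by have := zeP (inl g).
have hx : `|h x - h (pt g)| <= eps.
  rewrite /h -sumrB; apply: (le_trans (ler_norm_sum _ _ _)).
  apply: (@le_trans _ _ (\sum_(j : J) eps * (d%:R * 2 ^+ d * (2 * (2 ^ n.+1)%:R * (2 * pi / G%:R))))).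
    apply: ler_sum => j _; rewrite -mulrBr normrM; apply: ler_pM => //.
    exact: ebas_lipschitz.
  rewrite sumr_const -[leLHS]mulr_natl mulrCA -[leRHS]mulr1.
  by rewrite ler_wpM2l.
have : `|h x| <= 2 * eps.
  have -> : h x = (h x - h (pt g)) + h (pt g) by rewrite subrK.
  by rewrite (le_trans (ler_normD _ _))// mulr_natl mulr2n lerD.
move=> hle; apply: (le_trans hle).
have -> : 2 * C * Num.sqrt D%:R * A * b * Num.sqrt (n.+1%:R / q%:R) =
  2 * (C * A * b * (Num.sqrt D%:R * Num.sqrt (n.+1%:R / q%:R))) by ring.
rewrite ler_wpM2l// /eps ler_wpM2l ?mulr_ge0 ?(ltW C0) ?(ltW A0)//.
rewrite -sqrtrM//; apply: ler_wsqrtr; rewrite mulrA ler_wpM2r ?invr_ge0//.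
have TD : (8 * #|{: T}| <= 2 ^ (D * n.+1))%N.
  apply: (@leq_trans (2 ^ 4 * 2 ^ (n.+2 * (3 * d + 4) * d.+1))%N).
    have h1 : (G ^ d <= 2 ^ (n.+2 * (3 * d + 4) * d.+1))%N.
      by rewrite /G -expnM leq_exp2l// leq_mul2l leqnSn orbT.
    have h2 : (#|J| <= 2 ^ (n.+2 * (3 * d + 4) * d.+1))%N.
      rewrite cJ leq_exp2l// -mulnA leq_mul2l/=; clear; nia.
    by rewrite cT; move: (2 ^ (_ * d.+1))%N (G ^ d)%N #|J| h1 h2; clear; lia.
  rewrite -expnD leq_exp2l// /D; clear; nia.
apply: (@le_trans _ _ (ln ((2 ^ (D * n.+1))%:R : R))).
  rewrite ler_ln ?posrE ?mulr_gt0 ?ltr0n ?expn_gt0// -natrM ler_nat//.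
rewrite natrX lnXn// -[leLHS]mulr_natr -natrM -[leRHS]mul1r ler_wpM2r//.
by have := @le_ln1Dx R 1; rewrite -[1 + 1]/(2 : R); apply; lra.
Qed.

End discretization.

(** * Approximation of a convolution *)

Section layer_approximation.
Variables (R : realType) (r p l K : R) (d : nat).
Hypotheses (r_gt0 : 0 < r) (r_lt : r < 2^-1) (p_gt2 : 2 < p) (l_gt1 : 1 < l).
Local Notation mu := (torus_measure R).
Local Notation a := (2 `^ (- r) : R).
Local Notation X := (rpoint R d.+1).

Let r_lt1 : r < 1. Proof. by apply: lt_trans r_lt _; rewrite invf_lt1// ltr1n. Qed.

Definition power_bounded (u : X -> R) : Prop :=
  [/\ measurable_fun [set: X] u, Rint (mu d.+1) (fun y => `|u y| `^ p) &
      \int[mu d.+1]_y (`|u y| `^ p) <= K].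

Lemma measurable_cut (u : X -> R) k : measurable_fun [set: X] u ->
  measurable_fun [set: X] (cut l u k).
Proof.
move=> mu_u; rewrite /cut; apply: measurable_fun_ifT => //.
by apply: measurable_fun_ler => //; exact: measurableT_comp.
Qed.

Lemma bmeas_layer (u : X -> R) i : measurable_fun [set: X] u -> bmeas (layer l u i).
Proof.
move=> mu_u; split; last by exists (l ^+ i) => x; exact: layer_le.
case: i => [|i]; first exact: measurable_cut.
by apply: measurable_funB; exact: measurable_cut.
Qed.

(** The first error is that of the discarded blocks against the height l^i. The second is the
    product of the square-summed weights, the [L_2] bound of the layer and the discretised random
    approximation. [S] is fixed before [u]. *)
Lemma layer_approx (Cx : nat -> set (set (X -> R))) : approx_scheme Cx ->
  exists2 C : R, 0 < C & forall n i q : nat, (0 < q)%N ->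
  exists2 S, Cx (4 * q)%N S & forall u : X -> R, power_bounded u ->
  exists2 y, S y & forall x, in_cube x ->
  `|bessel_conv r (layer l u i) x - y x| <=
    C * (l ^+ i * a ^+ n * n.+1%:R ^+ d +
         Num.sqrt ((2 * a ^+ 2) ^+ n * n.+1%:R ^+ d.+1 * (l `^ (2 - p)) ^+ i / q%:R)).
Proof.
move=> sch; have [C1 C10 C1P] := conv_low r_gt0 r_lt1 d.
have [C2 C20 C2P] := sum_kcoefs_sqr r_gt0 r_lt d.
have [C3 C30 C3P] := discretization sch.
have a0 : 0 < a by rewrite powR_gt0.
have pi20 : 0 <= 2 * pi :> R by rewrite mulr_ge0// pi_ge0.
(* Bessel's constant times the integral of the bound in [layer_sqr_le]; the absolute value is taken
   because [K] has no assumed sign. *)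
pose Kb := (2 * pi) ^+ d.+1 * (l `^ (p - 2) * ((2 * pi) ^+ d.+1 + `|K|)).
have Kb0 : 0 <= Kb.
  by rewrite !mulr_ge0 ?exprn_ge0 ?powR_ge0 ?addr_ge0 ?exprn_ge0.
pose C := C1 + C3 * Num.sqrt (C2 * Kb).
exists C => [|n i q q0]; first by rewrite ltr_wpDr// mulr_ge0 ?(ltW C30).
pose A := Num.sqrt (C2 * (2 * a ^+ 2) ^+ n * n.+1%:R ^+ d).
have nn0 : 0 <= C2 * (2 * a ^+ 2) ^+ n * n.+1%:R ^+ d.
  by rewrite !mulr_ge0 ?exprn_ge0 ?mulr_ge0 ?exprn_ge0 ?(ltW C20) ?(ltW a0).
have Kg0 : 0 <= Kb * (l `^ (2 - p)) ^+ i by rewrite mulr_ge0// exprn_ge0// powR_ge0.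
have CK0 : 0 <= C2 * Kb by rewrite mulr_ge0// ltW.
pose b := Num.sqrt (Kb * (l `^ (2 - p)) ^+ i).
have A2 : A ^+ 2 = C2 * (2 * a ^+ 2) ^+ n * n.+1%:R ^+ d.
  by rewrite sqr_sqrtr.
have A0 : 0 < A.
  by rewrite sqrtr_gt0 !mulr_gt0 ?exprn_gt0 ?mulr_gt0 ?exprn_gt0.
have kA : \sum_al (@lowcoef R r d.+1 n al) ^+ 2 <= A ^+ 2 by rewrite A2; exact: C2P.
have b0 : 0 <= b by exact: sqrtr_ge0.
have b2 : b ^+ 2 = Kb * (l `^ (2 - p)) ^+ i by rewrite sqr_sqrtr.
have [S CS SP] := C3P n _ A b q A0 b0 q0 kA.
exists S => // u [mu_u ip uK].
have bl := bmeas_layer i mu_u.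
have zb : \sum_(al : {ffun 'I_d.+1 -> 'I_(2 ^ n.+1) * bool})
    (\int[mu d.+1]_y (ebas al y * layer l u i y)) ^+ 2 <= b ^+ 2.
  have bl2 : bmeas (fun x => layer l u i x ^+ 2) by exact: bmeas_mul.
  apply: (le_trans (Bessel_torus _ (bmeas_Rint _ bl) (bmeas_Rint _ bl2))).
  rewrite b2 /Kb -mulrA ler_wpM2l ?exprn_ge0//.
  apply: (@le_trans _ _ (\int[mu d.+1]_y ((l `^ (p - 2) * (l `^ (2 - p)) ^+ i) * (1 + `|u y| `^ p)))).
    apply: le_Rintegral => //.
    - exact: bmeas_Rint.
    - by apply: Rint_scale; apply: Rint_add => //; exact: Rint_cst.
    - by move=> y _; exact: layer_sqr_le.
  rewrite RintegralZl//; last by apply: Rint_add => //; exact: Rint_cst.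
  rewrite RintegralD//; last exact: Rint_cst.
  rewrite Rintegral_cst// torus_measureT mul1r mulrAC ler_wpM2r ?exprn_ge0 ?powR_ge0//.
  by rewrite ler_wpM2l ?powR_ge0// lerD2l (le_trans uK)// ler_norm.
have [y Sy yP] := SP _ zb.
exists y => // x xc.
have [mbl _] := bl; have := C1P _ (l ^+ i) n x mbl (layer_le u l_gt1 i).
rewrite low_expand; last exact: bmeas_Rint.
have := yP x xc; set low := \sum_j _; move=> h1 h2.
have -> : bessel_conv r (layer l u i) x - y x = (bessel_conv r (layer l u i) x - low) + (low - y x) by ring.
apply: (le_trans (ler_normD _ _)); rewrite (mulrDr C).
set Y := Num.sqrt (_ / _) in h1 *; set Z := Num.sqrt (_ / _).
have ABZ : C3 * A * b * Y = C3 * Num.sqrt (C2 * Kb) * Z.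
  rewrite -!mulrA; congr (_ * _); rewrite /A /b /Y /Z.
  rewrite -(sqrtrM _ Kg0) -(sqrtrM _ nn0) -(sqrtrM _ CK0).
  by congr Num.sqrt; rewrite [n.+1%:R ^+ d.+1]exprS; ring.
have P0 : 0 <= l ^+ i * a ^+ n * n.+1%:R ^+ d.
  by rewrite !mulr_ge0 ?exprn_ge0 ?(ltW a0) ?(ltW (lt_trans ltr01 l_gt1)).
apply: lerD.
  apply: (le_trans h2); rewrite /C mulrDl.
  have -> : C1 * l ^+ i * a ^+ n * n.+1%:R ^+ d = C1 * (l ^+ i * a ^+ n * n.+1%:R ^+ d) by ring.
  by rewrite lerDl mulr_ge0 // mulr_ge0// ltW.
apply: (le_trans h1); rewrite ABZ /C mulrDl.
by rewrite lerDr mulr_ge0 ?sqrtr_ge0 ?(ltW C10).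
Qed.

End layer_approximation.

Lemma scheme_sum (R : realType) (d : nat) (Cx : nat -> set (set (rpoint R d -> R))) :
  approx_scheme Cx -> forall (I : nat) (k : nat -> nat) (S : nat -> set (rpoint R d -> R)),
  (forall i, (i < I)%N -> Cx (k i) (S i)) ->
  exists2 S', Cx (\sum_(i < I) k i)%N S' &
  forall y : nat -> rpoint R d -> R, (forall i, (i < I)%N -> S i (y i)) ->
    S' (fun x => \sum_(i < I) y i x).
Proof.
move=> sch; elim=> [|I IH] k S kS.
  have [S' CS' S'0] := scheme_zero sch; exists S'; first by rewrite big_ord0.
  by move=> y _; under eq_fun do rewrite big_ord0.
have [S' CS' S'P] := IH k S (fun i iI => kS i (ltnW iI)).
exists (sum_set S' (S I)).
  by rewrite big_ord_recr/=; apply: scheme_add => //; exact: kS.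
move=> y yS; exists (fun x => \sum_(i < I) y i x), (y I); split.
- by apply: S'P => i iI; apply: yS; exact: ltnW.
- exact: yS.
- by apply/funext => x; rewrite big_ord_recr.
Qed.

(** * Balancing the errors and computing the rate *)

Section numerics.
Variable R : realType.

Lemma exists_pow2 (x : R) : 1 <= x -> exists n, 2 ^+ n <= x < 2 ^+ n.+1.
Proof.
move=> x1; have x0 : 0 <= x := le_trans ler01 x1.
have /andP[h1 h2] := truncn_itv x0.
have t0 : (0 < Num.truncn x)%N by rewrite truncn_gt0.
have /andP[l1 l2] := trunc_log_bounds (isT : 1 < 2)%N t0.
exists (trunc_log 2 (Num.truncn x)); rewrite -!natrX; apply/andP; split.
  by apply: le_trans h1; rewrite ler_nat.
by apply: (lt_le_trans h2); rewrite ler_nat.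
Qed.

(** Raising the level by one with each layer leaves the ratio l a, up to powers of [i.+1]; [N]
    stands for ln m. *)
Lemma high_error_le (a l N D : R) (n i d : nat) : 0 <= a -> 0 <= l -> 0 <= N -> 0 <= D ->
  n.+1%:R <= D * N ->
  l ^+ i * a ^+ (n + i) * (n + i).+1%:R ^+ d <=
  D ^+ d * (a ^+ n * N ^+ d) * (i.+1%:R ^+ d * (l * a) ^+ i).
Proof.
move=> a0 l0 N0 D0 nD.
have h : (n + i).+1%:R <= D * N * i.+1%:R :> R.
  apply: (@le_trans _ _ (n.+1%:R * i.+1%:R)).
    by rewrite -natrM ler_nat; nia.
  by rewrite ler_wpM2r.
apply: (@le_trans _ _ (l ^+ i * a ^+ (n + i) * (D * N * i.+1%:R) ^+ d)).
  rewrite ler_wpM2l ?mulr_ge0 ?exprn_ge0// lerXn2r ?nnegrE// ?mulr_ge0//.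
rewrite le_eqVlt; apply/orP; left; apply/eqP.
by rewrite !exprMn exprD; ring.
Qed.

(** The upper bound on [2 ^+ n] is exactly what brings this error down to the size of the high one.
    Dividing the budget by e^i worsens the ratio of decay from 2 a^2 g to 2 a^2 g / e. *)
Lemma low_error_le (a g e N D M q : R) (n i d : nat) :
  0 <= a -> 0 <= g -> 0 < e -> 0 < N -> 0 <= D -> 0 < M ->
  n.+1%:R <= D * N -> 2 ^+ n <= M * N ^+ d / N -> M * e ^+ i <= q ->
  Num.sqrt ((2 * a ^+ 2) ^+ (n + i) * (n + i).+1%:R ^+ d.+1 * g ^+ i / q) <=
  Num.sqrt (D ^+ d.+1) * (a ^+ n * N ^+ d) * (i.+1%:R ^+ d.+1 * Num.sqrt (2 * a ^+ 2 * g / e) ^+ i).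
Proof.
move=> a0 g0 e0 N0 D0 M0 nD nM qM.
have h : (n + i).+1%:R <= D * N * i.+1%:R :> R.
  apply: (@le_trans _ _ (n.+1%:R * i.+1%:R)).
    by rewrite -natrM ler_nat; nia.
  by rewrite ler_wpM2r.
have Me0 : 0 < M * e ^+ i by rewrite mulr_gt0// exprn_gt0.
have q0 : 0 < q := lt_le_trans Me0 qM.
have DN0 : 0 <= D * N by rewrite mulr_ge0// ltW.
have rho0 : 0 <= 2 * a ^+ 2 * g / e by rewrite !mulr_ge0 ?exprn_ge0 ?invr_ge0 ?(ltW e0).
set rhs := _ * _ * (_ * _).
have rhs0 : 0 <= rhs by rewrite !mulr_ge0 ?exprn_ge0 ?sqrtr_ge0 ?(ltW N0).
rewrite -[leRHS](ger0_norm rhs0) -sqrtr_sqr.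
apply: ler_wsqrtr.
have rhs2 : rhs ^+ 2 = D ^+ d.+1 * (a ^+ n * N ^+ d) ^+ 2 *
    ((i.+1%:R ^+ d.+1) ^+ 2 * (2 * a ^+ 2 * g / e) ^+ i).
  rewrite /rhs !(exprMn 2) sqr_sqrtr ?exprn_ge0//.
  by rewrite (exprAC _ i 2) sqr_sqrtr.
rewrite rhs2.
have a20 : 0 <= 2 * a ^+ 2 by rewrite mulr_ge0// exprn_ge0.
have aa0 : 0 <= (2 * a ^+ 2) ^+ (n + i) by rewrite exprn_ge0.
apply: (@le_trans _ _ ((2 * a ^+ 2) ^+ (n + i) * (D * N * i.+1%:R) ^+ d.+1 * g ^+ i / (M * e ^+ i))).
  apply: ler_pM; rewrite ?invr_ge0 ?(ltW q0) ?mulr_ge0 ?exprn_ge0//.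
    by rewrite ler_wpM2r ?exprn_ge0// ler_wpM2l// lerXn2r ?nnegrE// ?(mulr_ge0 DN0).
  by rewrite lef_pV2 ?posrE.
have -> : (2 * a ^+ 2) ^+ (n + i) * (D * N * i.+1%:R) ^+ d.+1 * g ^+ i / (M * e ^+ i) =
   (2 ^+ n * (N ^+ d * N / M)) * (D ^+ d.+1 * (a ^+ n) ^+ 2 * i.+1%:R ^+ d.+1 * (2 * a ^+ 2 * g / e) ^+ i).
  rewrite exprD !(exprMn d.+1) (exprMn n) (exprAC a 2 n) [N ^+ d.+1]exprSr.
  rewrite [(2 * a ^+ 2 * g / e) ^+ i]exprMn [(2 * a ^+ 2 * g) ^+ i]exprMn exprVn.
  have ei0 : e ^+ i != 0 by rewrite expf_neq0// gt_eqF.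
  by field; rewrite ei0 gt_eqF.
have -> : D ^+ d.+1 * (a ^+ n * N ^+ d) ^+ 2 * ((i.+1%:R ^+ d.+1) ^+ 2 * (2 * a ^+ 2 * g / e) ^+ i) =
   (N ^+ d) ^+ 2 * (D ^+ d.+1 * (a ^+ n) ^+ 2 * (i.+1%:R ^+ d.+1) ^+ 2 * (2 * a ^+ 2 * g / e) ^+ i).
  by rewrite (exprMn 2 (a ^+ n)); ring.
apply: ler_pM; rewrite ?mulr_ge0 ?invr_ge0 ?exprn_ge0 ?(ltW N0) ?(ltW M0)//.
  have -> : 2 ^+ n * (N ^+ d * N / M) = N ^+ d * (2 ^+ n * (N / M)) by ring.
  rewrite [leRHS]expr2 ler_wpM2l ?exprn_ge0 ?(ltW N0)//.
  apply: (@le_trans _ _ (M * N ^+ d / N * (N / M))).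
    by rewrite ler_wpM2r// divr_ge0// ltW.
  by rewrite le_eqVlt; apply/orP; left; apply/eqP; field; rewrite !gt_eqF.
rewrite ler_wpM2r ?exprn_ge0// ler_wpM2l ?mulr_ge0 ?exprn_ge0//.
by rewrite -[leLHS]mulr1 expr2 ler_wpM2l ?exprn_ge0// exprn_ege1// ler1n.
Qed.

(** Here [d] is the dimension minus one, in accordance with tori of dimension [d.+1]. *)
Definition rate (d : nat) (r : R) (m : nat) : R :=
  m%:R `^ (- r) * (ln m%:R) `^ (d%:R * (1 - r) + r).

Lemma inv_le_rate d r (m : nat) : 0 < r -> r < 1 -> 1 <= ln (m%:R : R) -> m%:R^-1 <= rate d r m.
Proof.
move=> r0 r1 N1; have m0 : (0 < m)%N by case: m N1 => //; rewrite ln0//; lra.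
have mR : 1 <= m%:R :> R by rewrite ler1n.
have m0R : 0 < m%:R :> R by rewrite ltr0n.
rewrite -powR_inv1 ?ler0n// -[leLHS]mulr1 /rate.
apply: ler_pM; rewrite ?powR_ge0//.
  by apply: ler_powR => //; lra.
have ex0 : 0 <= d%:R * (1 - r) + r.
  by rewrite addr_ge0 ?(ltW r0)// mulr_ge0// subr_ge0 ltW.
by have := @ge0_ler_powR R _ ex0 1 (ln m%:R); rewrite powR1 !nnegrE; apply => //; lra.
Qed.

(** The hypothesis is the upper half of the dyadic bracket for m N^(d - 1), with N = ln m; the
    exponent of N becomes d - r (d - 1) = d (1 - r) + r. *)
Lemma pow_le_rate d r (m n : nat) : 0 < r -> r < 1 -> 1 <= ln (m%:R : R) ->
  m%:R * ln m%:R ^+ d / ln m%:R < 2 ^+ n.+1 :> R ->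
  (2 `^ (- r)) ^+ n * ln m%:R ^+ d <= 2 * rate d r m.
Proof.
move=> r0 r1 N1 Xn; have m0 : (0 < m)%N by case: m N1 {Xn} => //; rewrite ln0//; lra.
have m0R : 0 < m%:R :> R by rewrite ltr0n.
set N : R := ln _ in N1 Xn *; have N0 : 0 < N by lra.
have n20 : 0 < 2 ^+ n :> R by rewrite exprn_gt0.
have X0 : 0 < m%:R * N ^+ d / N by rewrite !mulr_gt0 ?exprn_gt0 ?invr_gt0.
have e1 : (2 `^ (- r)) ^+ n = 2 * (2 ^- 1 * (2 ^+ n) `^ (- r)).
  rewrite -powR_mulrn ?powR_ge0// -powRrM mulrC powRrM powR_mulrn//.
  by rewrite expr1 mulrA divff// mul1r.
rewrite e1 -[leLHS]mulrA ler_wpM2l//.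
have h : (2 ^+ n) `^ (- r) <= 2 * (m%:R * N ^+ d / N) `^ (- r).
  have -> : (2 ^+ n) `^ (- r) = 2 `^ r * (2 ^+ n.+1) `^ (- r).
    rewrite exprS powRM// mulrA -powRD ?implybT//; last by apply/implyP.
    by rewrite subrr powRr0 mul1r.
  apply: ler_pM; rewrite ?powR_ge0//.
    by rewrite -[leRHS]powRr1//; apply: ler_powR; [rewrite ler1n|exact: ltW].
  rewrite !powRN lef_pV2 ?posrE ?powR_gt0 ?exprn_gt0//.
  by apply: ge0_ler_powR; rewrite ?nnegrE ?(ltW r0) ?(ltW X0) ?(ltW Xn)// exprn_ge0.
apply: (@le_trans _ _ ((m%:R * N ^+ d / N) `^ (- r) * N ^+ d)).
  rewrite ler_wpM2r ?exprn_ge0 ?(ltW N0)// expr1.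
  by rewrite mulrC ler_pdivrMr// mulrC.
rewrite /rate -/N powRM ?mulr_ge0 ?exprn_ge0 ?invr_ge0 ?(ltW N0)//.
rewrite powRM ?exprn_ge0 ?(ltW N0)// -!mulrA ler_wpM2l ?powR_ge0//.
rewrite -powR_mulrn ?(ltW N0)// -powRrM -powR_inv1 ?(ltW N0)// -powRrM.
rewrite -!powRD ?(gt_eqF N0) ?implybT//.
by rewrite le_eqVlt; apply/orP; left; apply/eqP; congr (_ `^ _); ring.
Qed.

End numerics.

Section real_approximation.
Variables (R : realType) (r p K : R) (d : nat).
Hypotheses (r_gt0 : 0 < r) (r_lt : r < 2^-1) (p_gt2 : 2 < p) (p_r : p^-1 < r) (K1 : 1 <= K).
Local Notation mu := (torus_measure R).
Local Notation a := (2 `^ (- r) : R).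
Local Notation X := (rpoint R d.+1).

Let r_lt1 : r < 1. Proof. by apply: lt_trans r_lt _; rewrite invf_lt1// ltr1n. Qed.
Let p_gt1 : 1 < p. Proof. by apply: lt_trans p_gt2; rewrite ltr1n. Qed.
Let p_gt0 : 0 < p. Proof. exact: lt_trans ltr01 p_gt1. Qed.

Lemma powR2_lt1 (t : R) : t < 0 -> 2 `^ t < 1.
Proof.
move=> t0; rewrite -[t]opprK powRN invf_lt1 ?powR_gt0//.
have e0 : 0 < - t by rewrite oppr_gt0.
by have := @gt0_ltr_powR R _ e0 1 2; rewrite powR1 !nnegrE; apply => //; rewrite ltr1n.
Qed.

(** The base is 2^eta with eta the midpoint of (1 - 2 r) / (p - 2) and r, an interval that is
    nonempty because r p > 1. *)
Lemma exists_truncation_base : exists2 l : R, 1 < l &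
  l * a < 1 /\ 2 * a ^+ 2 * l `^ (2 - p) < 1.
Proof.
have p2 : 0 < p - 2 by rewrite subr_gt0.
have rp : 1 < r * p by rewrite -ltr_pdivrMr// mul1r.
have lo : (1 - 2 * r) / (p - 2) < r by rewrite ltr_pdivrMr//; lra.
pose eta := ((1 - 2 * r) / (p - 2) + r) / 2.
have eta_lo : (1 - 2 * r) / (p - 2) < eta by rewrite /eta; lra.
have eta_hi : eta < r by rewrite /eta; lra.
have eta0 : 0 < eta.
  apply: le_lt_trans eta_lo; rewrite divr_ge0 ?(ltW p2)//.
  have := r_lt; lra.
exists (2 `^ eta).
  by have := @gt0_ltr_powR R _ eta0 1 2; rewrite powR1 !nnegrE; apply => //; rewrite ltr1n.
have n2 : (2 : R) != 0 by [].
split.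
  by rewrite -powRD ?n2 ?implybT//; apply: powR2_lt1; rewrite subr_lt0.
rewrite -powR_mulrn ?powR_ge0// -!powRrM -{1}[2](powRr1 (ler0n R 2)) -!powRD ?n2 ?implybT//.
apply: powR2_lt1; move: eta_lo; rewrite ltr_pdivrMr//; nra.
Qed.

Lemma Rint_dom_power (u v : X -> R) : measurable_fun [set: X] v -> (forall y, `|v y| <= `|u y|) ->
  Rint (mu d.+1) (fun y => `|u y| `^ p) -> Rint (mu d.+1) (fun y => `|v y| `^ p).
Proof.
move=> mv vu; apply: Rint_dom.
  apply: (measurableT_comp (measurable_powR p)); exact: measurableT_comp.
move=> y; rewrite !(ger0_norm (powR_ge0 _ _)).
by apply: ge0_ler_powR; rewrite ?nnegrE// ltW.
Qed.

Lemma measurable_tail (l : R) (u : X -> R) I : measurable_fun [set: X] u ->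
  measurable_fun [set: X] (tail l u I).
Proof. by move=> mu_u; apply: measurable_funB => //; exact: measurable_cut. Qed.

Lemma bessel_conv_split (l : R) (u : X -> R) I x : 1 < l -> power_bounded p K u ->
  bessel_conv r u x = \sum_(i < I.+1) bessel_conv r (layer l u i) x + bessel_conv r (tail l u I) x.
Proof.
move=> l1 [mu_u ip _].
have Rl (i : 'I_I.+1) : Rint (mu d.+1) (fun y => Fr r [tuple tnth x j - tnth y j | j < d.+1] * layer l u i y).
  have bl := bmeas_layer l1 i mu_u; have [ml _] := bl.
  by have [] := conv_cvg r_gt0 r_lt1 p_gt1 p_r ml (bmeas_power (ltW p_gt0) bl) x.
have Rt : Rint (mu d.+1) (fun y => Fr r [tuple tnth x j - tnth y j | j < d.+1] * tail l u I y).
  have mt := measurable_tail l I mu_u.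
  have it : Rint (mu d.+1) (fun y => `|tail l u I y| `^ p).
    apply: (Rint_dom_power mt _ ip) => y; rewrite /tail /cut.
    by case: ifP; rewrite ?subrr ?subr0 ?normr0.
  by have [] := conv_cvg r_gt0 r_lt1 p_gt1 p_r mt it x.
rewrite /bessel_conv -Rintegral_bigsum// -RintegralD//; last exact: Rint_bigsum.
by apply: eq_Rintegral => y _; rewrite -mulr_sumr -mulrDr sum_layer.
Qed.

(** An exponent [q] strictly between 1 / r and [p] keeps the convolution bounded, while the [L_q]
    norm of the tail decays like a power of l^I. Hence I of order ln M reaches an error C / M. *)
Lemma tail_conv_le (l : R) : 1 < l -> exists2 C : R, 0 < C & exists2 c : R, 0 <= c &
  forall (M : R) (I : nat) (u : X -> R) x, 1 <= M -> c * ln M <= I%:R -> power_bounded p K u ->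
  `|bessel_conv r (tail l u I) x| <= C / M.
Proof.
move=> l1; pose q := (r^-1 + p) / 2.
have rp : r^-1 < p by rewrite invf_plt ?posrE.
have r2 : 2 < r^-1 by rewrite -[2]invrK ltf_pV2 ?posrE ?invr_gt0.
have qp : q < p by rewrite /q; lra.
have rq : r^-1 < q by rewrite /q; lra.
have q1 : 1 < q by lra.
have q0 : 0 < q by lra.
have qr : q^-1 < r by rewrite invf_plt ?posrE.
have pq0 : 0 < p - q by rewrite subr_gt0.
have lnl : 0 < ln l by rewrite ln_gt0.
have [C C0 CP] : exists2 C : R, 0 < C & forall (u : X -> R) x (dl : R), 0 < dl ->
    measurable_fun [set: X] u -> Rint (mu d.+1) (fun y => `|u y| `^ q) ->
    \int[mu d.+1]_y (`|u y| `^ q) <= dl `^ q -> `|bessel_conv r u x| <= C * dl.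
  exists (((8 * pi) ^+ d.+1 + 16 ^+ d.+1) * (1 - 2 `^ q^-1 * a)^-1 ^+ d.+1).
    rewrite mulr_gt0 ?addr_gt0 ?exprn_gt0 ?mulr_gt0 ?pi_gt0// invr_gt0 subr_gt0.
    exact: theta_lt1.
  by move=> u x dl; exact: conv_homogeneous_le.
exists (C * K); first by rewrite mulr_gt0// (lt_le_trans ltr01 K1).
(* With this constant l^I is at least M^(q / (p - q)), which makes (l^I)^(q - p) at most M^(- q). *)
exists (q / (p - q) / ln l); first by apply: divr_ge0; [apply: divr_ge0|]; exact: ltW.
move=> M I u x M1 cI [mu_u ip uK].
have M0 : 0 < M := lt_le_trans ltr01 M1.
have K0 : 0 < K := lt_le_trans ltr01 K1.
have l0 : 0 < l := lt_trans ltr01 l1.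
have tq y := tail_power_le u l1 I y q0 qp.
rewrite -mulrA; apply: CP.
- by rewrite divr_gt0.
- exact: measurable_tail.
- apply: (@Rint_dom _ _ _ _ _ (fun y => (l ^+ I) `^ (q - p) * `|u y| `^ p)).
  + apply: (measurableT_comp (measurable_powR q)); apply: measurableT_comp => //.
    exact: measurable_tail.
  + by move=> y; rewrite ger0_norm ?powR_ge0// (le_trans (tq y))// ler_norm.
  + exact: Rint_scale.
apply: (@le_trans _ _ (\int[mu d.+1]_y ((l ^+ I) `^ (q - p) * `|u y| `^ p))).
  apply: le_Rintegral => //.
  - apply: (@Rint_dom _ _ _ _ _ (fun y => (l ^+ I) `^ (q - p) * `|u y| `^ p)).
    + apply: (measurableT_comp (measurable_powR q)); apply: measurableT_comp => //.
      exact: measurable_tail.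
    + by move=> y; rewrite ger0_norm ?powR_ge0// (le_trans (tq y))// ler_norm.
    + exact: Rint_scale.
  - exact: Rint_scale.
rewrite RintegralZl//; apply: (@le_trans _ _ (M `^ (- q) * K)).
  apply: ler_pM => //; rewrite ?powR_ge0//.
    by apply: Rintegral_ge0 => y _; exact: powR_ge0.
  have -> : q - p = - (p - q) by ring.
  rewrite !powRN lef_pV2 ?posrE ?powR_gt0 ?exprn_gt0//.
  have -> : M `^ q = (M `^ (q / (p - q))) `^ (p - q).
    by rewrite -powRrM divfK// gt_eqF.
  apply: ge0_ler_powR; rewrite ?nnegrE ?powR_ge0 ?exprn_ge0 ?(ltW pq0) ?(ltW l0)//.
  rewrite -ler_ln ?posrE ?powR_gt0 ?exprn_gt0// ln_powR lnXn//.
  by move: cI; rewrite mulrAC ler_pdivrMr// mulr_natl.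
rewrite powRM ?invr_ge0 ?(ltW K0) ?(ltW M0)// mulrC.
have -> : M^-1 `^ q = M `^ (- q).
  by rewrite -powR_inv1 ?(ltW M0)// -powRrM mulN1r.
rewrite ler_wpM2r ?powR_ge0// -{1}(powRr1 (ltW K0)).
by apply: ler_powR => //; exact: ltW.
Qed.

Lemma real_approx (Cx : nat -> set (set (X -> R))) : approx_scheme Cx ->
  exists2 C : R, 0 < C & exists2 c : nat, (0 < c)%N &
  forall m : nat, 1 <= ln (m%:R : R) -> exists k S, [/\ (k <= c * m)%N, Cx k S &
    forall u : X -> R, power_bounded p K u -> exists2 y, S y & forall x, in_cube x ->
    `|bessel_conv r u x - y x| <= C * rate d r m].
Proof.
move=> sch; have [l l1 [la rho1]] := exists_truncation_base.
have l0 : 0 < l := lt_trans ltr01 l1.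
have a0 : 0 < a by rewrite powR_gt0.
pose g := l `^ (2 - p); have g0 : 0 < g by rewrite powR_gt0.
pose rho0 := 2 * a ^+ 2 * g; have rho00 : 0 < rho0 by rewrite !mulr_gt0 ?exprn_gt0.
(* Strictly between [rho0] and 1: the budgets m e^i stay summable, and the low errors still decay
   since rho0 / e < 1. *)
pose e := (1 + rho0) / 2.
have e0 : 0 < e by rewrite /e; lra.
have e1 : e < 1 by rewrite /e /rho0 /g; lra.
have rhoe : rho0 < e by rewrite /e /rho0 /g; lra.
have sq01 : 0 <= Num.sqrt (2 * a ^+ 2 * g / e) < 1.
  rewrite sqrtr_ge0/= -[ltRHS]sqrtr1 ltr_sqrt// ltr_pdivrMr// mul1r//.
have la01 : 0 <= l * a < 1 by rewrite la mulr_ge0// ltW.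
have [C1 C10 C1P] := layer_approx K r_gt0 r_lt p_gt2 l1 sch.
have [C2 C20 [cI cI0 tailP]] := tail_conv_le l1.
have [C3 C30 C3P] := poly_geometric_bounded d la01.
have [C4 C40 C4P] := poly_geometric_bounded d.+1 sq01.
pose D := d.+1%:R / ln 2 + 1 : R.
have ln20 : 0 < ln 2 :> R by rewrite ln_gt0// ltr1n.
have D0 : 0 < D by rewrite ltr_wpDl// divr_ge0// ltW.
pose CE := C1 * (D ^+ d * C3 + Num.sqrt (D ^+ d.+1) * C4) * 2.
have CE0 : 0 <= CE by rewrite /CE !(mulr_ge0, addr_ge0) ?exprn_ge0 ?sqrtr_ge0 ?(ltW C10) ?(ltW D0).
(* The geometric sum of the budgets, plus one unit of rounding per layer; there are at most cI ln m
   + 2 layers, hence at most (cI + 2) m. *)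
pose Q := 4 * ((1 - e)^-1 + (cI + 2)).
have e1i : 0 <= (1 - e)^-1 by rewrite invr_ge0 subr_ge0 ltW.
have Q0 : 0 <= Q by rewrite /Q mulr_ge0// addr_ge0// addr_ge0.
exists (CE + C2); first by rewrite ltr_wpDl.
exists (Num.truncn Q).+1 => // m N1.
set N : R := ln _ in N1 *.
have N0 : 0 < N := lt_le_trans ltr01 N1.
have m0 : (0 < m)%N by rewrite lt0n; apply/negP => /eqP m0; move: N1; rewrite /N m0 ln0// ler10.
have mR : 0 < m%:R :> R by rewrite ltr0n.
have Nm : N <= m%:R.
  have h := @le_ln1Dx R (m%:R - 1); rewrite (_ : 1 + (m%:R - 1) = m%:R) in h; last by ring.
  have h1 : N <= m%:R - 1 by apply: h; lra.
  lra.
(* The power d - 1 of [N] is written as a quotient, to include [d = 0]; as N <= m, the bracketed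
   number is at least 1. *)
have [n0 /andP[n0lo n0hi]] : exists n, 2 ^+ n <= m%:R * N ^+ d / N < 2 ^+ n.+1.
  apply: exists_pow2; rewrite ler_pdivlMr// mul1r (le_trans Nm)//.
  by rewrite -[leLHS]mulr1 ler_wpM2l// exprn_ege1.
have n0D : n0.+1%:R <= D * N.
  have : n0%:R * ln 2 <= d.+1%:R * N.
    rewrite !mulr_natl -!lnXn// ler_ln ?posrE ?exprn_gt0//.
    apply: (le_trans n0lo); rewrite ler_pdivrMr// exprS -mulrA ler_wpM2l//.
    rewrite -[leLHS]mulr1; apply: ler_pM => //; first by rewrite exprn_ge0// ltW.
    by rewrite lerXn2r ?nnegrE ?(ltW N0).
  rewrite -ler_pdivlMr// => h; rewrite -natr1 /D mulrDl mul1r.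
  by rewrite mulrAC lerD.
pose I := (Num.truncn (cI * N)).+1.
have Ilo : cI * N <= I%:R by rewrite /I ltW// truncnS_gt.
have Ihi : I%:R <= cI * N + 1.
  by rewrite /I -natr1 lerD2r truncn_le// mulr_ge0// ltW.
(* Rounding up keeps every budget positive, even where m e^i is below 1. *)
pose q i := (Num.truncn (m%:R * e ^+ i)).+1.
have qlo i : m%:R * e ^+ i <= (q i)%:R by rewrite /q ltW// truncnS_gt.
have qhi i : (q i)%:R <= m%:R * e ^+ i + 1.
  by rewrite /q -natr1 lerD2r truncn_le// mulr_ge0// exprn_ge0// ltW.
have /boolp.choice[S SP] : forall i : nat, exists S, Cx (4 * q i)%N S /\ forall u : X -> R, power_bounded p K u ->
    exists2 y, S y & forall x, in_cube x -> `|bessel_conv r (layer l u i) x - y x| <=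
    C1 * (l ^+ i * a ^+ (n0 + i) * (n0 + i).+1%:R ^+ d +
         Num.sqrt ((2 * a ^+ 2) ^+ (n0 + i) * (n0 + i).+1%:R ^+ d.+1 * g ^+ i / (q i)%:R)).
  by move=> i; have [S CS SP] := C1P (n0 + i)%N i (q i) isT; exists S.
have [S' CS' S'P] := scheme_sum sch (fun i (iI : (i < I.+1)%N) => (SP i).1).
exists (\sum_(i < I.+1) 4 * q i)%N, S'; split => //.
  rewrite -(ler_nat R) natr_sum.
  apply: (@le_trans _ _ (Q * m%:R)); last first.
    by rewrite natrM ler_wpM2r// ltW// truncnS_gt.
  apply: (@le_trans _ _ (4 * (m%:R * (\sum_(i < I.+1) e ^+ i) + I.+1%:R))).
    have -> : m%:R * (\sum_(i < I.+1) e ^+ i) + I.+1%:R = \sum_(i < I.+1) (m%:R * e ^+ i + 1).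
      by rewrite big_split/= -mulr_sumr sumr_const card_ord.
    rewrite mulr_sumr; apply: ler_sum => i _; rewrite natrM ler_wpM2l//.
  rewrite /Q -mulrA ler_wpM2l// mulrDl lerD//.
    rewrite mulrC ler_wpM2r// geometric_le// e1 ltW//.
  rewrite -natr1 (le_trans (lerD Ihi (lexx 1)))//.
  have : cI * N <= cI * m%:R by rewrite ler_wpM2l.
  have : 1 <= m%:R :> R by rewrite ler1n.
  lra.
move=> u uP.
have /boolp.choice[y yP] : forall i : nat, exists y, S i y /\ forall x, in_cube x -> `|bessel_conv r (layer l u i) x - y x| <=
    C1 * (l ^+ i * a ^+ (n0 + i) * (n0 + i).+1%:R ^+ d +
         Num.sqrt ((2 * a ^+ 2) ^+ (n0 + i) * (n0 + i).+1%:R ^+ d.+1 * g ^+ i / (q i)%:R)).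
  by move=> i; have [y Sy yP] := (SP i).2 u uP; exists y.
exists (fun x => \sum_(i < I.+1) y i x); first by apply: S'P => i _; exact: (yP i).1.
move=> x xc; rewrite (bessel_conv_split I x l1 uP) addrAC -sumrB mulrDl.
apply: (le_trans (ler_normD _ _)); apply: lerD; last first.
  have M1 : 1 <= m%:R :> R by rewrite ler1n.
  have M2 : cI * ln m%:R <= I.+1%:R by rewrite (le_trans Ilo)// ler_nat.
  apply: (le_trans (tailP _ _ _ x M1 Ilo uP)).
  by rewrite ler_wpM2l ?(ltW C20)// inv_le_rate.
pose E := a ^+ n0 * N ^+ d.
have E0 : 0 <= E by rewrite mulr_ge0 ?exprn_ge0 ?(ltW a0) ?(ltW N0).
apply: (@le_trans _ _ (C1 * (D ^+ d * C3 + Num.sqrt (D ^+ d.+1) * C4) * E)); last first.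
  rewrite /CE -[leRHS]mulrA ler_wpM2l//; last exact: pow_le_rate.
  by rewrite mulr_ge0 ?(ltW C10)// addr_ge0// mulr_ge0 ?exprn_ge0 ?sqrtr_ge0 ?(ltW D0).
apply: (le_trans (ler_norm_sum _ _ _)).
apply: (@le_trans _ _ (\sum_(i < I.+1) C1 * (D ^+ d * E * (i.+1%:R ^+ d * (l * a) ^+ i) +
    Num.sqrt (D ^+ d.+1) * E * (i.+1%:R ^+ d.+1 * Num.sqrt (2 * a ^+ 2 * g / e) ^+ i)))).
  apply: ler_sum => i _; apply: (le_trans ((yP i).2 x xc)).
  rewrite ler_wpM2l ?(ltW C10)//; apply: lerD.
    by apply: high_error_le => //; exact: ltW.
  exact: (low_error_le (ltW a0) (ltW g0) e0 N0 (ltW D0) mR n0D n0lo (qlo i)).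
rewrite -mulr_sumr big_split/= -!mulr_sumr -[leRHS]mulrA ler_wpM2l ?(ltW C10)//.
have -> : (D ^+ d * C3 + Num.sqrt (D ^+ d.+1) * C4) * E =
  D ^+ d * E * C3 + Num.sqrt (D ^+ d.+1) * E * C4 by ring.
apply: lerD; apply: ler_wpM2l.
- by rewrite mulr_ge0// exprn_ge0// ltW.
- exact: C3P.
- by rewrite mulr_ge0// sqrtr_ge0.
- exact: C4P.
Qed.

End real_approximation.

(** * The unit ball of the Sobolev space *)

Section complex_functions.
Variable R : realType.
Local Notation mu := (torus_measure R).
Local Notation normc := Normc.normc.

Lemma Re_le_normc (z : R[i]) : `|complex.Re z| <= normc z.
Proof.
case: z => x y /=; rewrite -sqrtr_sqr; apply: ler_wsqrtr.
by rewrite lerDl sqr_ge0.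
Qed.

Lemma Im_le_normc (z : R[i]) : `|complex.Im z| <= normc z.
Proof.
case: z => x y /=; rewrite -sqrtr_sqr; apply: ler_wsqrtr.
by rewrite lerDr sqr_ge0.
Qed.

Lemma normc_ge0 (z : R[i]) : 0 <= normc z.
Proof. by case: z => x y; exact: sqrtr_ge0. Qed.

Lemma normc_le (x y : R) : normc (x +i* y)%C <= `|x| + `|y|.
Proof.
rewrite /= -(@ler_pXn2r _ 2)// ?nnegrE ?sqrtr_ge0 ?addr_ge0//.
rewrite sqr_sqrtr ?addr_ge0 ?sqr_ge0// sqrrD !real_normK ?num_real//.
by rewrite addrAC lerDl mulrn_wge0// mulr_ge0.
Qed.

Lemma torus_cube_ae d : \forall x \ae mu d, in_cube x.
Proof.
apply: filter_forall => j.
have mN : measurable (~` (@circle R)) by apply: measurableC; exact: measurable_circle.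
exists [set x : rpoint R d | (~` (@circle R)) (tnth x j)]; split.
- by have := @measurable_tnth _ (measurableTypeR R) d j measurableT _ mN; rewrite setTI.
- apply: torus_negligible_coord => //.
  by rewrite /circle_measure /= /mfrestr /= /mrestr setICl measure0.
move=> x /= xj; rewrite /circle/= in_itv/=.
exact: xj.
Qed.

Lemma Lp_norm_oo_le d (h : cfun R d) (M : R) : cmeasurable h -> 0 <= M ->
  (\forall x \ae mu d, normc (h x) <= M) -> (Lp_norm +oo%E h <= M%:E)%E.
Proof.
move=> mh M0 hM; rewrite /Lp_norm asboolT// unlock; case: ifP => _; last by rewrite lee_fin.
apply/ess_sup_inf.ess_supP; move: hM; apply: filterS => x xM /=.
by rewrite lee_fin ger0_norm// normc_ge0.
Qed.

End complex_functions.

Section sobolev_ball.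
Variables (R : realType) (d : nat) (r p : R).
Hypotheses (r_gt0 : 0 < r) (p_gt2 : 2 < p).
Local Notation mu := (torus_measure R).
Local Notation normc := Normc.normc.
Local Notation cst_d := ((2 * pi) ^- d.+1 : R).

Lemma part_power_bounded (phi : cfun R d.+1) (f : rpoint R d.+1 -> R) :
  (Lp_norm p%:E phi < 2%:E)%E -> measurable_fun [set: rpoint R d.+1] f ->
  (forall x, `|f x| <= normc (phi x)) -> power_bounded p (2 `^ p) f.
Proof.
have p0 : 0 < p by apply: lt_trans p_gt2.
rewrite /Lp_norm; case: asboolP => // mphi phi2 mf fphi.
have I2 : (\int[mu d.+1]_x (normc (phi x) `^ p)%:E <= (2 `^ p)%:E)%E.
  have := poweR_Lnorm (mu d.+1) (fun x => (normc (phi x))%:E) (lt0r_neq0 p0).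
  under eq_integral do rewrite abse_EFin ger0_norm ?normc_ge0// poweR_EFin.
  move=> <-; rewrite -poweR_EFin; apply: gt0_ler_poweR.
  - exact: ltW.
  - by rewrite in_itv/= leey Lnorm_ge0.
  - by rewrite in_itv/= leey andbT lee_fin ler0n.
  - exact: ltW.
have mfp : measurable_fun [set: rpoint R d.+1] (fun x => `|f x| `^ p).
  apply: (measurableT_comp (measurable_powR p)); exact: measurableT_comp.
have fI : (\int[mu d.+1]_x (`|f x| `^ p)%:E <= (2 `^ p)%:E)%E.
  apply: le_trans I2; apply: ge0_le_integral => //.
  - exact/measurable_EFinP.
  - apply/measurable_EFinP; apply: (measurableT_comp (measurable_powR p)).
    have [mr mi] := mphi.
    have -> : (fun x => normc (phi x)) =
       (fun x => (complex.Re (phi x) ^+ 2 + complex.Im (phi x) ^+ 2) `^ 2^-1).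
      by apply/funext => x; rewrite powR12_sqrt ?addr_ge0 ?sqr_ge0//; case: (phi x).
    apply: (measurableT_comp (measurable_powR 2^-1)).
    by apply: measurable_funD; apply: measurable_funX.
  - by move=> x _; rewrite lee_fin; apply: ge0_ler_powR; rewrite ?nnegrE ?normc_ge0// ltW.
have fR : Rint (mu d.+1) (fun x => `|f x| `^ p).
  apply/integrableP; split; first exact/measurable_EFinP.
  under eq_integral do rewrite /= ger0_norm ?powR_ge0//.
  by rewrite (le_lt_trans fI)// ltry.
split => //.
rewrite -lee_fin; apply: le_trans fI.
by rewrite /Rintegral fineK//; exact: (integrable_fin_num measurableT fR).
Qed.

(** The Sobolev norm is an infimum, so a norm at most 1 yields a preimage of norm below 2, whose
    real and imaginary parts have [p]-th power integral at most 2^p. *)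
Lemma sobolev_ball_repr (f : cfun R d.+1) : (sobolev_norm r p f <= 1)%E ->
  exists u v, [/\ power_bounded p (2 `^ p) u, power_bounded p (2 `^ p) v, cmeasurable f &
    \forall x \ae mu d.+1,
      f x = (cst_d%:C)%C * (bessel_conv r u x +i* bessel_conv r v x)%C].
Proof.
move=> f1.
have /ereal_inf_lt[_ [phi [fp _ fphi] <-] phi2] : (sobolev_norm r p f < 2%:E)%E.
  by rewrite (le_lt_trans f1)// lte_fin ltr1n.
have mphi : cmeasurable phi.
  by move: phi2; rewrite /Lp_norm; case: asboolP.
have mf : cmeasurable f.
  by move: fp; rewrite /Lp_norm; case: asboolP.
exists (fun x => complex.Re (phi x)), (fun x => complex.Im (phi x)); split => //.
- by apply: (part_power_bounded phi2) => [|x]; [exact: mphi.1|exact: Re_le_normc].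
- by apply: (part_power_bounded phi2) => [|x]; [exact: mphi.2|exact: Im_le_normc].
move: fphi; apply: filterS => x ->; rewrite /Fr_conv /cintegral /bessel_conv.
congr (_ * _); congr (_ +i* _)%C; apply: eq_Rintegral => y _; case: (phi y) => s t /=.
  by rewrite mul0r subr0.
by rewrite mul0r addr0.
Qed.

End sobolev_ball.

(** * From costs to indices *)

Section rates.
Variables (R : realType) (d : nat) (r : R).
Hypotheses (r_gt0 : 0 < r) (r_lt1 : r < 1).

Lemma rate_gt0 m : (2 <= m)%N -> 0 < rate d r m :> R.
Proof.
move=> m2; rewrite mulr_gt0// powR_gt0//; first by rewrite ltr0n (leq_trans _ m2).
by rewrite ln_gt0// ltr1n.
Qed.

Let ex0 : 0 <= d%:R * (1 - r) + r.
Proof. by rewrite addr_ge0 ?(ltW r_gt0)// mulr_ge0// subr_ge0 ltW. Qed.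

(** The estimates hold at indices above c n with n large. A large [m] is handled by a proportional
    [n], at the price of a constant, and the finitely many small [m] by the uniform bound [C0]. *)
Lemma rate_transfer (s : nat -> \bar R) (C0 C : R) (c : nat) : (0 < c)%N -> 0 < C ->
  (forall m, (0 < m)%N -> (s m <= C0%:E)%E) ->
  (forall m n, 1 <= ln (n%:R : R) -> (c * n < m)%N -> (s m <= (C * rate d r n)%:E)%E) ->
  exists2 C1 : R, 0 < C1 & forall m, (2 <= m)%N -> (s m <= (C1 * rate d r m)%:E)%E.
Proof.
move=> c0 C_gt0 sC0 sC.
pose n3 := (Num.truncn (expR 1 : R)).+1.
have n3P (n : nat) : (n3 <= n)%N -> 1 <= ln (n%:R : R).
  move=> h; rewrite -[leLHS](expRK 1); rewrite ler_ln ?posrE ?expR_gt0//.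
    by apply: (@le_trans _ _ n3%:R); rewrite ?ler_nat// ltW// truncnS_gt.
  by rewrite ltr0n (leq_trans _ h).
pose M0 := (c * n3)%N.
have M0g : (0 < M0)%N by rewrite muln_gt0 c0.
(* A lower bound of the rate for m between 2 and [M0]: the decreasing factor is taken at [M0], the
   increasing one at 2. *)
pose rho := M0%:R `^ (- r) * (ln 2) `^ (d%:R * (1 - r) + r) : R.
have rho0 : 0 < rho by rewrite mulr_gt0// powR_gt0 ?ltr0n// ln_gt0// ltr1n.
exists (`|C0| / rho + C * (2 * c)%:R); first by rewrite ltr_wpDl ?divr_ge0 ?(ltW rho0)// mulr_gt0// ltr0n muln_gt0.
move=> m m2; have m0 : (0 < m)%N by apply: leq_trans m2.
have r0 := rate_gt0 m2.
have [mM|Mm] := leqP m M0.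
  apply: (le_trans (sC0 _ m0)); rewrite lee_fin mulrDl.
  rewrite -[leLHS]addr0 lerD//; last exact: (mulr_ge0 (mulr_ge0 (ltW C_gt0) (ler0n _ _)) (ltW r0)).
  apply: (le_trans (ler_norm C0)); rewrite -mulrA ler_peMr// ler_pdivlMl// mulr1.
  rewrite /rho /rate; apply: ler_pM; rewrite ?powR_ge0//.
    rewrite !powRN lef_pV2 ?posrE ?powR_gt0 ?ltr0n//.
    by apply: ge0_ler_powR; rewrite ?nnegrE ?ler_nat// ltW.
  apply: ge0_ler_powR; rewrite ?nnegrE ?ln_ge0 ?ler1n//.
  by rewrite ler_ln ?posrE ?ltr0n// ler_nat.
(* The largest [n] with c n < m. *)
pose n := (m.-1 %/ c)%N.
have nm : (c * n < m)%N by rewrite -[X in (_ < X)%N](prednK m0) ltnS mulnC /n leq_divM.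
have n3n : (n3 <= n)%N by rewrite leq_divRL// mulnC -ltnS prednK.
have n0 : (0 < n)%N by apply: leq_trans n3n.
have mn : (m <= 2 * c * n)%N.
  have := ltn_ceil m.-1 c0; rewrite -/n => h; rewrite -(prednK m0).
  apply: (leq_trans h); move: c0 n0; move: (n) (c); clear; nia.
apply: (le_trans (sC m n (n3P _ n3n) nm)); rewrite lee_fin.
apply: (@le_trans _ _ (C * (2 * c)%:R * rate d r m)); last first.
  by rewrite ler_wpM2r ?(ltW r0)// lerDr divr_ge0 ?(ltW rho0).
rewrite -mulrA ler_wpM2l ?(ltW C_gt0)// /rate mulrA.
apply: ler_pM; rewrite ?powR_ge0//.
  have -> : n%:R `^ (- r) = (2 * c)%:R `^ r * (2 * c * n)%:R `^ (- r).
    rewrite (natrM _ (2 * c) n) powRM ?ler0n// mulrA -powRD ?subrr ?powRr0 ?mul1r//.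
    by rewrite pnatr_eq0 muln_eq0/= -lt0n c0 implybT.
  apply: ler_pM; rewrite ?powR_ge0//.
    rewrite -[leRHS]powRr1//; apply: ler_powR; last exact: ltW.
    by rewrite ler1n muln_gt0.
  rewrite !powRN lef_pV2 ?posrE ?powR_gt0 ?ltr0n ?muln_gt0 ?c0//.
  by apply: ge0_ler_powR; rewrite ?nnegrE ?ler_nat// ltW.
apply: ge0_ler_powR; rewrite ?nnegrE ?ln_ge0 ?ler1n//.
rewrite ler_ln ?posrE ?ltr0n// ler_nat.
by apply: leq_trans (ltnW nm); rewrite leq_pmull.
Qed.

End rates.

(** * From real waves to complex exponentials *)

Section trigonometric_expansion.
Variable R : realType.
Local Notation C := R[i].

Lemma complex_sum (I : Type) (s : seq I) (f g : I -> R) :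
  ((\sum_(i <- s) f i) +i* (\sum_(i <- s) g i))%C = \sum_(i <- s) (f i +i* g i)%C :> C.
Proof. by elim: s => [|i s IH]; rewrite ?big_nil// !big_cons -IH. Qed.

Lemma imaginary_sum (I : Type) (s : seq I) (f : I -> R) :
  (0 +i* (\sum_(i <- s) f i))%C = \sum_(i <- s) (0 +i* f i)%C :> C.
Proof. by rewrite -(complex_sum s (fun=> 0) f) big1_eq. Qed.

Definition expi (t : R) : C := (cos t +i* sin t)%C.

Lemma expiD s t : expi (s + t) = expi s * expi t.
Proof. by rewrite /expi cosD sinD /=; congr (_ +i* _)%C; rewrite addrC mulrC [X in _ + X]mulrC. Qed.

Lemma expi_sum d (t : 'I_d -> R) : \prod_j expi (t j) = expi (\sum_j t j).
Proof.
have e0 : expi 0 = 1 by rewrite /expi cos0 sin0.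
by rewrite (big_morph expi expiD e0).
Qed.

(** Coefficients of Euler's formulas for cosine and sine; [sg] selects the frequency [- h]. *)
Definition wave_coef (h : nat) (b sg : bool) : C :=
  let s := Num.sqrt (cmul R h) / 2 in
  if b then (0 +i* (if sg then s else - s))%C else (s +i* 0)%C.

Definition wave_freq (h : nat) (sg : bool) : int := if sg then - h%:Z else h%:Z.

Lemma ubas_expi h b (x : R) :
  ((ubas h b x)%:C)%C = \sum_(sg : bool) wave_coef h b sg * expi ((wave_freq h sg)%:~R * x).
Proof.
rewrite big_bool /wave_freq /wave_coef /expi /ubas mulrNz mulNr cosN sinN -pmulrn.
set s := Num.sqrt _; set c := cos _; set z := sin _.
by case: b; rewrite /=; apply/eqP; rewrite eq_complex/=; apply/andP; split; apply/eqP; field.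
Qed.

(** Frequencies may repeat, which turns addition into concatenation; [trig_list_polys] merges the
    repetitions into a finite set. *)
Definition trig_list d (n : nat) (f : cfun R d) : Prop :=
  exists2 l : seq (C * d.-tuple int), (size l <= n)%N &
    f = fun x => \sum_(t <- l) t.1 * trig_monomial t.2 x.

(** Each of the [d] real waves splits into two exponentials. *)
Lemma trig_list_tensor d (c : C) (t : {ffun 'I_d -> nat * bool}) :
  trig_list (2 ^ d) (fun x => c * ((tensor_ubas t x)%:C)%C).
Proof.
pose co (sg : {ffun 'I_d -> bool}) := c * \prod_j wave_coef (t j).1 (t j).2 (sg j).
pose fr (sg : {ffun 'I_d -> bool}) : d.-tuple int := [tuple wave_freq (t j).1 (sg j) | j < d].
exists [seq (co sg, fr sg) | sg <- enum {: {ffun 'I_d -> bool}}].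
  by rewrite size_map -cardE card_ffun card_bool card_ord.
apply/funext => x; rewrite big_map big_enum/= /tensor_ubas rmorph_prod/=.
under eq_bigr do rewrite ubas_expi.
rewrite (bigA_distr_bigA (fun j sg => wave_coef (t j).1 (t j).2 sg *
  expi ((wave_freq (t j).1 sg)%:~R * tnth x j))) mulr_sumr.
apply: eq_bigr => sg _; rewrite big_split/= mulrA expi_sum; congr (_ * _).
rewrite /trig_monomial /expi.
have -> : \sum_(j < d) (tnth (fr sg) j)%:~R * tnth x j =
    \sum_j (wave_freq (t j).1 (sg j))%:~R * tnth x j :> R.
  by apply: eq_bigr => j _; rewrite tnth_mktuple.
by [].
Qed.

Lemma trig_list_sum d (n : nat) (I : Type) (s : seq I) (f : I -> cfun R d) :
  (forall i, trig_list n (f i)) -> trig_list (size s * n) (fun x => \sum_(i <- s) f i x).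
Proof.
move=> fn; elim: s => [|i s [l ls lE]].
  by exists [::] => //; apply/funext => x; rewrite !big_nil.
have [l1 l1s l1E] := fn i.
exists (l1 ++ l); first by rewrite size_cat mulSn leq_add.
apply/funext => x; rewrite big_cons big_cat/=.
by rewrite l1E (congr1 (fun g => g x) lE).
Qed.

Lemma trig_list_polys d (n : nat) (f : cfun R d) : trig_list n f -> trig_polys n f.
Proof.
move=> [l ln ->].
pose L := [fset k in [seq t.2 | t <- l]]%fset.
exists L, (fun k => \sum_(t <- l | t.2 == k) t.1); split.
  by apply: leq_trans ln; rewrite card_fseq (leq_trans (size_undup _))// size_map.
apply/funext => x; rewrite fct_sumE.
have E k : ((\sum_(t <- l | t.2 == k) t.1) *: trig_monomial k) x =
    \sum_(t <- l) (if t.2 == k then t.1 * trig_monomial k x else 0).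
  by rewrite -[LHS]/(_ * _) mulr_suml big_mkcond.
under [RHS]eq_bigr do rewrite E.
rewrite exchange_big/=; apply: eq_big_seq => t tl.
rewrite (bigD1_seq t.2) ?fset_uniq//=; last by rewrite !inE; apply: map_f.
by rewrite eqxx big1 ?addr0// => k /negbTE tk; rewrite eq_sym tk.
Qed.

End trigonometric_expansion.

Section approximation_in_ball.
Variables (R : realType) (d : nat) (r p : R).
Hypotheses (p_gt2 : 2 < p) (p_r : p^-1 < r) (r_lt : r < 2^-1).
Local Notation mu := (torus_measure R).
Local Notation normc := Normc.normc.
Local Notation cst_d := ((2 * pi) ^- d.+1 : R).
Local Notation X := (rpoint R d.+1).
Local Notation W := (@sobolev_norm R d.+1 r p).

Let p_gt0 : 0 < p. Proof. by apply: lt_trans p_gt2. Qed.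
Let p_gt1 : 1 < p. Proof. by apply: lt_trans p_gt2; rewrite ltr1n. Qed.
Let r_gt0 : 0 < r. Proof. by apply: lt_trans p_r; rewrite invr_gt0. Qed.
Let r_lt1 : r < 1. Proof. by apply: lt_trans r_lt _; rewrite invf_lt1// ltr1n. Qed.

(** The factor is the normalisation in [Fr_conv], kept outside the approximation of the two real
    parts. *)
Definition cpair (y1 y2 : X -> R) : cfun R d.+1 :=
  fun x => (cst_d%:C)%C * (y1 x +i* y2 x)%C.

Lemma cpairE y1 y2 x : cpair y1 y2 x = ((cst_d * y1 x) +i* (cst_d * y2 x))%C.
Proof. by rewrite /cpair; apply/eqP; rewrite eq_complex/= !mul0r subr0 addr0 !eqxx. Qed.

Lemma cst_d_itv : 0 <= cst_d <= 1.
Proof.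
have h : 1 <= 2 * pi :> R by have := @pi_ge2 R; lra.
have h1 : 1 <= (2 * pi) ^+ d.+1 :> R by rewrite exprn_ege1.
by rewrite invr_ge0 invf_le1 ?h1 ?(le_trans ler01 h1)// (lt_le_trans ltr01 h1).
Qed.

Lemma cpair_le y1 y2 x (M : R) : `|y1 x| <= M -> `|y2 x| <= M -> normc (cpair y1 y2 x) <= 2 * M.
Proof.
move=> h1 h2; have /andP[c0 c1] := cst_d_itv.
rewrite cpairE; apply: (le_trans (normc_le _ _)).
have h y : `|cst_d * y| <= `|y| by rewrite normrM (ger0_norm c0) ler_piMl.
have -> : 2 * M = M + M by ring.
by rewrite lerD// (le_trans (h _)).
Qed.

Lemma cmeasurable_cpair y1 y2 : measurable_fun [set: X] y1 -> measurable_fun [set: X] y2 ->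
  cmeasurable (cpair y1 y2).
Proof.
move=> m1 m2; have -> : cpair y1 y2 = fun x => ((cst_d * y1 x) +i* (cst_d * y2 x))%C.
  by apply/funext => x; exact: cpairE.
by split => /=; apply: measurable_funM.
Qed.

Lemma cmeasurable_sub (f g : cfun R d.+1) : cmeasurable f -> cmeasurable g -> cmeasurable (f - g).
Proof.
move=> [f1 f2] [g1 g2]; split.
  have -> : (fun x => complex.Re ((f - g) x)) = (fun x => complex.Re (f x) - complex.Re (g x)).
    by apply/funext => x; rewrite -[(f - g) x]/(f x - g x); case: (f x) (g x) => [? ?] [? ?].
  exact: measurable_funB.
have -> : (fun x => complex.Im ((f - g) x)) = (fun x => complex.Im (f x) - complex.Im (g x)).
  by apply/funext => x; rewrite -[(f - g) x]/(f x - g x); case: (f x) (g x) => [? ?] [? ?].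
exact: measurable_funB.
Qed.

(** Supplies the bound at cost 0 that covers the small indices. *)
Lemma in_ball_le : exists2 C : R, 0 < C & forall f : cfun R d.+1, (W f <= 1)%E ->
  cmeasurable f /\ \forall x \ae mu d.+1, normc (f x) <= C.
Proof.
pose B := ((8 * pi) ^+ d.+1 + 16 ^+ d.+1 * 2 `^ p) * (1 - 2 `^ p^-1 * 2 `^ (- r))^-1 ^+ d.+1.
have th : 0 < 1 - 2 `^ p^-1 * 2 `^ (- r) :> R.
  by rewrite subr_gt0; exact: theta_lt1.
have B0 : 0 < B.
  rewrite mulr_gt0 ?exprn_gt0 ?invr_gt0// ltr_wpDl ?mulr_gt0 ?powR_gt0 ?exprn_gt0//.
  by rewrite exprn_ge0// mulr_ge0// pi_ge0.
have BP (u : X -> R) x : power_bounded p (2 `^ p) u -> `|bessel_conv r u x| <= B.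
  move=> [mu_u ip uK]; apply: (le_trans (conv_le r_gt0 r_lt1 p_gt1 p_r x mu_u ip)).
  by rewrite ler_wpM2r ?exprn_ge0 ?invr_ge0 ?(ltW th)// lerD2l ler_wpM2l ?exprn_ge0.
exists (2 * B); first by rewrite mulr_gt0.
move=> f f1; have [u [v [uP vP mf fE]]] := sobolev_ball_repr p_gt2 f1.
split => //; move: fE; apply: filterS => x ->.
by apply: (@cpair_le (bessel_conv r u) (bessel_conv r v)); exact: BP.
Qed.

Lemma in_ball_approx (Cx : nat -> set (set (X -> R))) : approx_scheme Cx ->
  exists2 C : R, 0 < C & exists2 c : nat, (0 < c)%N &
  forall n : nat, 1 <= ln (n%:R : R) -> exists k S, [/\ (k <= c * n)%N, Cx k S &
    forall f : cfun R d.+1, (W f <= 1)%E -> exists y1 y2, [/\ S y1, S y2, cmeasurable f &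
      \forall x \ae mu d.+1, normc ((f - cpair y1 y2) x) <= C * rate d r n]].
Proof.
move=> sch; have K1 : 1 <= 2 `^ p :> R.
  by rewrite -[leLHS](powRr0 2); apply: ler_powR; rewrite ?ler1n// ltW.
have [C C0 [c c0 H]] := real_approx r_gt0 r_lt p_gt2 p_r K1 sch.
exists (2 * C); first by rewrite mulr_gt0.
exists c => // n n1; have [k [S [kn CS SP]]] := H n n1.
exists k, S; split => // f f1.
have [u [v [uP vP mf fE]]] := sobolev_ball_repr p_gt2 f1.
have [y1 S1 h1] := SP u uP; have [y2 S2 h2] := SP v vP.
exists y1, y2; split => //.
have cub := torus_cube_ae R d.+1.
near=> x; rewrite -[(f - cpair y1 y2) x]/(f x - cpair y1 y2 x).
have -> : f x = (cst_d%:C)%C * (bessel_conv r u x +i* bessel_conv r v x)%C by near: x.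
have xc : in_cube x by near: x.
rewrite /cpair -mulrBr.
have -> : (bessel_conv r u x +i* bessel_conv r v x)%C - (y1 x +i* y2 x)%C =
   ((bessel_conv r u x - y1 x) +i* (bessel_conv r v x - y2 x))%C by [].
rewrite -mulrA; apply: (@cpair_le (fun x => bessel_conv r u x - y1 x) (fun x => bessel_conv r v x - y2 x)).
  exact: h1.
exact: h2.
Unshelve. all: by end_near.
Qed.

End approximation_in_ball.

(** * Reading the three quantities off the approximations *)

Section numbers.
Variables (R : realType) (d : nat) (r p : R).
Local Notation mu := (torus_measure R).
Local Notation normc := Normc.normc.
Local Notation X := (rpoint R d.+1).
Local Notation W := (@sobolev_norm R d.+1 r p).
Local Notation Linf := (@Lp_norm R d.+1 +oo%E).
Local Notation I := (idfun : {linear cfun R d.+1 -> cfun R d.+1}).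

Definition ball_approx (Cx : nat -> set (set (X -> R))) (k : nat) (M : R) : Prop :=
  exists2 S, Cx k S & forall f : cfun R d.+1, (W f <= 1)%E ->
    exists y1 y2, [/\ S y1, S y2, cmeasurable f &
      \forall x \ae mu d.+1, normc ((f - cpair y1 y2) x) <= M].

Lemma Linf_sub_le (f : cfun R d.+1) (y1 y2 : X -> R) (M : R) : 0 <= M -> cmeasurable f ->
  bmeas y1 -> bmeas y2 -> (\forall x \ae mu d.+1, normc ((f - cpair y1 y2) x) <= M) ->
  (Linf (f - cpair y1 y2)%R <= M%:E)%E.
Proof.
move=> M0 mf [m1 _] [m2 _] h; apply: Lp_norm_oo_le => //.
by apply: cmeasurable_sub => //; exact: cmeasurable_cpair.
Qed.

Lemma Linf_cpair_fin (y1 y2 : X -> R) : bmeas y1 -> bmeas y2 -> (Linf (cpair y1 y2) < +oo)%E.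
Proof.
move=> [m1 [M1 h1]] [m2 [M2 h2]].
apply: (@le_lt_trans _ _ (2 * Num.max M1 M2)%:E); last exact: ltry.
apply: Lp_norm_oo_le; first exact: cmeasurable_cpair.
  rewrite mulr_ge0// le_max; apply/orP; left.
  by apply: (le_trans _ (h1 [tuple 0 | j < d.+1])).
by apply: aeW => x; apply: cpair_le; rewrite le_max ?h1 ?h2 ?orbT.
Qed.

(** Complex coefficients merge the real combinations for the two parts, so the dimension stays
    [k]. *)
Lemma kolmogorov_le k m M : 0 < M -> (1 * k < m)%N ->
  ball_approx (@in_span R d.+1) k M -> (kolmogorov_number W Linf I m <= M%:E)%E.
Proof.
rewrite mul1n => M0 km [S [g bg Sg] SP].
have bS y : S y -> bmeas y.
  move=> /Sg[c ->]; apply: bmeas_sum => i; apply: bmeas_mul => //; exact: bmeas_cst.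
pose G (i : 'I_k) : cfun R d.+1 := cpair (g i) (fun=> 0).
pose L := [set y | exists c : 'I_k -> R[i], y = \sum_(i < k) c i *: G i].
apply: ge_ereal_inf; eexists.
  exists L; last by reflexivity.
  exists k => //; exists G => // i; apply: Linf_cpair_fin => //; exact: bmeas_cst.
apply: ge_ereal_sup => _ [f f1 <-].
have [y1 [y2 [S1 S2 mf h]]] := SP f f1.
apply: ge_ereal_inf; exists (Linf (f - cpair y1 y2)); last first.
  apply: Linf_sub_le => //; [exact: ltW|exact: bS|exact: bS].
exists (cpair y1 y2) => //.
have [c1 ->] := Sg _ S1; have [c2 ->] := Sg _ S2.
exists (fun i => (c1 i +i* c2 i)%C); apply/funext => x.
rewrite fct_sumE /cpair complex_sum mulr_sumr; apply: eq_bigr => i _.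
rewrite -[RHS]/(_ * ((_ * _) : R[i])) mulrCA; congr (_ * _).
by apply/eqP; rewrite eq_complex/= !mulr0 subr0 add0r !eqxx.
Qed.

(** A centre is a pair of listed functions, one for each part, coded by quotient and remainder;
    hence the factor 2. *)
Lemma entropy_le k m M : 0 < M -> (2 * k < m)%N ->
  ball_approx (@in_list R d.+1) k M -> (entropy_number W Linf I m <= M%:E)%E.
Proof.
move=> M0 km [S [y by_ Sy] SP].
apply: ge_ereal_inf; exists M%:E => //; exists M => //; split => //.
exists (fun j : 'I_(2 ^ (m - 1)) => cpair (y (j %/ 2 ^ k)%N) (y (j %% 2 ^ k)%N)).
  by move=> j; exact: Linf_cpair_fin.
move=> _ [f f1 <-]; have [y1 [y2 [S1 S2 mf h]]] := SP f f1.
have [i1 i1k y1E] := Sy _ S1; have [i2 i2k y2E] := Sy _ S2.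
have jm : (i1 * 2 ^ k + i2 < 2 ^ (m - 1))%N.
  apply: (@leq_trans (2 ^ (k + k))); last by rewrite leq_exp2l//; lia.
  rewrite expnD; apply: (@leq_trans (i1.+1 * 2 ^ k)); last by rewrite leq_mul2r i1k orbT.
  by rewrite mulSn addnC ltn_add2r.
exists (Ordinal jm) => //=.
rewrite divnMDl ?expn_gt0// modnMDl (divn_small i2k) (modn_small i2k) addn0 -y1E -y2E.
have Mc : ((M%:C)%C : R[i]) != 0 by rewrite eq_complex/= eqxx andbT gt_eqF.
exists ((M%:C)%C^-1 *: (f - cpair y1 y2)); last first.
  by rewrite scalerA divff// scale1r addrC subrK.
(* Measurability of the rescaled difference is needed, because [Lp_norm] is infinite off measurable
   functions. *)
rewrite /unit_ball/=; apply: Lp_norm_oo_le => //.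
  have [mg1 mg2] : cmeasurable (f - cpair y1 y2).
    by apply: cmeasurable_sub => //; apply: cmeasurable_cpair; rewrite ?y1E ?y2E; [have [] := by_ i1|have [] := by_ i2].
  have MM : M * M^-1 = 1 by rewrite divff// gt_eqF.
  have E (z : R[i]) : ((M%:C)^-1 * z = ((M^-1 * complex.Re z) +i* (M^-1 * complex.Im z)))%C.
    apply: (mulfI Mc); rewrite mulrA divff// mul1r.
    case: z => s t /=; apply/eqP; rewrite eq_complex/= !mul0r subr0 addr0.
    by rewrite !mulrA MM !mul1r !eqxx.
  split.
    have -> : (fun x => complex.Re (((M%:C)%C^-1 *: (f - cpair y1 y2)) x)) =
        (fun x => M^-1 * complex.Re ((f - cpair y1 y2) x)).
      by apply/funext => x; rewrite -[(_ *: _) x]/((M%:C)%C^-1 * ((f - cpair y1 y2) x)) E.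
    exact: measurable_funM.
  have -> : (fun x => complex.Im (((M%:C)%C^-1 *: (f - cpair y1 y2)) x)) =
      (fun x => M^-1 * complex.Im ((f - cpair y1 y2) x)).
    by apply/funext => x; rewrite -[(_ *: _) x]/((M%:C)%C^-1 * ((f - cpair y1 y2) x)) E.
  exact: measurable_funM.
move: h; apply: filterS => x h.
rewrite -[(_ *: _) x]/((M%:C)%C^-1 * ((f - cpair y1 y2) x)) Normc.normcM Normc.normcV.
have -> : normc (M%:C)%C = M by rewrite /= expr0n addr0 sqrtr_sqr gtr0_norm.
by rewrite mulrC ler_pdivrMr// mul1r.
Qed.

Lemma bmeas_tensor_ubas (t : {ffun 'I_d.+1 -> nat * bool}) : bmeas (tensor_ubas t : X -> R).
Proof.
by apply: (@bmeas_tensor R d.+1 (fun j => ubas (t j).1 (t j).2)) => j; exact: bmeas_ubas.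
Qed.

(** The factor 2^(d + 2) counts two real parts, and 2^(d + 1) exponentials for each real tensor wave
    in d + 1 variables. *)
Lemma best_mterm_le k m M : 0 < M -> (2 ^ d.+2 * k < m)%N ->
  ball_approx (@sparse R d.+1) k M -> (best_mterm W I m <= M%:E)%E.
Proof.
move=> M0 km [S Sk SP]; apply: ge_ereal_sup => _ [f f1 <-].
have [y1 [y2 [S1 S2 mf h]]] := SP f f1.
have [l1 l1k y1E] := Sk _ S1; have [l2 l2k y2E] := Sk _ S2.
have bl (l : seq (R * {ffun 'I_d.+1 -> nat * bool})) :
    bmeas (fun x : X => \sum_(t <- l) t.1 * tensor_ubas t.2 x).
  apply: bmeas_sum => t; apply: bmeas_mul; first exact: bmeas_cst.
  exact: bmeas_tensor_ubas.
apply: ge_ereal_inf; exists (Linf (f - cpair y1 y2)); last first.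
  by apply: Linf_sub_le => //; [exact: ltW|rewrite y1E|rewrite y2E].
exists (cpair y1 y2) => //; apply: trig_list_polys.
pose cd : R[i] := (((2 * pi) ^- d.+1 : R)%:C)%C.
pose l := [seq (cd * (t.1%:C)%C, t.2) | t <- l1] ++ [seq (cd * (0 +i* t.1)%C, t.2) | t <- l2].
have := @trig_list_sum R d.+1 (2 ^ d.+1) _ l (fun t x => t.1 * ((tensor_ubas t.2 x)%:C)%C)
  (fun t => trig_list_tensor t.1 t.2).
have -> : (fun x => \sum_(t <- l) t.1 * ((tensor_ubas t.2 x)%:C)%C) = cpair y1 y2.
  apply/funext => x; rewrite big_cat !big_map/= /cpair -/cd y1E y2E.
  have -> : ((\sum_(t <- l1) t.1 * tensor_ubas t.2 x) +i* (\sum_(t <- l2) t.1 * tensor_ubas t.2 x))%C =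
     \sum_(t <- l1) (t.1%:C)%C * ((tensor_ubas t.2 x)%:C)%C + \sum_(t <- l2) (0 +i* t.1)%C * ((tensor_ubas t.2 x)%:C)%C.
    rewrite -[LHS]/(_ +i* _)%C.
    have -> : \sum_(t <- l1) (t.1%:C)%C * ((tensor_ubas t.2 x)%:C)%C = ((\sum_(t <- l1) t.1 * tensor_ubas t.2 x)%:C)%C :> R[i].
      by rewrite rmorph_sum/=; apply: eq_bigr => t _; rewrite rmorphM.
    have -> : \sum_(t <- l2) (0 +i* t.1)%C * ((tensor_ubas t.2 x)%:C)%C = (0 +i* (\sum_(t <- l2) t.1 * tensor_ubas t.2 x))%C :> R[i].
      rewrite imaginary_sum; apply: eq_bigr => t _.
      by apply/eqP; rewrite eq_complex/= !(mul0r, mulr0) subr0 add0r !eqxx.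
    by apply/eqP; rewrite eq_complex/= addr0 add0r !eqxx.
  by rewrite mulrDr !mulr_sumr; congr (_ + _); apply: eq_bigr => t _; rewrite mulrA.
move=> [l' l's l'E]; exists l' => //; apply: leq_trans l's _.
rewrite /l size_cat !size_map; apply: (@leq_trans ((k + k) * 2 ^ d.+1)).
  by rewrite leq_mul2r leq_add ?orbT.
have : ((k + k) * 2 ^ d.+1 = 2 ^ d.+2 * k)%N by rewrite [in RHS]expnS; lia.
lia.
Qed.

End numbers.

Section number_bound.
Variables (R : realType) (d : nat) (r p : R).
Hypotheses (p_gt2 : 2 < p) (p_r : p^-1 < r) (r_lt : r < 2^-1).
Local Notation mu := (torus_measure R).
Local Notation X := (rpoint R d.+1).

Let r_gt0 : 0 < r. Proof. by apply: lt_trans p_r; rewrite invr_gt0 (lt_trans _ p_gt2). Qed.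
Let r_lt1 : r < 1. Proof. by apply: lt_trans r_lt _; rewrite invf_lt1// ltr1n. Qed.

(** [B] is the price, per unit of cost of the real approximants, of passing to complex functions and
    to the index of the quantity [s]. *)
Lemma number_le_rate (Cx : nat -> set (set (X -> R))) (s : nat -> \bar R) (B : nat) :
  approx_scheme Cx -> (0 < B)%N ->
  (forall k m M, 0 < M -> (B * k < m)%N -> ball_approx r p Cx k M -> (s m <= M%:E)%E) ->
  exists2 C : R, 0 < C & forall m, (2 <= m)%N -> (s m <= (C * rate d r m)%:E)%E.
Proof.
move=> sch B0 H.
have [C0 C00 C0P] := in_ball_le d p_gt2 p_r r_lt.
have [C C_gt0 [c c0 CP]] := in_ball_approx p_gt2 p_r r_lt sch.
apply: (@rate_transfer _ _ _ r_gt0 r_lt1 s C0 C (B * c)%N) => //.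
- by rewrite muln_gt0 B0.
- move=> m m0; apply: (H 0%N) => //; first by rewrite muln0.
  have [S CS S0] := scheme_zero sch; exists S => // f f1.
  have [mf fC] := C0P f f1; exists (fun=> 0), (fun=> 0); split => //.
  move: fC; apply: filterS => x; rewrite -[(f - _) x]/(f x - cpair _ _ x) /cpair.
  by rewrite [(0 +i* 0)%C](_ : _ = 0)// mulr0 subr0.
move=> m n n1 nm; have [k [S [kn CS SP]]] := CP n n1.
have n2 : (2 <= n)%N.
  rewrite ltnNge; apply/negP => n1'.
  have : ln (n%:R : R) <= 0 by rewrite ln_le0// lern1.
  by lra.
apply: (H k).
- by rewrite mulr_gt0// rate_gt0.
- by apply: leq_ltn_trans nm; rewrite -mulnA leq_mul2l kn orbT.
- by exists S.
Qed.

End number_bound.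

Theorem theorem6p1 (R : realType) (d : nat) (p r : R)
    (d_gt0 : (0 < d)%N) (p_gt2 : 2 < p) (r_gt : p^-1 < r) (r_lt : r < 2^-1) :
  let W := @sobolev_norm R d r p in
  let Linf := @Lp_norm R d +oo%E in
  let I : {linear cfun R d -> cfun R d} := idfun in
  let rate (m : nat) : R :=
    m%:R `^ (- r) * (ln m%:R) `^ ((d%:R - 1) * (1 - r) + r) in
  [/\ exists2 c : R, 0 < c & forall m : nat, (2 <= m)%N ->
        (kolmogorov_number W Linf I m <= (c * rate m)%:E)%E,
      exists2 c : R, 0 < c & forall m : nat, (2 <= m)%N ->
        (entropy_number W Linf I m <= (c * rate m)%:E)%E
    & exists2 c : R, 0 < c & forall m : nat, (2 <= m)%N ->
        (best_mterm W I m <= (c * rate m)%:E)%E].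
Proof.
case: d d_gt0 => [//|d] _ W Linf I rt.
have rtE m : rt m = rate d r m by rewrite /rt /rate -natr1 addrK.
split.
- have [c c0 H] := number_le_rate p_gt2 r_gt r_lt (in_span_scheme R d.+1) (ltn0Sn 0) (@kolmogorov_le R d r p).
  by exists c => // m m2; rewrite rtE; exact: H.
- have [c c0 H] := number_le_rate p_gt2 r_gt r_lt (in_list_scheme R d.+1) (ltn0Sn 1) (@entropy_le R d r p).
  by exists c => // m m2; rewrite rtE; exact: H.
- have B0 : (0 < 2 ^ d.+2)%N by rewrite expn_gt0.
  have [c c0 H] := number_le_rate p_gt2 r_gt r_lt (sparse_scheme R d.+1) B0 (@best_mterm_le R d r p).
  by exists c => // m m2; rewrite rtE; exact: H.
Qed.
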